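(* Let $V$ be a finite-dimensional real normed space, $m\ge 1$ an integer, $p\ge 1$ a real number, and let $Y$ be a $G^{m}(V)$-valued path. Then $Y$ is $1/p$-Hölder if and only if there exists a sequence $(y(n))_n$ of infinitely differentiable $V$-valued paths such that (i) the $1/p$-Hölder norm of $S_{m}(y(n))$ is bounded uniformly in $n$, and (ii) $S_{m}(y(n))$ converges pointwise on $[0,1]$ to $Y$. In particular, given a $G^m(V)$-valued path $Y$ that is $\alpha$-Hölder with $\alpha=1/p$, there is a sequence of signatures $S_m(y(n))$ of smooth paths that converges to $Y$ in the $\alpha'$-Hölder distance for every $\alpha'\in(0,\alpha)$.
   Context: $T^{(m)}(V)=\bigoplus_{n=0}^{m}V^{\otimes n}$ is the truncated tensor algebra with (truncated) product $\otimes$; $\mathcal{G}^{m}(V)$ is its Lie subalgebra generated by $V$ for the bracket $[a,b]=a\otimes b-b\otimes a$; $G^{m}(V)=\exp(\mathcal{G}^{m}(V))$ is the free nilpotent Lie group of step $m$ over $V$, with product $\otimes$ and neutral element $1$. The dilation is $\delta_{t}(1+v_{1}+\dots+v_{m})=1+tv_{1}+\dots+t^{m}v_{m}$, $v_i\in V^{\otimes i}$, $t\in\mathbb{R}$. $\|\cdot\|_{m}$ is a fixed symmetric subadditive homogeneous norm on $G^{m}(V)$, i.e. a function $G^m(V)\to[0,\infty)$ with $\|g\|_m=0$ iff $g=1$, $\|\delta_t g\|_m=|t|\,\|g\|_m$, $\|g\otimes h\|_m\le\|g\|_m+\|h\|_m$, $\|g^{-1}\|_m=\|g\|_m$ (for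 instance the Carnot–Caratheodory norm; all such norms are equivalent since $\dim V<\infty$). Set $d_{m}(g,h)=\|g^{-1}\otimes h\|_{m}$. A $G^m(V)$-valued path is a continuous map $[0,1]\to G^{m}(V)$ starting at $1$; for such a path $Y_{s,t}:=Y_{s}^{-1}\otimes Y_{t}$. For a smooth path $y:[0,1]\to V$, the signature is $S_{m}(y)_{s,t}=1+\sum_{k=1}^{m}\int_{s<u_{1}<\dots<u_{k}<t}dy_{u_{1}}\otimes\dots\otimes dy_{u_{k}}\in G^{m}(V)$, and $S_m(y)$ denotes the $G^m(V)$-valued path $t\mapsto S_m(y)_{0,t}$. For $\alpha\in(0,1]$ the $\alpha$-Hölder distance between $G^m(V)$-valued paths is $\sup_{0\le s<t\le 1}\frac{d_{m}(x_{s,t},y_{s,t})}{(t-s)^{\alpha}}$; the $\alpha$-Hölder norm of $x$ is its $\alpha$-Hölder distance to the constant path $1$, i.e. $\sup_{s<t}\|x_{s,t}\|_m/(t-s)^\alpha$, and $x$ is $\alpha$-Hölder if this is finite. *)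

(* Defs.v *)
From HB Require Import structures.
From mathcomp Require Import all_boot all_order all_algebra.
From mathcomp Require Import all_classical all_reals all_analysis.

Set Implicit Arguments.
Unset Strict Implicit.
Unset Printing Implicit Defensive.

Import Order.TTheory GRing.Theory Num.Theory.
Import numFieldNormedType.Exports.

Local Open Scope classical_set_scope.
Local Open Scope ring_scope.

(* Finite-dimensional normed spaces. *)
#[short(type="normedVectType")]
HB.structure Definition NormedVector (R : realType) :=
  {V of NormedModule R V & Vector R V}.

HB.instance Definition _ (R : realType) (m n : nat) := Vector.on 'M[R]_(m, n).

(* Tensors are represented by their coordinates in the basis of V^{(x)n}
   induced by the basis [vbasis fullv] of V: the coefficient at the word
   [:: i_1; ...; i_n] is that of e_{i_1} (x) ... (x) e_{i_n}.  Words have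
   length at most m, so the truncation is built in. *)
Definition letter (R : realType) (V : normedVectType R) : finType :=
  'I_(\dim (fullv : {vspace V})).

Definition ttensor (R : realType) (V : normedVectType R) (m : nat) : Type :=
  {ffun m.-bseq (letter V) -> R}.

HB.instance Definition _ (R : realType) (V : normedVectType R) (m : nat) :=
  GRing.Lmodule.copy (ttensor V m) {ffun m.-bseq (letter V) -> R^o}.

Definition vcoord (R : realType) (V : normedVectType R) (i : letter V) (v : V)
  : R := coord (vbasis fullv) i v.

Section TruncatedTensorAlgebra.
Variables (R : realType) (V : normedVectType R) (m : nat).
Implicit Types (a b c : ttensor V m) (w : m.-bseq (letter V)).
Local Notation T := (ttensor V m).
Local Notation L := (letter V).

(* coefficient at an arbitrary word; it is 0 beyond the truncation *)
Definition tcoef a (s : seq L) : R :=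
  oapp (a : {ffun m.-bseq L -> R}) 0 (insub s).

Definition tensor_of (f : seq L -> R) : T := [ffun w : m.-bseq L => f w].

Definition tone : T := tensor_of (fun s => (size s == 0%N)%:R).

(* (u_1 (x) ... (x) u_k) (x) (v_1 (x) ... (x) v_l) is concatenation, so the
   coefficient of a product at s sums over the ways of cutting s in two. *)
Definition tmul a b : T :=
  tensor_of (fun s => \sum_(k < (size s).+1) tcoef a (take k s) * tcoef b (drop k s)).

Lemma tcoef_tensor_of f (s : seq L) : (size s <= m)%N ->
  tcoef (tensor_of f) s = f s.
Proof. by move=> sm; rewrite /tcoef insubT /= ffunE. Qed.

Lemma ttensorP a b : (forall w, tcoef a w = tcoef b w) -> a = b.
Proof. by move=> eab; apply/ffunP => w; move: (eab w); rewrite /tcoef !valK. Qed.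

Lemma tcoefD a b s : tcoef (a + b) s = tcoef a s + tcoef b s.
Proof. by rewrite /tcoef; case: insub => [w|] /=; rewrite ?addr0 // ffunE. Qed.

Lemma tcoefZ (x : R) a s : tcoef (x *: a) s = x * tcoef a s.
Proof. by rewrite /tcoef; case: insub => [w|] /=; rewrite ?mulr0 // ffunE. Qed.

Lemma tcoef0 s : tcoef 0 s = 0.
Proof. by rewrite -(scale0r (0 : T)) tcoefZ mul0r. Qed.

Local Lemma tcoef1 w : tcoef tone w = (size w == 0%N)%:R.
Proof. by rewrite tcoef_tensor_of // size_bseq. Qed.

Local Lemma tcoefM a b w : tcoef (tmul a b) w =
  \sum_(k < (size w).+1) tcoef a (take k w) * tcoef b (drop k w).
Proof. by rewrite tcoef_tensor_of // size_bseq. Qed.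

Local Definition conv (f g : seq L -> R) (s : seq L) : R :=
  \sum_(k < (size s).+1) f (take k s) * g (drop k s).

Local Lemma conv0 f g : conv f g [::] = f [::] * g [::].
Proof. by rewrite /conv big_ord_recl big_ord0 addr0. Qed.

Local Lemma convS f g i s :
  conv f g (i :: s) = f [::] * g (i :: s) + conv (fun u => f (i :: u)) g s.
Proof. by rewrite /conv big_ord_recl. Qed.

Local Lemma convDl f1 f2 g x s :
  conv (fun u => x * f1 u + f2 u) g s = x * conv f1 g s + conv f2 g s.
Proof.
rewrite /conv mulr_sumr -big_split; apply: eq_bigr => k _ /=.
by rewrite mulrDl mulrA.
Qed.

Local Lemma convA f g h s : conv f (conv g h) s = conv (conv f g) h s.
Proof.
elim: s f g h => [|i s IH] f g h; first by rewrite !conv0 mulrA.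
rewrite !convS IH conv0 mulrDr mulrA -addrA; congr (_ + _).
rewrite -convDl; congr (conv _ _ _); apply/funext => u.
by rewrite convS.
Qed.

Local Lemma eq_conv f g f' g' s :
  (forall u, (size u <= size s)%N -> f u = f' u) ->
  (forall u, (size u <= size s)%N -> g u = g' u) -> conv f g s = conv f' g' s.
Proof.
move=> ef eg; apply: eq_bigr => k _; rewrite ef ?eg //.
  by rewrite size_drop leq_subr.
by rewrite size_take_min geq_minr.
Qed.

Local Lemma tmulA : associative tmul.
Proof.
move=> a b c; apply: ttensorP => w; rewrite !tcoefM -!/(conv _ _ _).
have wm := size_bseq w.
rewrite (@eq_conv _ _ (tcoef a) (conv (tcoef b) (tcoef c))) //; last first.
  by move=> u uw; apply: tcoef_tensor_of; apply: leq_trans wm.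
rewrite convA; apply: eq_conv => // u uw; apply/esym/tcoef_tensor_of.
exact: leq_trans wm.
Qed.

Local Lemma tmul1l : left_id tone tmul.
Proof.
move=> a; apply: ttensorP => w; rewrite tcoefM big_ord_recl /= big1 ?addr0.
  by rewrite take0 drop0 tcoef_tensor_of // mul1r.
move=> k _; rewrite tcoef_tensor_of /bump /= add1n size_take_min.
  by rewrite (minn_idPl (ltn_ord k)) mul0r.
exact: leq_trans (geq_minr _ _) (size_bseq w).
Qed.

Local Lemma tmul1r : right_id tone tmul.
Proof.
move=> a; apply: ttensorP => w; rewrite tcoefM big_ord_recr /= big1 ?add0r.
  by rewrite take_size drop_size tcoef_tensor_of // mulr1.
move=> k _; rewrite tcoef_tensor_of /= size_drop.
  by rewrite subn_eq0 leqNgt ltn_ord mulr0.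
exact: leq_trans (leq_subr _ _) (size_bseq w).
Qed.

Local Lemma tmulDl : left_distributive tmul +%R.
Proof.
move=> a b c; apply: ttensorP => w; rewrite tcoefD !tcoefM -big_split.
by apply: eq_bigr => k _; rewrite tcoefD mulrDl.
Qed.

Local Lemma tmulDr : right_distributive tmul +%R.
Proof.
move=> a b c; apply: ttensorP => w; rewrite tcoefD !tcoefM -big_split.
by apply: eq_bigr => k _; rewrite tcoefD mulrDr.
Qed.

Local Lemma tone_neq0 : tone != 0.
Proof.
apply/eqP => /(congr1 (fun a : T => tcoef a [::])).
by rewrite tcoef_tensor_of // tcoef0 => /eqP; rewrite oner_eq0.
Qed.

HB.instance Definition _ := GRing.Zmodule_isNzRing.Build T
  tmulA tmul1l tmul1r tmulDl tmulDr tone_neq0.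

Local Lemma tscaleAl (x : R) (a b : T) : x *: (a * b) = (x *: a) * b.
Proof.
apply: ttensorP => w; rewrite tcoefZ !tcoefM mulr_sumr.
by apply: eq_bigr => k _; rewrite tcoefZ mulrA.
Qed.

HB.instance Definition _ := GRing.Lmodule_isLalgebra.Build R T tscaleAl.

Local Lemma tscaleAr (x : R) (a b : T) : x *: (a * b) = a * (x *: b).
Proof.
apply: ttensorP => w; rewrite tcoefZ !tcoefM mulr_sumr.
by apply: eq_bigr => k _; rewrite tcoefZ mulrCA.
Qed.

HB.instance Definition _ := GRing.Lalgebra_isAlgebra.Build R T tscaleAr.

Lemma tcoef_mul (a b : T) s : (size s <= m)%N -> tcoef (a * b) s =
  \sum_(k < (size s).+1) tcoef a (take k s) * tcoef b (drop k s).
Proof. exact: tcoef_tensor_of. Qed.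

Lemma tcoef_one s : (size s <= m)%N -> tcoef 1 s = (size s == 0%N)%:R.
Proof. exact: tcoef_tensor_of. Qed.

(* scalar component *)
Definition tconst a : R := tcoef a [::].

Local Lemma tconstM a b : tconst (a * b) = tconst a * tconst b.
Proof. by rewrite /tconst tcoef_mul // big_ord_recl big_ord0 addr0. Qed.

Local Lemma tnilp a k s : tconst a = 0 -> (size s <= m)%N -> (size s < k)%N ->
  tcoef (a ^+ k) s = 0.
Proof.
move=> a0; elim: k s => // k IH s sm sk; rewrite exprS tcoef_mul //.
rewrite big_ord_recl big1 /= ?addr0.
  by rewrite take0 -/(tconst a) a0 mul0r.
move=> i _; rewrite IH ?mulr0 // size_drop /bump /= ?add1n.
  exact: leq_trans (leq_subr _ _) sm.
case: (size s) sk i => [|n] nk i; first by case: i.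
by rewrite subSS; apply: leq_ltn_trans (leq_subr _ _) _.
Qed.

Definition tinv a : T :=
  if tconst a == 0 then a
  else (tconst a)^-1 *: \sum_(k < m.+1) (1 - (tconst a)^-1 *: a) ^+ k.

Local Lemma tinvE a : tconst a != 0 -> tinv a * a = 1 /\ a * tinv a = 1.
Proof.
move=> a0; rewrite /tinv (negbTE a0).
set c := tconst a in a0 *; set z := 1 - c^-1 *: a.
have az : a = c *: (1 - z) by rewrite /z opprB addrC subrK scalerA divff ?scale1r.
have zm : z ^+ m.+1 = 0.
  apply: ttensorP => w; rewrite tnilp ?ltnS ?size_bseq ?tcoef0 //.
  rewrite /tconst /z -scaleN1r !tcoefD !tcoefZ tcoef_one //= -/(tconst a).
  by rewrite mulVf // mulN1r subrr.
have zS : (1 - z) * \sum_(k < m.+1) z ^+ k = 1.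
  by rewrite -opprB mulNr -subrX1 zm sub0r opprK.
have zC : (\sum_(k < m.+1) z ^+ k) * (1 - z) = (1 - z) * \sum_(k < m.+1) z ^+ k.
  apply/esym/commr_sum => k _; apply: commrX.
  by apply/commr_sym/commrB; [exact: commr1|exact: commr_refl].
rewrite {1 2}az -!scalerAl -!scalerAr !scalerA zC zS.
by rewrite mulVf // divff // scale1r.
Qed.

Local Lemma tmulVr : {in [pred a | tconst a != 0], left_inverse (1 : T) tinv *%R}.
Proof. by move=> a a0; case: (tinvE a0). Qed.

Local Lemma tdivrr : {in [pred a | tconst a != 0], right_inverse (1 : T) tinv *%R}.
Proof. by move=> a a0; case: (tinvE a0). Qed.

Local Lemma tunitP (a b : T) : b * a = 1 /\ a * b = 1 -> [pred a | tconst a != 0] a.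
Proof.
case=> + _ => /(congr1 tconst); rewrite tconstM [X in _ = X]tcoef_one //= => ab.
by apply/eqP => a0; move/eqP: ab; rewrite a0 mulr0 eq_sym oner_eq0.
Qed.

Local Lemma tinv_out : {in [predC [pred a | tconst a != 0]], tinv =1 id}.
Proof. by move=> a; rewrite /tinv !inE negbK => ->. Qed.

HB.instance Definition _ := GRing.NzRing_hasMulInverse.Build T
  tmulVr tdivrr tunitP tinv_out.

Definition tvec (v : V) : T :=
  tensor_of (fun s => if s is [:: i] then vcoord i v else 0).

Definition texp a : T := \sum_(k < m.+1) (k`!%:R : R)^-1 *: a ^+ k.

Definition dilation (t : R) a : T :=
  tensor_of (fun s => t ^+ size s * tcoef a s).

Definition lie_subalgebra (A : set T) : Prop :=
  [/\ A 0,
      forall (x : R) a b, A a -> A b -> A (x *: a + b) &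
      forall a b, A a -> A b -> A (a * b - b * a)].

Definition free_lie : set T := smallest lie_subalgebra (range tvec).

Definition free_group : set T := texp @` free_lie.

(* Only the values of N on the free nilpotent group are constrained. *)
Record homogeneous_norm (N : T -> R) : Prop := {
  hnorm_ge0 : forall g, free_group g -> 0 <= N g;
  hnorm_eq0 : forall g, free_group g -> (N g = 0 <-> g = 1);
  hnorm_dilation : forall t g, free_group g -> N (dilation t g) = `|t| * N g;
  hnorm_mul : forall g h, free_group g -> free_group h -> N (g * h) <= N g + N h;
  hnorm_inv : forall g, free_group g -> N g^-1 = N g
}.

Definition hdist (N : T -> R) (g h : T) : R := N (g^-1 * h).

(* Paths on [0, 1] are functions on R of which only the values on [0, 1]
   matter.  The topology of the finite-dimensional space T is that of
   coefficientwise convergence. *)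
Definition group_path (Y : R -> T) : Prop :=
  [/\ forall t : R, t \in `[0, 1] -> free_group (Y t),
      Y 0 = 1 &
      forall s, {within `[0, 1], continuous (fun t => tcoef (Y t) s)}].

Definition increment (Y : R -> T) (s t : R) : T := (Y s)^-1 * Y t.

Definition holder_dist (N : T -> R) (alpha : R) (X Y : R -> T) : \bar R :=
  ereal_sup [set r | exists s t : R, [/\ 0 <= s, s < t, t <= 1 &
    r = (hdist N (increment X s t) (increment Y s t) / (t - s) `^ alpha)%:E]].

Definition holder_norm (N : T -> R) (alpha : R) (X : R -> T) : \bar R :=
  holder_dist N alpha X (fun _ => 1).

Definition is_holder (N : T -> R) (alpha : R) (X : R -> T) : Prop :=
  (holder_norm N alpha X < +oo)%E.

End TruncatedTensorAlgebra.

Section SmoothPaths.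
Variables (R : realType) (V : normedVectType R).

Definition quotient01 (y : R -> V) (t u : R) : V := (u - t)^-1 *: (y u - y t).

(* punctured neighbourhoods of t within [0, 1]; derivatives are one-sided at
   the end points *)
Definition nbhs01 (t : R) : set_system R := within `[0, 1] t^'.

Definition derive01 (y : R -> V) (t : R) : V := lim (quotient01 y t @ nbhs01 t).

Definition smooth_path (y : R -> V) : Prop :=
  forall (k : nat) (t : R), t \in `[0, 1] ->
    cvg (quotient01 (iter k derive01 y) t @ nbhs01 t).

(* Iterated integral along a word read from its last letter, which carries the
   outermost integration variable:
   int_{s<u_k<t} ( ... int_{s<u_1<u_2} dy^{i_1}_{u_1} ... ) dy^{i_k}_{u_k}. *)
Fixpoint iterated_integral (y : R -> V) (s : R) (r : seq (letter V)) (t : R)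
    : R :=
  if r is i :: r' then
    \int[lebesgue_measure]_(u in `]s, t[)
      (iterated_integral y s r' u * vcoord i (derive01 y u))
  else 1.

Definition signature (m : nat) (y : R -> V) (s t : R) : ttensor V m :=
  tensor_of m (fun w => iterated_integral y s (rev w) t).

Definition signature_path (m : nat) (y : R -> V) (t : R) : ttensor V m :=
  signature m y 0 t.

End SmoothPaths.

(* Main.v *)
(* If the signatures converge pointwise with bounded Hoelder norms, the limit is
   Hoelder because [N] is lower semicontinuous on the free nilpotent group.
   Conversely, the bounded generation of the group by horizontal exponentials
   (Chow) lets one interpolate a Hoelder path [Y] on a uniform grid: each increment
   of [Y] is a product of a fixed number of factors [texp (tvec v)], with [N] of
   each factor at most a constant times [N] of the increment, and these factors are
   run through in turn with a smooth time change that is flat at the break points.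
   The resulting path is smooth, its signature is the product of the factors, it is
   Lipschitz at the scale of the grid, hence uniformly Hoelder, and it agrees with
   [Y] on the grid; interpolation gives convergence in every smaller exponent.

   The group is handled through the Dynkin map [dynkin]: an element without scalar
   part is Lie iff [dynkin a = tdeg a], where [tdeg] is the degree derivation, and
   [g] with scalar part [1] is in the group iff [g^-1 * tdeg g] is Lie.  These are
   closed conditions, and a linear flow [X' = X a] with [a] Lie preserves the second;
   this gives at once that the group is closed under products and that signatures
   belong to it.  Chow's theorem follows degree by degree from commutators, with
   explicit coefficients supplied by the Dynkin map.  No continuity of [N] is
   assumed: the upper bound on [N] comes from Chow's theorem, and then the lower
   bound from compactness. *)

Require Import Defs.
From HB Require Import structures.
From mathcomp Require Import all_boot all_order all_algebra.
From mathcomp Require Import all_classical all_reals all_analysis.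
From mathcomp Require Import ring lra zify.

Set Implicit Arguments.
Unset Strict Implicit.
Unset Printing Implicit Defensive.

Import Order.TTheory GRing.Theory Num.Theory.
Import numFieldNormedType.Exports.

Local Open Scope classical_set_scope.
Local Open Scope ring_scope.

(** * Words of bounded length and sums over them *)

Section Words.
Variable L : finType.

(** One fact of calculus drives the algebra: a real function with zero derivative is constant.
    Coefficients of a curve are real functions, and multiplying or bracketing by an element without
    scalar part raises the degree, so a linear equation is solved, and a property propagated along
    it, degree by degree in finitely many steps.

    The distance [d_m] is only left invariant. If two paths share their grid values, the increment
    of one followed back along the other is a small element conjugated by an increment of [Y], up to
    small factors at both ends. Uniform closeness thus rests on continuity of conjugation at 1,
    uniformly over [N]-bounded sets, which is estimated in a submultiplicative norm of the
    coefficients.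

    The condition [p >= 1] enters through scales: for mesh [h] the interpolating path has speed of
    order [h^(al - 1)], and [h^(al - 1) u <= u^al] for [u <= h] because [al <= 1]. The number of
    factors per cell is constant because each increment is first brought to norm 1 by a dilation,
    then dilated back. *)

Fixpoint words (n : nat) : seq (seq L) :=
  if n is n'.+1 then
    [::] :: flatten [seq [seq i :: w | w <- words n'] | i <- enum L]
  else [:: [::]].

Lemma mem_words n w : (w \in words n) = (size w <= n)%N.
Proof.
elim: n w => [|n IH] [|i w] //=; rewrite in_cons /= ltnS -IH.
apply/flatten_mapP/idP => [[j _ /mapP[u uw [_ ->]]] //|wn].
by exists i; rewrite ?mem_enum //; apply/mapP; exists w.
Qed.

Lemma big_words0 (M : nmodType) (F : seq L -> M) :
  \sum_(w <- words 0) F w = F [::].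
Proof. by rewrite big_seq1. Qed.

Lemma big_wordsS (M : nmodType) n (F : seq L -> M) :
  \sum_(w <- words n.+1) F w = F [::] + \sum_i \sum_(w <- words n) F (i :: w).
Proof.
rewrite big_cons big_flatten /= big_map big_enum /=; congr (_ + _).
by apply: eq_bigr => i _; rewrite big_map.
Qed.

Lemma big_words_widen (M : nmodType) k n (F : seq L -> M) : (k <= n)%N ->
  (forall w, (k < size w)%N -> F w = 0) ->
  \sum_(w <- words k) F w = \sum_(w <- words n) F w.
Proof.
elim: k n F => [|k IH] [|n] F // kn F0.
  rewrite big_words0 big_wordsS big1 ?addr0 // => i _.
  by rewrite big1 // => w _; rewrite F0.
rewrite !big_wordsS; congr (_ + _); apply: eq_bigr => i _.
by apply: IH => // w kw; apply: F0.
Qed.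

(** Cutting a word inverts concatenation: the cuts of words of length at most [n] are the pairs of
    total length at most [n]. This turns the coefficients of a product, sums over cuts, into double
    sums over words. *)
Lemma big_words_cat (M : nmodType) n (h : seq L -> seq L -> M) :
  \sum_(w <- words n) \sum_(k < (size w).+1) h (take k w) (drop k w) =
  \sum_(u <- words n) \sum_(v <- words (n - size u)) h u v.
Proof.
elim: n h => [|n IH] h.
  by rewrite big_words0 big_words0 big_words0 big_ord_recl big_ord0 addr0.
rewrite big_wordsS [RHS]big_wordsS /= big_wordsS big_ord_recl big_ord0 addr0.
rewrite -addrA; congr (_ + _); rewrite -big_split; apply: eq_bigr => i _ /=.
rewrite -(IH (fun u v => h (i :: u) v)) -big_split; apply: eq_bigr => w _ /=.
by rewrite big_ord_recl.
Qed.

Lemma big_words_nil (M : nmodType) n (F : seq L -> M) :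
  (forall w, w != [::] -> F w = 0) -> \sum_(w <- words n) F w = F [::].
Proof.
case: n => [|n] F0; first by rewrite big_words0.
rewrite big_wordsS big1 ?addr0 // => i _.
by rewrite big1 // => w _; rewrite F0.
Qed.

Lemma big_words_letter (M : nmodType) n (F : seq L -> M) : (0 < n)%N ->
  (forall w, size w != 1%N -> F w = 0) ->
  \sum_(w <- words n) F w = \sum_i F [:: i].
Proof.
case: n => // n _ F0.
rewrite big_wordsS F0 // add0r; apply: eq_bigr => i _.
by apply: big_words_nil => -[|j w] // _; rewrite F0.
Qed.

Lemma big_words_widen_le (R : numDomainType) k n (F : seq L -> R) : (k <= n)%N ->
  (forall w, 0 <= F w) ->
  \sum_(w <- words k) F w <= \sum_(w <- words n) F w.
Proof.
elim: k n F => [|k IH] [|n] F // kn F0.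
  rewrite big_words0 big_wordsS lerDl.
  by apply: sumr_ge0 => i _; apply: sumr_ge0.
rewrite !big_wordsS lerD2l; apply: ler_sum => i _.
exact: IH.
Qed.

End Words.

(** * Degree filtration and degree derivation *)

Section TensorAlgebra.
Variables (R : realType) (V : normedVectType R) (m : nat).
Local Notation T := (ttensor V m).
Local Notation L := (letter V).
Implicit Types (a b c g h : T) (w u v s : seq L) (k n : nat).

Lemma tcoef_gt a s : (m < size s)%N -> tcoef a s = 0.
Proof. by move=> ms; rewrite /tcoef insubF // leqNgt ms. Qed.

Lemma tcoefE (f : seq L -> R) s :
  tcoef (tensor_of m f) s = if (size s <= m)%N then f s else 0.
Proof.
by case: leqP => [/tcoef_tensor_of->|/tcoef_gt->].
Qed.

Lemma tcoefN a s : tcoef (- a) s = - tcoef a s.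
Proof. by rewrite -scaleN1r tcoefZ mulN1r. Qed.

Lemma tcoefB a b s : tcoef (a - b) s = tcoef a s - tcoef b s.
Proof. by rewrite tcoefD tcoefN. Qed.

Lemma tcoef_sum I (r : seq I) (P : pred I) (F : I -> T) s :
  tcoef (\sum_(i <- r | P i) F i) s = \sum_(i <- r | P i) tcoef (F i) s.
Proof.
apply: (big_morph (fun a => tcoef a s)); last exact: tcoef0.
by move=> a b; apply: tcoefD.
Qed.

Lemma tconst_mul a b : tconst (a * b) = tconst a * tconst b.
Proof. by rewrite /tconst tcoef_mul // big_ord_recl big_ord0 addr0. Qed.

Lemma tconst1 : tconst (1 : T) = 1.
Proof. by rewrite /tconst tcoef_one. Qed.

Lemma unitTE a : (a \is a GRing.unit) = (tconst a != 0).
Proof. by []. Qed.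

(** Linear extension of [f] from words, that is from basis tensors; [dynkin] and [ract] are
    instances. *)
Definition wsum (M : lmodType R) (f : seq L -> M) (a : T) : M :=
  \sum_(w <- words L m) tcoef a w *: f w.

Lemma wsum_linear (M : lmodType R) (f : seq L -> M) : linear (wsum f).
Proof.
move=> x a b; rewrite /wsum scaler_sumr -big_split; apply: eq_bigr => w _ /=.
by rewrite tcoefD tcoefZ scalerDl scalerA.
Qed.
HB.instance Definition _ (M : lmodType R) (f : seq L -> M) :=
  GRing.isLinear.Build R T M *:%R (wsum f) (wsum_linear f).

(** The pairs [u], [v] that the truncated product drops contribute nothing on the right, because [f]
    vanishes on words longer than [m]. *)
Lemma wsum_mul (M : lmodType R) (f : seq L -> M) a b :
  (forall w, (m < size w)%N -> f w = 0) ->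
  wsum f (a * b) = \sum_(u <- words L m) \sum_(v <- words L m)
    (tcoef a u * tcoef b v) *: f (u ++ v).
Proof.
move=> f0; rewrite /wsum.
rewrite (eq_big_seq (fun w => \sum_(k < (size w).+1)
   (tcoef a (take k w) * tcoef b (drop k w)) *: f (take k w ++ drop k w))).
  rewrite (big_words_cat _ (fun u v => (tcoef a u * tcoef b v) *: f (u ++ v))).
  apply: eq_bigr => u _; apply: big_words_widen; first exact: leq_subr.
  by move=> v muv; rewrite f0 ?scaler0 // size_cat; lia.
move=> w; rewrite mem_words => wm; rewrite tcoef_mul // scaler_suml.
by apply: eq_bigr => k _; rewrite cat_take_drop.
Qed.

(** The filtration by lowest degree, in which every statement modulo higher degree is phrased. It is
    multiplicative ([lowM]) and trivial from [m.+1] on ([low_eq0]), so inductions on the degree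
    stop. *)
Definition low k a := forall w, (size w < k)%N -> tcoef a w = 0.

Lemma low0 a : low 0 a. Proof. by []. Qed.

Lemma low_zero k : low k 0. Proof. by move=> w _; rewrite tcoef0. Qed.

Lemma lowD k a b : low k a -> low k b -> low k (a + b).
Proof. by move=> la lb w wk; rewrite tcoefD la ?lb ?addr0. Qed.

Lemma lowZ k (x : R) a : low k a -> low k (x *: a).
Proof. by move=> la w wk; rewrite tcoefZ la ?mulr0. Qed.

Lemma lowN k a : low k a -> low k (- a).
Proof. by rewrite -scaleN1r; apply: lowZ. Qed.

Lemma lowB k a b : low k a -> low k b -> low k (a - b).
Proof. by move=> la /lowN lb; apply: lowD. Qed.

Lemma low_le k n a : (k <= n)%N -> low n a -> low k a.
Proof. by move=> kn la w wk; apply: la; apply: leq_trans kn. Qed.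

Lemma low_sum k I (r : seq I) (P : pred I) (F : I -> T) :
  (forall i, P i -> low k (F i)) -> low k (\sum_(i <- r | P i) F i).
Proof.
move=> lF; apply: big_ind => //; [exact: low_zero|exact: lowD].
Qed.

Lemma lowM k n a b : low k a -> low n b -> low (k + n) (a * b).
Proof.
move=> la lb w wkn; case: (leqP (size w) m) => wm; last exact: tcoef_gt.
rewrite tcoef_mul // big1 // => -[j /= jw] _.
case: (ltnP j k) => jk.
  by rewrite la ?mul0r // size_take_min; apply: leq_ltn_trans jk; apply: geq_minl.
have jw' : (j <= size w)%N by rewrite -ltnS.
rewrite lb ?mulr0 // size_drop ltn_subLR // (leq_trans wkn) //.
by rewrite leq_add2r.
Qed.

Lemma lowMl k a b : low k a -> low k (a * b).
Proof. by move=> la; rewrite -[k]addn0; apply: lowM => //. Qed.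

Lemma lowMr k a b : low k b -> low k (a * b).
Proof. by move=> lb; rewrite -[k]add0n; apply: lowM => //. Qed.

Lemma low_const a : low 1 a <-> tconst a = 0.
Proof. by split=> [la|a0 [|//] _]; [exact: la|]. Qed.

Lemma low_eq0 a : low m.+1 a -> a = 0.
Proof.
move=> la; apply: ttensorP => w; rewrite tcoef0 la // ltnS; exact: size_bseq.
Qed.

Lemma low_X a k : low 1 a -> low k (a ^+ k).
Proof.
move=> la; elim: k => // k IH; rewrite exprS -add1n; exact: lowM.
Qed.

Lemma nilp_X a k : low 1 a -> (m < k)%N -> a ^+ k = 0.
Proof. by move=> la mk; apply: low_eq0; apply: low_le mk _; apply: low_X. Qed.

Definition tdeg a : T := tensor_of m (fun w => (size w)%:R * tcoef a w).
(** Inverse of [tdeg] on tensors without scalar part; the convention [0^-1 = 0] makes it kill the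
    scalar part. *)
Definition tdegi a : T := tensor_of m (fun w => (size w)%:R^-1 * tcoef a w).

Lemma tcoef_deg a w : tcoef (tdeg a) w = (size w)%:R * tcoef a w.
Proof. by rewrite tcoefE; case: leqP => // /tcoef_gt->; rewrite mulr0. Qed.

Lemma tcoef_degi a w : tcoef (tdegi a) w = (size w)%:R^-1 * tcoef a w.
Proof. by rewrite tcoefE; case: leqP => // /tcoef_gt->; rewrite mulr0. Qed.

Lemma tdeg_linear : linear tdeg.
Proof.
move=> x a b; apply: ttensorP => w.
by rewrite !(tcoefD, tcoefZ, tcoef_deg) mulrDr mulrCA.
Qed.
HB.instance Definition _ := GRing.isLinear.Build R T T *:%R tdeg tdeg_linear.

Lemma tdegi_linear : linear tdegi.
Proof.
move=> x a b; apply: ttensorP => w.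
by rewrite !(tcoefD, tcoefZ, tcoef_degi) mulrDr mulrCA.
Qed.
HB.instance Definition _ := GRing.isLinear.Build R T T *:%R tdegi tdegi_linear.

Lemma low_deg k a : low k a -> low k (tdeg a).
Proof. by move=> la w wk; rewrite tcoef_deg la ?mulr0. Qed.

Lemma low_degi k a : low k a -> low k (tdegi a).
Proof. by move=> la w wk; rewrite tcoef_degi la ?mulr0. Qed.

Lemma low1_deg a : low 1 (tdeg a).
Proof. by move=> [|//] _; rewrite tcoef_deg mul0r. Qed.

Lemma tdegK a : low 1 a -> tdegi (tdeg a) = a.
Proof.
move=> la; apply: ttensorP => w; rewrite tcoef_degi tcoef_deg.
case: (posnP (size w)) => [w0|w0]; first by rewrite la ?mulr0 // w0.
by rewrite mulrA mulVf ?mul1r // pnatr_eq0 -lt0n.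
Qed.

Lemma tdegiK a : low 1 a -> tdeg (tdegi a) = a.
Proof.
move=> la; apply: ttensorP => w; rewrite tcoef_deg tcoef_degi.
case: (posnP (size w)) => [w0|w0]; first by rewrite la ?mulr0 // w0.
by rewrite mulrA mulfV ?mul1r // pnatr_eq0 -lt0n.
Qed.

Lemma tdegM a b : tdeg (a * b) = tdeg a * b + a * tdeg b.
Proof.
apply: ttensorP => w; have wm := size_bseq w.
rewrite tcoef_deg tcoefD !tcoef_mul // mulr_sumr -big_split.
apply: eq_bigr => -[k kw] _ /=; rewrite !tcoef_deg size_takel // size_drop.
by rewrite natrB //; ring.
Qed.

Lemma tdeg1 : tdeg 1 = 0.
Proof.
apply: ttensorP => w; rewrite tcoef_deg tcoef0 tcoef_one ?size_bseq //.
by case: eqP => [->|_]; rewrite ?mul0r ?mulr0.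
Qed.

Definition tbr a b : T := a * b - b * a.

Lemma tbrZl x a b : tbr (x *: a) b = x *: tbr a b.
Proof. by rewrite /tbr -scalerAl -scalerAr scalerBr. Qed.

Lemma tbrZr x a b : tbr a (x *: b) = x *: tbr a b.
Proof. by rewrite /tbr -scalerAl -scalerAr scalerBr. Qed.

Lemma tbrDl a b c : tbr (a + b) c = tbr a c + tbr b c.
Proof. by rewrite /tbr mulrDl mulrDr opprD addrACA. Qed.

End TensorAlgebra.

(* Products are generalized first, for otherwise they are unfolded in the
   search for sums. *)
Ltac tlin :=
  repeat match goal with |- context [@GRing.mul ?A ?a ?b] =>
    let x := fresh "x" in set x := (@GRing.mul A a b); clearbody x
  end;
  apply: ttensorP => ?; rewrite !(tcoefD, tcoefN, tcoefZ, tcoef0); ring.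

(** * Lie elements and the Dynkin map *)

Section FreeLie.
Variables (R : realType) (V : normedVectType R) (m : nat).
Local Notation T := (ttensor V m).
Local Notation L := (letter V).
Implicit Types (v : V) (a b c g h x y : T) (w u : seq L) (k n : nat).

Lemma tbr_linearl b : linear ((@tbr R V m)^~ b).
Proof. by move=> x a c; rewrite tbrDl tbrZl. Qed.

Lemma tbrDr a b c : tbr a (b + c) = tbr a b + tbr a c.
Proof. by rewrite /tbr mulrDl mulrDr opprD addrACA. Qed.

Lemma low_br k n a b : low k a -> low n b -> low (k + n) (tbr a b).
Proof. by move=> la lb; apply: lowB; last rewrite addnC; apply: lowM. Qed.

Lemma tdeg_br a b : tdeg (tbr a b) = tbr (tdeg a) b + tbr a (tdeg b).
Proof.
by rewrite /tbr linearB /= !tdegM; tlin.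
Qed.

Lemma tconst_br a b : tconst (tbr a b) = 0.
Proof. by rewrite /tconst tcoefB -!/(tconst _) !tconst_mul mulrC subrr. Qed.

Definition basis (i : L) : V := (vbasis (fullv : {vspace V}))`_i.

Lemma vcoord_basis (i j : L) : vcoord j (basis i) = (i == j)%:R.
Proof. by rewrite /vcoord coord_free // (basis_free (vbasisP _)). Qed.

Lemma vcoord_sum (v : V) : v = \sum_i vcoord i v *: basis i.
Proof. by rewrite -coord_vbasis // memvf. Qed.

Lemma vcoordD (i : L) (u v : V) : vcoord i (u + v) = vcoord i u + vcoord i v.
Proof. by rewrite /vcoord linearD. Qed.

Lemma vcoordZ (i : L) (t : R) (v : V) : vcoord i (t *: v) = t * vcoord i v.
Proof. by rewrite /vcoord linearZ. Qed.

Lemma tvec_linear : linear (@tvec R V m).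
Proof.
move=> x a b; apply: ttensorP => w; rewrite tcoefD tcoefZ /tvec !tcoefE.
case: leqP => _; last by rewrite mulr0 addr0.
by case: (bseqval w) => [|i [|j s]]; rewrite ?mulr0 ?addr0 // vcoordD vcoordZ.
Qed.
HB.instance Definition _ :=
  GRing.isLinear.Build R V T *:%R (@tvec R V m) tvec_linear.

Lemma low_tvec v : low 1 (tvec m v).
Proof. by move=> [|//] _; rewrite /tvec tcoefE. Qed.

Lemma tdeg_tvec v : tdeg (tvec m v) = tvec m v.
Proof.
apply: ttensorP => w; rewrite tcoef_deg /tvec !tcoefE.
case: leqP => _; last by rewrite mulr0.
by case: (bseqval w) => [|i [|j s]]; rewrite ?mulr0 //= mul1r.
Qed.

Definition evec (i : L) : T := tvec m (basis i).

Lemma wsum_tvec (M : lmodType R) (f : seq L -> M) v :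
  (forall w, (m < size w)%N -> f w = 0) ->
  wsum f (tvec m v) = \sum_i vcoord i v *: f [:: i].
Proof.
move=> f0; rewrite /wsum; case: (posnP m) => m0.
  rewrite [RHS]big1; last by move=> i _; rewrite f0 ?scaler0 // m0.
  rewrite big1_seq // => w; rewrite mem_words => /andP[_].
  rewrite [X in (_ <= X)%N -> _]m0 leqn0 size_eq0 => /eqP->.
  by rewrite low_tvec ?scale0r.
rewrite big_words_letter //.
  by apply: eq_bigr => i _; rewrite /tvec tcoefE m0.
move=> w w1; rewrite /tvec tcoefE; case: leqP => _; last by rewrite scale0r.
by case: w w1 => [|i []] // *; rewrite scale0r.
Qed.

(** Iterated bracketing from the right by the letters of [w]; its linear extension [ract] is a right
    action of the tensor algebra ([ractM]). *)
Definition actw w x : T := foldl (fun y i => tbr y (evec i)) x w.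

Lemma actw_linear w : linear (actw w).
Proof.
elim: w => [//|i w IH] r x y; by rewrite /= -IH tbr_linearl.
Qed.
HB.instance Definition _ w :=
  GRing.isLinear.Build R T T *:%R (actw w) (actw_linear w).

Lemma actw_cat x u (v : seq L) : actw (u ++ v) x = actw v (actw u x).
Proof. by rewrite /actw foldl_cat. Qed.

Lemma low_actw k x w : low k x -> low (k + size w) (actw w x).
Proof.
elim: w k x => [|i w IH] k x lx; first by rewrite addn0.
by rewrite -addSnnS; apply: IH; rewrite -addn1; apply: low_br => //; apply: low_tvec.
Qed.

Lemma actw_gt x w : (m < size w)%N -> actw w x = 0.
Proof.
move=> mw; apply: low_eq0; apply: low_le mw _.
by rewrite -[size w]add0n; apply: low_actw.
Qed.

(** The left-normed bracket [[..[[e_1, e_2], e_3].., e_k]]. The empty word goes to 0, so [dynkin]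
    ignores the scalar part. *)
Definition wbr w : T := if w is i :: w' then actw w' (evec i) else 0.

Lemma low_wbr w : low (size w) (wbr w).
Proof.
case: w => [//|i w]; rewrite -[size _]add1n; apply: low_actw; exact: low_tvec.
Qed.

Lemma wbr_gt w : (m < size w)%N -> wbr w = 0.
Proof. by move=> mw; apply: low_eq0; apply: low_le mw (@low_wbr w). Qed.

Lemma wbr_rcons w i : w != [::] -> wbr (rcons w i) = tbr (wbr w) (evec i).
Proof. by case: w => // j w _; rewrite /= /actw foldl_rcons. Qed.

Definition ract x : T -> T := wsum (actw^~ x).
HB.instance Definition _ x := GRing.Linear.on (ract x).

Lemma ractM x a b : ract x (a * b) = ract (ract x a) b.
Proof.
rewrite /ract wsum_mul; last by move=> w; apply: actw_gt.
rewrite exchange_big; apply: eq_bigr => v _ /=.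
rewrite linear_sum /= scaler_sumr.
by apply: eq_bigr => u _; rewrite linearZ /= scalerA actw_cat mulrC.
Qed.

Definition dynkin : T -> T := wsum wbr.
HB.instance Definition _ := GRing.Linear.on dynkin.

(** For [u] nonempty the left-normed bracket of [u ++ v] is that of [u] acted on by [v]; the pairs
    with [u] empty give the first summand. *)
Lemma dynkinM a b : dynkin (a * b) = tconst a *: dynkin b + ract (dynkin a) b.
Proof.
rewrite /dynkin /ract wsum_mul; last exact: wbr_gt.
rewrite exchange_big {2 3}/wsum scaler_sumr -big_split; apply: eq_bigr => v _ /=.
rewrite linear_sum /= scaler_sumr.
rewrite -(@big_words_nil L _ m
  (fun u => if u is [::] then tconst a *: (tcoef b v *: wbr v) else 0)).
  rewrite -big_split; apply: eq_bigr => -[|i u] _ /=.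
    by rewrite -scalerA scaler0 linear0 scaler0 addr0.
  by rewrite add0r linearZ /= scalerA actw_cat mulrC.
by case.
Qed.

Lemma free_lie_ind (P : T -> Prop) : P 0 ->
  (forall (r : R) a b, P a -> P b -> P (r *: a + b)) ->
  (forall a b, P a -> P b -> P (tbr a b)) ->
  (forall v, P (tvec m v)) -> forall a, free_lie a -> P a.
Proof.
move=> P0 Pl Pb Pv a; apply; split=> [|_ [v _ <-]]; last exact: Pv.
by split.
Qed.

Lemma free_lie0 : free_lie (0 : T).
Proof. by move=> A [[]]. Qed.

Lemma free_lieL (r : R) a b : free_lie a -> free_lie b -> free_lie (r *: a + b).
Proof. by move=> la lb A AH; case: (AH) => -[_ + _] _; apply; [apply: la|apply: lb]. Qed.

Lemma free_lie_br a b : free_lie a -> free_lie b -> free_lie (tbr a b).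
Proof. by move=> la lb A AH; case: (AH) => -[_ _ +] _; apply; [apply: la|apply: lb]. Qed.

Lemma free_lie_tvec v : free_lie (tvec m v).
Proof. by move=> A [_]; apply; exists v. Qed.

Lemma free_lieZ (r : R) a : free_lie a -> free_lie (r *: a).
Proof. by move=> la; rewrite -[_ *: _]addr0; apply: free_lieL => //; apply: free_lie0. Qed.

Lemma free_lieD a b : free_lie a -> free_lie b -> free_lie (a + b).
Proof. by move=> la lb; rewrite -[a]scale1r; apply: free_lieL. Qed.

Lemma free_lieN a : free_lie a -> free_lie (- a).
Proof. by rewrite -scaleN1r; apply: free_lieZ. Qed.

Lemma free_lie_sum I (r : seq I) (F : I -> T) :
  (forall i, free_lie (F i)) -> free_lie (\sum_(i <- r) F i).
Proof. by move=> lF; apply: big_ind => //; [exact: free_lie0|exact: free_lieD]. Qed.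

Lemma free_lie_wbr w : free_lie (wbr w).
Proof.
elim/last_ind: w => [|w i IH]; first exact: free_lie0.
case: (w =P [::]) => [->|/eqP w0]; first exact: free_lie_tvec.
by rewrite wbr_rcons //; apply: free_lie_br => //; apply: free_lie_tvec.
Qed.

Lemma free_lie_dynkin a : free_lie (dynkin a).
Proof. by apply: free_lie_sum => w; apply: free_lieZ; apply: free_lie_wbr. Qed.

Lemma low_free_lie a : free_lie a -> low 1 a.
Proof.
move: a; apply: free_lie_ind; first exact: low_zero.
- by move=> r a b la lb; apply: lowD => //; apply: lowZ.
- by move=> a b la lb; apply: lowB; apply: lowMl.
- exact: low_tvec.
Qed.

Lemma tvec_sum v : tvec m v = \sum_i vcoord i v *: evec i.
Proof.
by rewrite {1}[v]vcoord_sum linear_sum; apply: eq_bigr => i _; rewrite linearZ.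
Qed.

(** By the Jacobi identity the elements that act through [ract] as a bracket are closed under
    brackets, and vectors act so by definition. *)
Lemma ract_free_lie a x : free_lie a -> ract x a = tbr x a.
Proof.
move=> la; move: a la x; apply: free_lie_ind.
- by move=> x; rewrite linear0 /tbr mul0r mulr0 subrr.
- by move=> r a b IHa IHb x; rewrite linearD linearZ /= IHa IHb tbrDr tbrZr.
- move=> a b IHa IHb x; rewrite {1}/tbr linearB /= !ractM.
  rewrite !IHa !IHb /tbr !mulrBl !mulrBr !mulrA.
  tlin.
- move=> v x; rewrite [LHS]wsum_tvec; last by move=> w; apply: actw_gt.
  rewrite tvec_sum /tbr mulr_sumr mulr_suml -sumrB; apply: eq_bigr => i _.
  by rewrite -/(tbr _ _) tbrZr.
Qed.

(** One half of the Dynkin-Specht-Wever theorem: by [dynkinM] and [ract_free_lie], [dynkin [a, b] =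
    [dynkin a, b] + [a, dynkin b]] for Lie elements, so [dynkin] is there a derivation, and it
    agrees with [tdeg] on vectors. *)
Lemma dynkin_free_lie a : free_lie a -> dynkin a = tdeg a.
Proof.
(* Membership is carried through the induction because [ract_free_lie] asks for it. *)
move=> la; suff [] : free_lie a /\ dynkin a = tdeg a by [].
move: a la; apply: free_lie_ind.
- by split; [exact: free_lie0|rewrite !linear0].
- by move=> r a b [la ea] [lb eb]; split; [exact: free_lieL|rewrite !linearD !linearZ /= ea eb].
- move=> a b [la ea] [lb eb]; split; first exact: free_lie_br.
  have a0 : tconst a = 0 by apply/low_const; exact: low_free_lie.
  have b0 : tconst b = 0 by apply/low_const; exact: low_free_lie.
  rewrite /tbr linearB /= !dynkinM a0 b0 !scale0r !add0r !ract_free_lie //.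
  by rewrite -/(tbr _ _) tdeg_br ea eb /tbr; tlin.
- move=> v; split; first exact: free_lie_tvec.
  by rewrite tdeg_tvec /dynkin wsum_tvec ?tvec_sum //; exact: wbr_gt.
Qed.

Lemma tdeg_dynkin a : tdeg (dynkin a) = dynkin (tdeg a).
Proof.
rewrite /dynkin {1}/wsum linear_sum; apply: eq_bigr => w _.
rewrite linearZ /= tcoef_deg mulrC -scalerA; congr (_ *: _).
elim/last_ind: w => [|w i IH]; first by rewrite linear0 scaler0.
case: (w =P [::]) => [->|/eqP w0]; first by rewrite /= tdeg_tvec scale1r.
rewrite wbr_rcons // tdeg_br IH tdeg_tvec tbrZl size_rcons -addn1 natrD.
by rewrite scalerDl scale1r.
Qed.

(** For the converse, [dynkin] commutes with [tdeg], so [a = dynkin (tdegi a)], and the image of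
    [dynkin] consists of Lie elements. *)
Lemma free_lieP a : free_lie a <-> low 1 a /\ dynkin a = tdeg a.
Proof.
split=> [la|[la ea]]; first by split; [exact: low_free_lie|exact: dynkin_free_lie].
have -> : a = dynkin (tdegi a); last exact: free_lie_dynkin.
rewrite -[LHS]tdegK // -ea -{1}[a]tdegiK // -tdeg_dynkin tdegK //.
by apply: low_free_lie; apply: free_lie_dynkin.
Qed.

Lemma free_lie_tdeg a : free_lie a -> free_lie (tdeg a).
Proof. by move=> la; rewrite -dynkin_free_lie //; apply: free_lie_dynkin. Qed.

Lemma dynkin_tdegi a : free_lie a -> dynkin (tdegi a) = a.
Proof.
move=> /free_lieP[la ea]; rewrite -[RHS]tdegK // -ea -{2}[a]tdegiK // -tdeg_dynkin tdegK //.
by apply: low_free_lie; apply: free_lie_dynkin.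
Qed.

Lemma free_lie_tdegi a : free_lie a -> free_lie (tdegi a).
Proof.
move=> la; apply/free_lieP; have l1 := low_free_lie la.
by split; [exact: low_degi|rewrite dynkin_tdegi ?tdegiK].
Qed.

End FreeLie.

(** * Everywhere defined derivatives of real functions *)

Section RealDerivatives.
Variable R : realType.
Implicit Types (f g : R -> R) (t : R).

Definition der f f' := forall t, is_derive t (1 : R) f (f' t).

Lemma der_eq f f' g' : der f f' -> f' =1 g' -> der f g'.
Proof. by move=> df e t; rewrite -e. Qed.

Lemma der_unique f f' g' : der f f' -> der f g' -> f' =1 g'.
Proof.
move=> df dg t; have Hf := df t; have Hg := dg t.
by rewrite -(@derive_val _ _ _ _ _ _ _ Hf) -(@derive_val _ _ _ _ _ _ _ Hg).
Qed.

Lemma der_cst (c : R) : der (fun=> c) (fun=> 0).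
Proof. by move=> t; apply: is_derive_cst. Qed.

Lemma der_id : der id (fun=> 1).
Proof. by move=> t; apply: is_derive_id. Qed.

Lemma derD f f' g g' : der f f' -> der g g' ->
  der (fun t => f t + g t) (fun t => f' t + g' t).
Proof. by move=> df dg t; apply: is_deriveD. Qed.

Lemma derM f f' g g' : der f f' -> der g g' ->
  der (fun t => f t * g t) (fun t => f' t * g t + f t * g' t).
Proof.
move=> df dg t; apply: (is_derive_eq (is_deriveM (df t) (dg t))).
by rewrite /GRing.scale /=; ring.
Qed.

Lemma derZ (c : R) f f' : der f f' -> der (fun t => c * f t) (fun t => c * f' t).
Proof.
move=> df; apply: (der_eq (derM (der_cst c) df)) => t.
by rewrite mul0r add0r.
Qed.

Lemma der_comp f f' g g' : der f f' -> der g g' ->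
  der (fun t => f (g t)) (fun t => f' (g t) * g' t).
Proof.
by move=> df dg t; apply: (is_derive_eq (@is_derive1_comp _ f g t _ _ (df _) (dg t))).
Qed.

Lemma is_derX n f t (d : R) : is_derive t (1 : R) f d ->
  is_derive t (1 : R) (fun x => f x ^+ n) (n%:R * f t ^+ n.-1 * d).
Proof.
move=> df; elim: n => [|n IH].
  by apply: (is_derive_eq (is_derive_cst _ _ _)); rewrite !mul0r.
rewrite (_ : (fun x => _) = fun x => f x * f x ^+ n); last first.
  by apply/funext => x; rewrite exprS.
apply: (is_derive_eq (is_deriveM df IH)); rewrite /GRing.scale /=.
case: n {IH} => [|n] /=; first by ring.
by rewrite exprS -[n.+2]add1n natrD; ring.
Qed.

Lemma derX n f f' : der f f' ->
  der (fun t => f t ^+ n) (fun t => n%:R * f t ^+ n.-1 * f' t).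
Proof. by move=> df t; apply: is_derX. Qed.

Lemma der_sum I (r : seq I) (F F' : I -> R -> R) : (forall i, der (F i) (F' i)) ->
  der (fun t => \sum_(i <- r) F i t) (fun t => \sum_(i <- r) F' i t).
Proof.
move=> dF; elim: r => [|i r IH].
  have -> : (fun t => \sum_(i <- [::]) F i t) = fun=> 0.
    by apply/funext => t; rewrite big_nil.
  by apply: (der_eq (der_cst 0)) => t; rewrite big_nil.
have -> : (fun t => \sum_(j <- i :: r) F j t) = fun t => F i t + \sum_(j <- r) F j t.
  by apply/funext => t; rewrite big_cons.
by apply: (der_eq (derD (dF i) IH)) => t; rewrite big_cons.
Qed.

Lemma der_continuous f f' : der f f' -> continuous f.
Proof.
move=> df t; have := df t; case=> + _.
by move=> /derivable1_diffP /differentiable_continuous.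
Qed.

Lemma der0_cst f s t : der f (fun=> 0) -> f s = f t.
Proof. by move=> df; apply: is_derive_0_is_cst. Qed.

End RealDerivatives.

(** * Differentiable curves in the tensor algebra and linear flows *)

Section Curves.
Variables (R : realType) (V : normedVectType R) (m : nat).
Local Notation T := (ttensor V m).
Local Notation L := (letter V).
Implicit Types (v : V) (a b c g h x y : T) (w u : seq L) (k n : nat).
Implicit Types (X Y Z Q : R -> T) (s t : R).

Definition tder X X' := forall w, der (fun t => tcoef (X t) w) (fun t => tcoef (X' t) w).

Lemma tder_eq X X' Y' : tder X X' -> X' =1 Y' -> tder X Y'.
Proof. by move=> dX e w; apply: (der_eq (dX w)) => t; rewrite e. Qed.

Lemma tder_unique X X' Y' : tder X X' -> tder X Y' -> X' =1 Y'.
Proof. by move=> dX dY t; apply: ttensorP => w; apply: der_unique (dX w) (dY w) t. Qed.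

Lemma tder0_cst X s t : tder X (fun=> 0) -> X s = X t.
Proof.
move=> dX; apply: ttensorP => w; apply: (@der0_cst _ (fun t => tcoef (X t) w)).
by apply: (der_eq (dX w)) => r; rewrite tcoef0.
Qed.

Lemma tder_cst a : tder (fun=> a) (fun=> 0).
Proof. by move=> w; apply: (der_eq (der_cst _)) => t; rewrite tcoef0. Qed.

Lemma tderD X X' Y Y' : tder X X' -> tder Y Y' ->
  tder (fun t => X t + Y t) (fun t => X' t + Y' t).
Proof.
move=> dX dY w; rewrite (_ : (fun t => _) = fun t => tcoef (X t) w + tcoef (Y t) w).
  by apply: (der_eq (derD (dX w) (dY w))) => t; rewrite tcoefD.
by apply/funext => t; rewrite tcoefD.
Qed.

Lemma tderZ (f f' : R -> R) X X' : der f f' -> tder X X' ->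
  tder (fun t => f t *: X t) (fun t => f' t *: X t + f t *: X' t).
Proof.
move=> df dX w; rewrite (_ : (fun t => _) = fun t => f t * tcoef (X t) w).
  by apply: (der_eq (derM df (dX w))) => t; rewrite tcoefD !tcoefZ.
by apply/funext => t; rewrite tcoefZ.
Qed.

Lemma tderZc (r : R) X X' : tder X X' -> tder (fun t => r *: X t) (fun t => r *: X' t).
Proof.
by move=> dX; apply: (tder_eq (tderZ (der_cst r) dX)) => t; rewrite scale0r add0r.
Qed.

Lemma tderZl (f f' : R -> R) a : der f f' ->
  tder (fun t => f t *: a) (fun t => f' t *: a).
Proof.
move=> df; apply: (tder_eq (tderZ df (tder_cst a))) => t.
by rewrite scaler0 addr0.
Qed.

Lemma tderN X X' : tder X X' -> tder (fun t => - X t) (fun t => - X' t).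
Proof.
move=> dX; rewrite (_ : (fun t => - X t) = fun t => -1 *: X t).
  by apply: (tder_eq (tderZc (-1) dX)) => t; rewrite scaleN1r.
by apply/funext => t; rewrite scaleN1r.
Qed.

Lemma tder_sum I (r : seq I) (F F' : I -> R -> T) : (forall i, tder (F i) (F' i)) ->
  tder (fun t => \sum_(i <- r) F i t) (fun t => \sum_(i <- r) F' i t).
Proof.
move=> dF w; rewrite (_ : (fun t => _) = fun t => \sum_(i <- r) tcoef (F i t) w).
  by apply: (der_eq (der_sum _ (dF^~ w))) => t; rewrite tcoef_sum.
by apply/funext => t; rewrite tcoef_sum.
Qed.

Lemma tderM X X' Y Y' : tder X X' -> tder Y Y' ->
  tder (fun t => X t * Y t) (fun t => X' t * Y t + X t * Y' t).
Proof.
move=> dX dY w; case: (leqP (size w) m) => wm; last first.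
  rewrite (_ : (fun t => _) = fun=> 0).
    by apply: (der_eq (der_cst _)) => t; rewrite tcoef_gt.
  by apply/funext => t; rewrite tcoef_gt.
rewrite (_ : (fun t => _) = fun t =>
  \sum_(k < (size w).+1) tcoef (X t) (take k w) * tcoef (Y t) (drop k w)).
  have dk (k : 'I_(size w).+1) := derM (dX (take k w)) (dY (drop k w)).
  apply: (der_eq (der_sum _ dk)) => t.
  by rewrite tcoefD !tcoef_mul // -big_split.
by apply/funext => t; rewrite tcoef_mul.
Qed.

Lemma tder_tdeg X X' : tder X X' -> tder (fun t => tdeg (X t)) (fun t => tdeg (X' t)).
Proof.
move=> dX w; rewrite (_ : (fun t => _) = fun t => (size w)%:R * tcoef (X t) w).
  by apply: (der_eq (derZ _ (dX w))) => t; rewrite tcoef_deg.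
by apply/funext => t; rewrite tcoef_deg.
Qed.

Lemma tder_dynkin X X' : tder X X' -> tder (fun t => dynkin (X t)) (fun t => dynkin (X' t)).
Proof.
move=> dX; apply: tder_sum => w.
exact: tderZl (dX w).
Qed.

Lemma tderX X X' k : tder X X' -> exists X'', tder (fun t => X t ^+ k) X''.
Proof.
move=> dX; elim: k => [|k [Y dY]]; first by exists (fun=> 0); apply: tder_cst.
exists (fun t => X' t * X t ^+ k + X t * Y t).
rewrite (_ : (fun t => _) = fun t => X t * X t ^+ k); first exact: tderM.
by apply/funext => t; rewrite exprS.
Qed.

Lemma tinv_sum x : tconst x = 1 -> x^-1 = \sum_(k < m.+1) (1 - x) ^+ k.
Proof.
move=> x1; rewrite /GRing.inv /= /tinv x1 oner_eq0 invr1 !scale1r.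
by apply: eq_bigr => k _.
Qed.

Lemma tconst_unit x : tconst x = 1 -> x \is a GRing.unit.
Proof. by move=> x1; rewrite unitTE x1 oner_eq0. Qed.

(** The inverse is a polynomial in [1 - X], hence differentiable; the value of its derivative is
    then read off from [X^-1 * X = 1]. *)
Lemma tderV X X' : (forall t, tconst (X t) = 1) -> tder X X' ->
  tder (fun t => (X t)^-1) (fun t => - ((X t)^-1 * X' t * (X t)^-1)).
Proof.
move=> X1 dX.
have [Z dZ] : exists Z, tder (fun t => (X t)^-1) Z.
  have dY := tderD (tder_cst 1) (tderN dX).
  pose Z k := projT1 (cid (tderX k dY)).
  have dZ k : tder (fun t => (1 - X t) ^+ k) (Z k) by rewrite /Z; case: cid.
  exists (fun t => \sum_(k < m.+1) Z k t).
  rewrite (_ : (fun t => _) = fun t => \sum_(k < m.+1) (1 - X t) ^+ k).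
    by apply: tder_sum => k; apply: dZ.
  by apply/funext => t; rewrite tinv_sum.
apply: (tder_eq dZ) => t.
have : Z t * X t + (X t)^-1 * X' t = 0.
  apply: (@tder_unique (fun=> 1) (fun t => Z t * X t + (X t)^-1 * X' t) (fun=> 0)).
    rewrite (_ : (fun=> 1) = fun t => (X t)^-1 * X t); first exact: tderM.
    by apply/funext => s; rewrite mulVr // tconst_unit.
  exact: tder_cst.
move=> /eqP; rewrite addr_eq0 => /eqP ZX.
by rewrite -[LHS]mulr1 -(divrr (tconst_unit (X1 t))) mulrA ZX mulNr.
Qed.

(* The defect [dynkin - tdeg], whose kernel is the Lie algebra, gains one degree
   along the bracket with a Lie element. *)
Lemma free_lie_ode (Q a b : R -> T) :
  tder Q (fun t => tbr (Q t) (a t) + b t) ->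
  (forall t, free_lie (a t)) -> (forall t, free_lie (b t)) ->
  free_lie (Q 0) -> forall t, free_lie (Q t).
Proof.
move=> dQ La Lb LQ0.
have cQ t : tconst (Q t) = 0.
  rewrite -(low_const (Q 0)).1; last exact: low_free_lie.
  apply: (@der0_cst _ (fun t => tcoef (Q t) [::])).
  apply: (der_eq (dQ [::])) => s; rewrite tcoefD -/(tconst _) tconst_br add0r.
  exact/low_const/low_free_lie.
pose theta x := dynkin x - tdeg x.
have thetaD x y : theta (x + y) = theta x + theta y.
  by rewrite /theta !linearD /=; tlin.
have theta0 x : free_lie x -> theta x = 0.
  by move=> lx; rewrite /theta dynkin_free_lie ?subrr.
have low_theta k x : low k x -> low k (theta x).
  move=> lx; apply: lowB; last exact: low_deg.
  apply: low_sum => w _; case: (ltnP (size w) k) => wk.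
    by rewrite lx // scale0r; apply: low_zero.
  by apply: lowZ; apply: low_le wk (@low_wbr _ _ _ w).
have main n : forall t, low n (theta (Q t)).
  elim: n => [|n IH] t; first exact: low0.
  have step s : low n.+1 (theta (tbr (Q s) (a s) + b s)).
    rewrite thetaD (theta0 (b s)) // addr0.
    (* [P] is Lie and [tdeg (Q s - P) = - theta (Q s)], so the induction hypothesis puts [Q s - P]
       in [low n], and the bracket with [a s] moves it to [low n.+1]. *)
    set P := dynkin (tdegi (Q s)).
    have -> : Q s = P + (Q s - P) by rewrite addrC subrK.
    rewrite tbrDl thetaD theta0 ?add0r; last first.
      by apply: free_lie_br => //; apply: free_lie_dynkin.
    apply: low_theta; rewrite -addn1; apply: low_br; last exact: low_free_lie.
    have lQ : low 1 (Q s) by apply/low_const.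
    have lP : low 1 P by apply: low_free_lie; apply: free_lie_dynkin.
    rewrite -[Q s - P]tdegK; last exact: lowB.
    apply: low_degi; rewrite linearB /= tdeg_dynkin tdegiK //.
    by rewrite -opprB; apply: lowN; apply: IH.
  move=> w; rewrite ltnS => wn.
  have <- : tcoef (theta (Q 0)) w = 0 by rewrite theta0 // tcoef0.
  apply: (@der0_cst _ (fun t => tcoef (theta (Q t)) w)).
  have dth : tder (fun t => theta (Q t)) (fun t => theta (tbr (Q t) (a t) + b t)).
    exact: tderD (tder_dynkin dQ) (tderN (tder_tdeg dQ)).
  by apply: (der_eq (dth w)) => s; rewrite step.
move=> t; apply/free_lieP; split; first exact/low_const.
by apply/eqP; rewrite -subr_eq0; apply/eqP; apply: low_eq0 (main m.+1 t).
Qed.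

(** The logarithmic derivative along dilations: [tdeg x] is the derivative of [dilation t x] at
    [t = 1]. *)
Definition qlog x : T := x^-1 * tdeg x.

(** Along the flow [q = qlog X] solves [q' = [q, a] + tdeg a] with [q = 0] at time 0, an equation
    covered by [free_lie_ode]. *)
Lemma free_lie_flow X (a : R -> T) : tder X (fun t => X t * a t) ->
  (forall t, free_lie (a t)) -> X 0 = 1 ->
  forall t, tconst (X t) = 1 /\ free_lie (qlog (X t)).
Proof.
move=> dX La X0.
have X1 t : tconst (X t) = 1.
  rewrite -(tconst1 V m) -X0.
  apply: (@der0_cst _ (fun t => tcoef (X t) [::])).
  apply: (der_eq (dX [::])) => s.
  by rewrite -/(tconst _) tconst_mul (low_const (a s)).1 ?mulr0 //; apply: low_free_lie.
move=> t; split=> //; move: t.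
apply: (@free_lie_ode (fun t => qlog (X t)) a (fun t => tdeg (a t))) => //.
- apply: (tder_eq (tderM (tderV X1 dX) (tder_tdeg dX))) => t.
  have Xu := tconst_unit (X1 t).
  rewrite /qlog /tbr tdegM mulrDr (mulrA _ (X t) (tdeg _)) mulVr // mul1r mulNr.
  by rewrite (mulrA _ (X t) (a t)) mulVr // mul1r -!mulrA; tlin.
- by move=> t; apply: free_lie_tdeg.
- by rewrite /qlog X0 tdeg1 mulr0; apply: free_lie0.
Qed.

End Curves.

(** * Exponentials of tensors without scalar part *)

Section Exponential.
Variables (R : realType) (V : normedVectType R) (m : nat).
Local Notation T := (ttensor V m).
Local Notation L := (letter V).
Implicit Types (v : V) (a b c g h x y : T) (w u : seq L) (k n : nat) (s t : R).

(** Differentiation shifts the index of the series; the surplus last term of [texp (f t *: a) * a]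
    is a multiple of [a^(m+1) = 0]. *)
Lemma tder_texp (f f' : R -> R) a : low 1 a -> der f f' ->
  tder (fun t => texp (f t *: a)) (fun t => f' t *: (texp (f t *: a) * a)).
Proof.
move=> la df.
have E t : texp (f t *: a) = \sum_(k < m.+1) (k`!%:R^-1 * f t ^+ k) *: a ^+ k.
  by apply: eq_bigr => k _; rewrite exprZn scalerA.
rewrite (_ : (fun t => texp _) = fun t => \sum_(k < m.+1) (k`!%:R^-1 * f t ^+ k) *: a ^+ k).
  have dk (k : 'I_m.+1) := tderZl (a ^+ k) (derZ (k`!%:R^-1) (derX k df)).
  apply: (tder_eq (tder_sum _ dk)) => t.
  have -> : texp (f t *: a) * a = \sum_(k < m.+1) (k`!%:R^-1 * f t ^+ k) *: a ^+ k.+1.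
    by rewrite E mulr_suml; apply: eq_bigr => k _; rewrite -scalerAl -exprSr.
  rewrite scaler_sumr big_ord_recl [RHS]big_ord_recr /=.
  rewrite (@nilp_X _ _ _ a m.+1) // !scaler0 addr0.
  rewrite !mul0r mulr0 scale0r add0r; apply: eq_bigr => k _.
  rewrite scalerA; congr (_ *: _).
  rewrite /bump /= add1n factS natrM.
  by field; rewrite nat1r !pnatr_eq0 -lt0n fact_gt0.
by apply/funext => t; rewrite E.
Qed.

Lemma texp0 : texp (0 : T) = 1.
Proof.
rewrite /texp big_ord_recl /= fact0 invr1 expr0 scale1r big1 ?addr0 // => k _.
by rewrite exprS mul0r scaler0.
Qed.

Lemma texp_comm (r : R) a : texp (r *: a) * a = a * texp (r *: a).
Proof.
rewrite /texp mulr_suml mulr_sumr; apply: eq_bigr => k _.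
by rewrite exprZn -!scalerAr -!scalerAl -exprS -exprSr.
Qed.

(** The left side is constant in [t], since the two terms of its derivative cancel. Inverses and the
    law [texpD] both come from this identity. *)
Lemma texp_subl a s t : low 1 a -> texp (- t *: a) * texp ((s + t) *: a) = texp (s *: a).
Proof.
move=> la.
pose F t := texp (- t *: a) * texp ((s + t) *: a).
rewrite -[LHS]/(F t) (@tder0_cst _ _ _ F t 0).
  by rewrite /F oppr0 scale0r texp0 mul1r addr0.
have d1 : der (fun t : R => - t) (fun=> -1).
  by move=> r; apply: is_deriveNid.
have d2 : der (fun t => s + t) (fun=> 1).
  by apply: (der_eq (derD (der_cst s) (@der_id R))) => r; rewrite add0r.
apply: (tder_eq (tderM (tder_texp la d1) (tder_texp la d2))) => r.
by rewrite scale1r scaleN1r (texp_comm (s + r)) mulNr mulrA addNr.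
Qed.

Lemma texpNl a : low 1 a -> texp (- a) * texp a = 1.
Proof.
by move=> la; have := texp_subl 0 1 la; rewrite scaleN1r add0r scale1r scale0r texp0.
Qed.

Lemma texpNr a : low 1 a -> texp a * texp (- a) = 1.
Proof. by move=> la; have := texpNl (lowN la); rewrite opprK. Qed.

Lemma texpD a s t : low 1 a -> texp ((s + t) *: a) = texp (s *: a) * texp (t *: a).
Proof.
move=> la; have := texp_subl t s la; rewrite addrC => <-.
by rewrite mulrA scaleNr texpNr ?mul1r //; apply: lowZ.
Qed.

Lemma tconst_texp a : low 1 a -> tconst (texp a) = 1.
Proof.
move=> la; rewrite /tconst /texp tcoef_sum big_ord_recl big1 ?addr0.
  by rewrite expr0 fact0 invr1 scale1r tcoef_one.
by move=> k _; rewrite tcoefZ (@low_X _ _ _ a) ?mulr0.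
Qed.

Lemma texpV a : low 1 a -> (texp a)^-1 = texp (- a).
Proof.
move=> la; have u : texp a \is a GRing.unit by rewrite tconst_unit // tconst_texp.
by rewrite -[RHS]mulr1 -(mulrV u) mulrA texpNl ?mul1r.
Qed.

End Exponential.

(** * The free nilpotent group *)

Section FreeGroup.
Variables (R : realType) (V : normedVectType R) (m : nat).
Local Notation T := (ttensor V m).
Local Notation L := (letter V).
Implicit Types (v : V) (a b c g h x y : T) (w u : seq L) (k n : nat) (s t : R).

(** For [j >= 2] a monomial of [(a + c)^j] that contains [c] has another factor without scalar part,
    hence starts above degree [k]; the power [j = 1] contributes [c] itself. *)
Lemma texp_addl k a c : (0 < k)%N -> low 1 a -> low k c ->
  low k.+1 (texp (a + c) - texp a - c).
Proof.
move=> k0 la lc.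
have claim j : low k.+1 ((a + c) ^+ j - a ^+ j - (j == 1%N)%:R *: c).
  case: j => [|j]; first by rewrite subrr scale0r subrr; apply: low_zero.
  elim: j => [|j IH].
    rewrite !expr1 (_ : _ - _ = 0); first exact: low_zero.
    by rewrite scale1r; tlin.
  rewrite scale0r subr0 exprS [a ^+ _]exprS.
  have -> : (a + c) * (a + c) ^+ j.+1 - a * a ^+ j.+1 =
      (a + c) * ((a + c) ^+ j.+1 - a ^+ j.+1) + c * a ^+ j.+1.
    by rewrite mulrBr !mulrDl; tlin.
  apply: lowD.
    rewrite -add1n; apply: lowM.
      by apply: lowD => //; apply: low_le lc.
    rewrite -[X in low k X](subrK ((j.+1 == 1%N)%:R *: c)).
    by apply: lowD; [apply: low_le IH|apply: lowZ].
  by rewrite -addn1; apply: lowM => //; rewrite exprS; apply: lowMl.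
have cE : c = \sum_(j < m.+1) j`!%:R^-1 *: ((j == 1%N :> nat)%:R *: c).
  (* For [m = 0] the exponential series has no term of index 1, but then [c = 0]. *)
  case: (posnP m) => m0.
    have -> : c = 0 by apply: low_eq0; apply: low_le lc; rewrite m0.
    by rewrite big1 // => j _; rewrite !scaler0.
  rewrite (bigD1 (Ordinal (m0 : 1 < m.+1)%N)) //= (_ : 1`! = 1%N) // invr1 !scale1r.
  rewrite big1 ?addr0 // => j j1; rewrite (_ : (j == 1%N :> nat) = false) ?scale0r ?scaler0 //.
  by apply/negbTE; apply: contraNneq j1 => j1; apply/eqP/val_inj.
rewrite [X in _ - X]cE /texp -!sumrB; apply: low_sum => j _.
by rewrite -!scalerBr; apply: lowZ; apply: claim.
Qed.

Lemma texp_low k a : (0 < k)%N -> low k a -> low k.+1 (texp a - 1 - a).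
Proof.
move=> k0 la; have := texp_addl k0 (@low_zero _ _ _ 1) la.
by rewrite add0r texp0.
Qed.

(** The conjugates of [x] by [texp (t *: a)] solve [Q' = [Q, a]], so [free_lie_ode] keeps them in
    the Lie algebra. *)
Lemma texp_free_lie_conj a x : free_lie a -> free_lie x ->
  free_lie ((texp a)^-1 * x * texp a).
Proof.
move=> La Lx; have la := low_free_lie La.
rewrite texpV //.
pose Q t := texp (- t *: a) * x * texp (t *: a).
have -> : texp (- a) * x * texp a = Q 1 by rewrite /Q scaleN1r scale1r.
apply: (@free_lie_ode _ _ _ Q (fun=> a) (fun=> 0)) => //; last 2 first.
- by move=> _; apply: free_lie0.
- by rewrite /Q oppr0 scale0r texp0 mul1r mulr1.
have d1 : der (fun t : R => - t) (fun=> -1) by move=> r; apply: is_deriveNid.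
apply: (tder_eq (tderM (tderM (tder_texp la d1) (tder_cst x)) (tder_texp la (@der_id R)))).
move=> t; rewrite mulr0 !addr0 scaleN1r scale1r /tbr /Q texp_comm.
by rewrite !mulNr -!mulrA addrC.
Qed.

(** The cocycle rule of logarithmic derivatives; with the previous lemma it turns closure under
    products into closure of the Lie algebra under sums. *)
Lemma qlogM g h : tconst g = 1 -> tconst h = 1 ->
  qlog (g * h) = h^-1 * qlog g * h + qlog h.
Proof.
move=> g1 h1; have gu := tconst_unit g1; have hu := tconst_unit h1.
rewrite /qlog tdegM invrM // mulrDr !mulrA; congr (_ + _).
by rewrite -(mulrA _ _ g) mulVr // mulr1.
Qed.

(** [texp a] is the value at time 1 of the flow [X' = X a] started at 1. *)
Lemma free_group_qlog g : free_group g -> tconst g = 1 /\ free_lie (qlog g).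
Proof.
move=> [a La <-]; have la := low_free_lie La.
have := @free_lie_flow _ _ _ (fun t => texp (t *: a)) (fun=> a) _ (fun=> La) _ 1.
rewrite scale1r; apply; last by rewrite scale0r texp0.
by apply: (tder_eq (tder_texp la (@der_id R))) => t; rewrite scale1r.
Qed.

Lemma tconst_free_group g : free_group g -> tconst g = 1.
Proof. by move=> /free_group_qlog[]. Qed.

Lemma free_group_unit g : free_group g -> g \is a GRing.unit.
Proof. by move=> /tconst_free_group/tconst_unit. Qed.

Lemma low_inv1 x : tconst x = 1 -> low 1 (x^-1 - 1).
Proof.
move=> x1; apply/low_const; have xu := tconst_unit x1.
have := tconst_mul x^-1 x; rewrite mulVr // tconst1 x1 mulr1 => xv.
by rewrite /tconst tcoefB -/(tconst _) -xv -/(tconst _) tconst1 subrr.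
Qed.

(* The logarithm is found degree by degree: if [texp a] agrees with [g] up to
   degree [n], then [qlog g - qlog (texp a)] is a Lie element whose component of
   degree [n.+1] is that of [tdeg (g - texp a)]. *)
Lemma free_group_of_qlog g : tconst g = 1 -> free_lie (qlog g) -> free_group g.
Proof.
move=> g1 Lg.
suff H n : exists2 a, free_lie a & low n.+1 (g - texp a).
  have [a La /(low_le (leqnSn _))/low_eq0/eqP] := H m.+1.
  by rewrite subr_eq0 => /eqP ->; exists a.
elim: n => [|n [a La lga]].
  exists 0; first exact: free_lie0.
  by apply/low_const; rewrite texp0 /tconst tcoefB -!/(tconst _) g1 tconst1 subrr.
have la := low_free_lie La.
have a1 : tconst (texp a) = 1 by apply: tconst_texp.
have [_ La'] : tconst (texp a) = 1 /\ free_lie (qlog (texp a)).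
  by apply: free_group_qlog; exists a.
have gu := tconst_unit g1; have au := tconst_unit a1.
set e := texp a in lga a1 La' au *.
pose u := qlog g - qlog e.
have Lu : free_lie u by apply: free_lieD => //; apply: free_lieN.
(* As [g - e] starts in degree [n.+1], replacing [g^-1] by 1 costs one degree more, and so does the
   term containing [tdeg e]. *)
have lu : low n.+2 (u - tdeg (g - e)).
  have -> : u - tdeg (g - e) =
      (g^-1 - 1) * tdeg (g - e) - g^-1 * (g - e) * (e^-1 * tdeg e).
    rewrite mulrBl mul1r linearB /= mulrBr /u /qlog.
    rewrite [g^-1 * (g - e)]mulrBr mulVr // mulrBl mul1r.
    by rewrite -[g^-1 * e * _]mulrA (mulrA e) mulrV // mul1r; tlin.
  apply: lowB.
    by rewrite -add1n; apply: lowM; [apply: low_inv1|apply: low_deg].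
  rewrite -addn1; apply: lowM; first exact: lowMr.
  exact/lowMr/low1_deg.
have lge1 : low 1 (g - e) by apply: low_le lga.
have lc : low n.+2 (g - e - tdegi u).
  rewrite -[X in X - _]tdegK // -linearB /=; apply: low_degi.
  by rewrite -opprB; apply: lowN.
exists (a + tdegi u); first by apply: free_lieD => //; apply: free_lie_tdegi.
have -> : g - texp (a + tdegi u) =
    (g - e - tdegi u) - (texp (a + tdegi u) - e - tdegi u) by tlin.
apply: lowB => //; apply: texp_addl => //.
rewrite -[tdegi u](subrK (g - e)); apply: lowD => //.
by rewrite -opprB; apply: lowN; apply: low_le lc.
Qed.

Lemma free_groupP g : free_group g <-> tconst g = 1 /\ free_lie (qlog g).
Proof. by split=> [/free_group_qlog//|[]]; apply: free_group_of_qlog. Qed.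

Lemma free_group_texp a : free_lie a -> free_group (texp a).
Proof. by exists a. Qed.

Lemma free_group1 : free_group (1 : T).
Proof. by rewrite -texp0; apply: free_group_texp; apply: free_lie0. Qed.

Lemma free_groupM g h : free_group g -> free_group h -> free_group (g * h).
Proof.
move=> /free_group_qlog[g1 Lg] Gh; have [h1 Lh] := free_group_qlog Gh.
apply/free_groupP; split; first by rewrite tconst_mul g1 h1 mulr1.
rewrite qlogM //; apply: free_lieD => //.
by case: Gh => a La <-; apply: texp_free_lie_conj.
Qed.

Lemma free_groupV g : free_group g -> free_group g^-1.
Proof.
move=> [a La <-]; rewrite texpV; last exact: low_free_lie.
by apply: free_group_texp; apply: free_lieN.
Qed.

Lemma free_group_prod I (r : seq I) (F : I -> T) :
  (forall i, free_group (F i)) -> free_group (\prod_(i <- r) F i).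
Proof.
by move=> GF; apply: big_ind => //; [exact: free_group1|exact: free_groupM].
Qed.

Lemma free_group_tvec v : free_group (texp (tvec m v)).
Proof. by apply: free_group_texp; apply: free_lie_tvec. Qed.

Lemma tcoef_dilation t a w : tcoef (dilation t a) w = t ^+ size w * tcoef a w.
Proof. by rewrite tcoefE; case: leqP => // /tcoef_gt->; rewrite mulr0. Qed.

Lemma dilation_linear t : linear (@dilation R V m t).
Proof.
move=> x a b; apply: ttensorP => w.
by rewrite !(tcoefD, tcoefZ, tcoef_dilation) mulrDr mulrCA.
Qed.
HB.instance Definition _ t :=
  GRing.isLinear.Build R T T *:%R (@dilation R V m t) (dilation_linear t).

Lemma dilation1 t : dilation t (1 : T) = 1.
Proof.
apply: ttensorP => w; rewrite tcoef_dilation tcoef_one ?size_bseq //.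
by case: eqP => [->|_]; rewrite ?expr0 ?mulr1 ?mulr0.
Qed.

Lemma dilationM t a b : dilation t (a * b) = dilation t a * dilation t b.
Proof.
apply: ttensorP => w; have wm := size_bseq w.
rewrite tcoef_dilation !tcoef_mul // mulr_sumr.
apply: eq_bigr => -[k kw] _ /=; rewrite !tcoef_dilation size_takel // size_drop.
have -> : t ^+ size w = t ^+ k * t ^+ (size w - k) by rewrite -exprD subnKC.
by ring.
Qed.

Lemma dilationX t a k : dilation t (a ^+ k) = dilation t a ^+ k.
Proof. by elim: k => [|k IH]; rewrite ?dilation1 // !exprS dilationM IH. Qed.

Lemma dilation_texp t a : dilation t (texp a) = texp (dilation t a).
Proof.
by rewrite /texp linear_sum; apply: eq_bigr => k _; rewrite linearZ /= dilationX.
Qed.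

Lemma dilation_tvec t v : dilation t (tvec m v) = tvec m (t *: v).
Proof.
rewrite linearZ /=; apply: ttensorP => w; rewrite tcoef_dilation tcoefZ /tvec !tcoefE.
case: leqP => _; last by rewrite !mulr0.
by case: (bseqval w) => [|i [|j s]]; rewrite ?mulr0 //= expr1.
Qed.

Lemma dilation_comp s t a : dilation s (dilation t a) = dilation (s * t) a.
Proof. by apply: ttensorP => w; rewrite !tcoef_dilation exprMn mulrA. Qed.

Lemma dilation_1 a : dilation 1 a = a.
Proof. by apply: ttensorP => w; rewrite tcoef_dilation expr1n mul1r. Qed.

Lemma free_lie_dilation t a : free_lie a -> free_lie (dilation t a).
Proof.
move: a; apply: free_lie_ind.
- by rewrite linear0; apply: free_lie0.
- by move=> r a b la lb; rewrite linearP; apply: free_lieL.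
- by move=> a b la lb; rewrite /tbr linearB /= !dilationM; apply: free_lie_br.
- by move=> v; rewrite dilation_tvec; apply: free_lie_tvec.
Qed.

Lemma free_group_dilation t g : free_group g -> free_group (dilation t g).
Proof.
move=> [a La <-]; rewrite dilation_texp; apply: free_group_texp.
exact: free_lie_dilation.
Qed.

End FreeGroup.

(** * A submultiplicative norm on tensors *)

Section TensorNorm.
Variables (R : realType) (V : normedVectType R) (m : nat).
Local Notation T := (ttensor V m).
Local Notation L := (letter V).
Implicit Types (v : V) (a b c g h x y : T) (w u : seq L) (k n : nat) (s t : R).

(** The l1 norm of the coefficients, submultiplicative for concatenation ([ler_tnormM]). It measures
    differences of group elements, which lie outside the group. *)
Definition tnorm a : R := \sum_(w <- words L m) `|tcoef a w|.

Lemma tnorm_ge0 a : 0 <= tnorm a.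
Proof. by apply: sumr_ge0. Qed.

Lemma ler_tcoef_tnorm a w : `|tcoef a w| <= tnorm a.
Proof.
case: (leqP (size w) m) => wm; last by rewrite tcoef_gt // normr0 tnorm_ge0.
rewrite /tnorm (big_rem w) ?mem_words //=.
by rewrite lerDl; apply: sumr_ge0.
Qed.

Lemma tnorm_eq0 a : tnorm a = 0 -> a = 0.
Proof.
move=> a0; apply: ttensorP => w; apply/eqP.
by rewrite tcoef0 -normr_le0 -a0 ler_tcoef_tnorm.
Qed.

Lemma tnorm0 : tnorm 0 = 0.
Proof. by rewrite /tnorm big1 // => w _; rewrite tcoef0 normr0. Qed.

Lemma ler_tnormD a b : tnorm (a + b) <= tnorm a + tnorm b.
Proof.
by rewrite /tnorm -big_split; apply: ler_sum => w _; rewrite tcoefD ler_normD.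
Qed.

Lemma tnormZ t a : tnorm (t *: a) = `|t| * tnorm a.
Proof. by rewrite /tnorm mulr_sumr; apply: eq_bigr => w _; rewrite tcoefZ normrM. Qed.

Lemma tnormN a : tnorm (- a) = tnorm a.
Proof. by rewrite -scaleN1r tnormZ normrN1 mul1r. Qed.

Lemma ler_tnormB a b : tnorm (a - b) <= tnorm a + tnorm b.
Proof. by rewrite -[tnorm b]tnormN ler_tnormD. Qed.

Lemma tnormBC a b : tnorm (a - b) = tnorm (b - a).
Proof. by rewrite -opprB tnormN. Qed.

Lemma ler_tnorm_sum I (r : seq I) (F : I -> T) :
  tnorm (\sum_(i <- r) F i) <= \sum_(i <- r) tnorm (F i).
Proof.
elim/big_rec2: _ => [|i x y _ IH]; first by rewrite tnorm0.
by rewrite (le_trans (ler_tnormD _ _)) // lerD2l.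
Qed.

Lemma tnorm1 : tnorm 1 = 1.
Proof.
rewrite /tnorm big_words_nil; first by rewrite tcoef_one // normr1.
move=> w w0; case: (leqP (size w) m) => wm; last by rewrite tcoef_gt ?normr0.
by rewrite tcoef_one // size_eq0 (negbTE w0) normr0.
Qed.

Lemma ler_tnormM a b : tnorm (a * b) <= tnorm a * tnorm b.
Proof.
have -> : tnorm (a * b) = \sum_(w <- words L m)
    `|\sum_(k < (size w).+1) tcoef a (take k w) * tcoef b (drop k w)|.
  by apply: eq_big_seq => w; rewrite mem_words => wm; rewrite tcoef_mul.
apply: (@le_trans _ _ (\sum_(w <- words L m) \sum_(k < (size w).+1)
    `|tcoef a (take k w)| * `|tcoef b (drop k w)|)).
  apply: ler_sum => w _; rewrite (le_trans (ler_norm_sum _ _ _)) //.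
  by apply: ler_sum => k _; rewrite normrM.
rewrite (big_words_cat _ (fun u (v : seq L) => `|tcoef a u| * `|tcoef b v|)) /=.
rewrite mulr_suml; apply: ler_sum => u _.
by rewrite -mulr_sumr ler_wpM2l // big_words_widen_le ?leq_subr.
Qed.

Lemma ler_tnormX a k : tnorm (a ^+ k) <= tnorm a ^+ k.
Proof.
elim: k => [|k IH]; first by rewrite !expr0 tnorm1.
by rewrite !exprS (le_trans (ler_tnormM _ _)) // ler_wpM2l ?tnorm_ge0.
Qed.

(** A common majorant: of the exponential, whose coefficients [1 / k!] are at most 1, and of the
    inverse, a geometric series in [1 - g]. *)
Definition geom (r : R) : R := \sum_(k < m.+1) r ^+ k.

Lemma geom_ge0 (r : R) : 0 <= r -> 0 <= geom r.
Proof. by move=> r0; apply: sumr_ge0 => k _; apply: exprn_ge0. Qed.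

Lemma ler_geom (r s : R) : 0 <= r -> r <= s -> geom r <= geom s.
Proof.
move=> r0 rs; apply: ler_sum => k _; apply: lerXn2r => //.
by rewrite nnegrE (le_trans r0).
Qed.

Lemma ler_tnorm_texp a : tnorm (texp a) <= geom (tnorm a).
Proof.
rewrite (le_trans (ler_tnorm_sum _ _)) //; apply: ler_sum => k _.
rewrite tnormZ (le_trans _ (ler_tnormX _ _)) //.
rewrite ler_piMl ?tnorm_ge0 // ger0_norm ?invr_ge0 //.
by rewrite invf_le1 ?ltr0n ?fact_gt0 // ler1n fact_gt0.
Qed.

Lemma ler_tnormV g : tconst g = 1 -> tnorm g^-1 <= geom (1 + tnorm g).
Proof.
move=> g1; rewrite tinv_sum // (le_trans (ler_tnorm_sum _ _)) //.
apply: (@le_trans _ _ (geom (tnorm (1 - g)))).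
  by apply: ler_sum => k _; apply: ler_tnormX.
by rewrite ler_geom ?tnorm_ge0 // -[X in X + tnorm g]tnorm1 ler_tnormB.
Qed.

End TensorNorm.

(** * Bounded generation by horizontal exponentials *)

Section Chow.
Variables (R : realType) (V : normedVectType R) (m : nat).
Local Notation T := (ttensor V m).
Local Notation L := (letter V).
Implicit Types (v : V) (a b c g h x y : T) (w u : seq L) (k n : nat) (s t : R).
Implicit Types (K : nat) (C : R).

Definition horizontal_product (vs : seq (R * L)) : T :=
  \prod_(p <- vs) texp (p.1 *: evec m p.2).

(** Uniformity is the point: one [K] and one [C] are to serve for a whole bounded set of group
    elements. *)
Definition reachable K C g := exists vs : seq (R * L),
  [/\ (size vs <= K)%N, all (fun p => `|p.1| <= C) vs & g = horizontal_product vs].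

Lemma low_evec t (i : L) : low 1 (t *: evec m i).
Proof. by apply: lowZ; apply: low_tvec. Qed.

Lemma reachable1 C : reachable 0 C 1.
Proof. by exists [::]; rewrite /horizontal_product big_nil. Qed.

Lemma reachable_le K K' C C' g : (K <= K')%N -> C <= C' ->
  reachable K C g -> reachable K' C' g.
Proof.
move=> KK CC [vs [sv vC ->]]; exists vs; split=> //; first exact: leq_trans KK.
by apply: sub_all vC => p /le_trans; apply.
Qed.

Lemma reachableM K K' C g h : reachable K C g -> reachable K' C h ->
  reachable (K + K') C (g * h).
Proof.
move=> [vs [sv vC ->]] [us [su uC ->]]; exists (vs ++ us).
by rewrite size_cat leq_add // all_cat vC uC /horizontal_product big_cat.
Qed.

Lemma reachable_texp C t (i : L) : `|t| <= C -> reachable 1 C (texp (t *: evec m i)).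
Proof.
by move=> tC; exists [:: (t, i)]; rewrite /horizontal_product big_seq1 /= tC.
Qed.

Lemma reachable_free_group K C g : reachable K C g -> free_group g.
Proof.
move=> [vs [_ _ ->]]; apply: free_group_prod => p.
by apply: free_group_texp; apply: free_lieZ; apply: free_lie_tvec.
Qed.

Lemma reachableV K C g : reachable K C g -> reachable K C g^-1.
Proof.
move=> [vs [sv vC ->]]; elim: vs K sv vC => [|p vs IH] [|K] //= sv.
- by move=> _; rewrite /horizontal_product big_nil invr1; apply: reachable1.
- move=> _; rewrite /horizontal_product big_nil invr1.
  exact: reachable_le (leq0n _) (lexx _) (reachable1 C).
move=> /andP[pC vC].
rewrite /horizontal_product big_cons invrM -/(horizontal_product vs); last 2 first.
- exact/free_group_unit/(@reachable_free_group 1 C)/reachable_texp.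
- apply: free_group_unit; apply: (@reachable_free_group (size vs) C).
  by exists vs.
rewrite texpV; last exact: low_evec.
rewrite -scaleNr -addn1; apply: reachableM; first exact: IH.
by apply: reachable_texp; rewrite normrN.
Qed.

Lemma reachable_tnorm K C : 0 <= C ->
  exists B : R, forall g, reachable K C g -> tnorm g <= B.
Proof.
move=> C0; pose b := 1 + \sum_(i : L) geom m (C * tnorm (evec m i)).
have g0 (i : L) : 0 <= geom m (C * tnorm (evec m i)).
  by apply: geom_ge0; rewrite mulr_ge0 ?tnorm_ge0.
have b1 : 1 <= b by rewrite lerDl sumr_ge0.
exists (b ^+ K) => g [vs [sv vC ->]].
apply: (@le_trans _ _ (b ^+ size vs)); last exact: ler_weXn2l.
elim: vs vC {sv} => [|[t i] vs IH] /=.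
  by rewrite /horizontal_product big_nil tnorm1.
move=> /andP[tC vC]; rewrite /horizontal_product big_cons exprS.
rewrite (le_trans (ler_tnormM _ _)) // ler_pM ?tnorm_ge0 //; last exact: IH.
rewrite (le_trans (ler_tnorm_texp _)) //.
apply: (@le_trans _ _ (geom m (C * tnorm (evec m i)))).
  rewrite ler_geom ?tnorm_ge0 // tnormZ ler_wpM2r ?tnorm_ge0 //.
by rewrite /b (bigD1 i) //= addrCA lerDl addr_ge0 // sumr_ge0.
Qed.

(** The left side is [(x y - y x) (y x)^-1]; splitting 1 off the inverse exhibits the leading
    term. *)
Lemma commutator_sub1 (A : unitRingType) (x y : A) :
  x \is a GRing.unit -> y \is a GRing.unit ->
  x * y * x^-1 * y^-1 - 1 = (x * y - y * x) * ((y * x)^-1 - 1) + (x * y - y * x).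
Proof.
move=> xu yu; rewrite mulrBr mulr1 subrK mulrBl mulrV ?unitrMl //.
by rewrite invrM // mulrA.
Qed.

(* The group commutator of [1 + a] and [1 + b] is [1 + [a, b]] up to higher
   degree. *)
Lemma reachable_wbr w : w != [::] -> exists K, forall C t, 1 <= C -> `|t| <= C ->
  exists2 g, reachable K C g & low (size w).+1 (g - 1 - t *: wbr m w).
Proof.
elim/last_ind: w => // w i IH _; case: (w =P [::]) => [->|/eqP w0].
  exists 1%N => C t C1 tC; exists (texp (t *: evec m i)); first exact: reachable_texp.
  by apply: texp_low => //; apply: low_evec.
have [K HK] := IH w0; exists (K + 1 + K + 1)%N => C t C1 tC.
have [A rA lA] := HK C t C1 tC.
(* The factor [t] rides on the prefix [w], and the new letter enters with coefficient 1, whence the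
   condition [1 <= C]. *)
have n1C : `|1| <= C by rewrite normr1.
have := reachable_texp i n1C; rewrite scale1r.
set B := texp _ => rB.
exists (A * B * A^-1 * B^-1).
  by do !apply: reachableM => //; apply: reachableV.
rewrite wbr_rcons // size_rcons -tbrZl.
set k := size w in lA *; set z := t *: wbr m w in lA *; set e := evec m i.
have k0 : (0 < k)%N by rewrite lt0n size_eq0.
have Au := free_group_unit (reachable_free_group rA).
have Bu := free_group_unit (reachable_free_group rB).
have A1 := tconst_free_group (reachable_free_group rA).
have B1 := tconst_free_group (reachable_free_group rB).
have lz : low k z by apply: lowZ; apply: low_wbr.
have le : low 1 e by apply: low_tvec.
have lB : low 2 (B - 1 - e) by apply: texp_low.
have lA1 : low k (A - 1) by rewrite -[A - 1](subrK z); apply: lowD => //; apply: low_le lA.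
have lB1 : low 1 (B - 1) by rewrite -[B - 1](subrK e); apply: lowD => //; apply: low_le lB.
have brE : tbr A B = tbr (A - 1) (B - 1).
  by rewrite /tbr !mulrBl !mulrBr !mul1r !mulr1; tlin.
have lbr : low k.+2 (tbr A B - tbr z e).
  have -> : tbr A B - tbr z e = tbr (A - 1 - z) (B - 1) + tbr z (B - 1 - e).
    by rewrite brE /tbr !(mulrBl, mulrBr); tlin.
  by apply: lowD; [rewrite -addn1|rewrite -addn2]; apply: low_br.
have -> : A * B * A^-1 * B^-1 - 1 - tbr z e =
    tbr A B * ((B * A)^-1 - 1) + (tbr A B - tbr z e).
  by rewrite commutator_sub1 // -addrA.
apply: lowD => //; rewrite -addn1; apply: lowM.
  by rewrite brE -addn1; apply: low_br.
by apply: low_inv1; rewrite tconst_mul A1 B1 mulr1.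
Qed.

(** Under products the terms of degree [k] add up, since [(g - 1) * (h - 1)] starts above degree
    [k]. *)
Lemma reachable_wbr_sum k (ws : seq (seq L)) : (0 < k)%N ->
  all (fun w => size w == k) ws ->
  exists K, forall C (f : seq L -> R), 1 <= C -> (forall w, `|f w| <= C) ->
  exists2 g, reachable K C g & low k.+1 (g - 1 - \sum_(w <- ws) f w *: wbr m w).
Proof.
move=> k0; elim: ws => [|w ws IH] /=.
  move=> _; exists 0%N => C f _ _; exists 1; first exact: reachable1.
  by rewrite big_nil subr0 subrr; apply: low_zero.
move=> /andP[/eqP wk /IH[K' HK']].
have [K HK] : exists K, forall C t, 1 <= C -> `|t| <= C ->
  exists2 g, reachable K C g & low k.+1 (g - 1 - t *: wbr m w).
  by rewrite -wk; apply: reachable_wbr; rewrite -size_eq0 wk -lt0n.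
exists (K + K')%N => C f C1 fC.
have [g rg lg] := HK C (f w) C1 (fC w).
have [h rh lh] := HK' C f C1 fC.
exists (g * h); first exact: reachableM.
rewrite big_cons; set z := f w *: _ in lg *; set s := \sum_(_ <- _) _ in lh *.
have -> : g * h - 1 - (z + s) = (g - 1) * (h - 1) + ((g - 1 - z) + (h - 1 - s)).
  by rewrite mulrBl !mulrBr mul1r !mulr1; tlin.
apply: lowD; last exact: lowD.
rewrite -addn1; apply: lowM.
  rewrite -[g - 1](subrK z); apply: lowD; first by apply: low_le lg.
  by apply: lowZ; rewrite -wk; apply: low_wbr.
have : tconst h = 1 by apply: tconst_free_group (reachable_free_group rh).
by move=> h1; apply/low_const; rewrite /tconst tcoefB -!/(tconst _) h1 tconst1 subrr.
Qed.

(** Modulo higher degree [g - 1] equals the Lie element [c = tdegi (qlog g)], and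
    [c = dynkin (tdegi c)] writes its term of degree [k] in brackets, with coefficients bounded in
    terms of [g]. *)
Lemma reachable_leading k g : (0 < k)%N -> free_group g -> low k (g - 1) ->
  low k.+1 (g - 1 - \sum_(w <- words L m | size w == k) (k%:R^-1 * tcoef g w) *: wbr m w).
Proof.
move=> k0 Gg lg; have [g1 Lg] := free_group_qlog Gg; have gu := tconst_unit g1.
set c := tdegi (qlog g).
have lg1 : low 1 (g - 1) by apply: low_le lg.
have lc : low k.+1 (c - (g - 1)).
  rewrite -[X in _ - X]tdegK // -linearB /=; apply: low_degi.
  have -> : qlog g - tdeg (g - 1) = (g^-1 - 1) * tdeg (g - 1).
    by rewrite mulrBl mul1r linearB /= tdeg1 subr0.
  by rewrite -add1n; apply: lowM; [apply: low_inv1|apply: low_deg].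
have Lc : free_lie c by apply: free_lie_tdegi.
set s := \sum_(_ <- _ | _) _.
have -> : g - 1 - s = (c - s) - (c - (g - 1)) by tlin.
apply: lowB => //; rewrite -[c in c - s]dynkin_tdegi // /dynkin /wsum /s.
rewrite [X in _ - X]big_mkcond -sumrB; apply: low_sum => w _.
rewrite tcoef_degi; case: eqP => [wk|/eqP wk].
  rewrite wk; have <- : tcoef c w = tcoef g w.
    apply/eqP; rewrite -subr_eq0; have := lc w; rewrite wk ltnSn => /(_ isT).
    rewrite !tcoefB; case: (leqP (size w) m) => wm; last by rewrite !tcoef_gt ?subrr.
    by rewrite tcoef_one // wk (gtn_eqF k0) subr0 => ->.
  by rewrite subrr; apply: low_zero.
rewrite subr0; case: (ltngtP (size w) k) wk => // wk _.
  have -> : tcoef c w = 0.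
    rewrite -(subrK (g - 1) c) tcoefD lg // addr0; apply: lc.
    exact: leq_trans wk (leqnSn k).
  by rewrite mulr0 scale0r; apply: low_zero.
by apply: lowZ; apply: low_le wk (@low_wbr _ _ _ w).
Qed.

(** Induction on the number [n] of degrees left: [g] is divided by a reachable [P] with the same
    term in degree [k], and [P^-1 * g] starts one degree later with a norm bounded in terms of [B]
    alone. *)
Lemma chow_low n k (B : R) : (0 < k)%N -> (k + n = m.+1)%N ->
  exists K C, 1 <= C /\ forall g, free_group g -> low k (g - 1) -> tnorm g <= B ->
    reachable K C g.
Proof.
elim: n k B => [|n IH] k B k0 kn.
  exists 0%N, 1; split=> // g _ lg _.
  have /eqP : g - 1 = 0 by apply: low_eq0; rewrite -kn addn0.
  by rewrite subr_eq0 => /eqP->; apply: reachable1.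
have [K HK] : exists K, forall C (f : seq L -> R), 1 <= C -> (forall w, `|f w| <= C) ->
  exists2 g, reachable K C g &
    low k.+1 (g - 1 - \sum_(w <- [seq w <- words L m | size w == k]) f w *: wbr m w).
  by apply: reachable_wbr_sum => //; apply: filter_all.
(* Large enough for the coefficients [tcoef g w / k], which are at most [tnorm g] in absolute
   value. *)
pose C := 1 + `|B|; have C1 : 1 <= C by rewrite lerDl.
have C0 : 0 <= C by apply: le_trans C1.
have [B1 HB1] := reachable_tnorm K C0.
(* The bound for the next degree: [P^-1] has norm at most [geom m (1 + B1)], and [g] at most [C]. *)
have [K' [C' [C'1 H']]] := IH k.+1 (geom m (1 + B1) * C) isT (etrans (addSnnS k n) kn).
exists (K + K')%N, (C + C'); split; first by rewrite -[1]addr0 lerD // (le_trans _ C'1).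
move=> g Gg lg gB.
have gC : tnorm g <= C by rewrite (le_trans gB) // (le_trans (ler_norm B)) // lerDr.
have fC w : `|k%:R^-1 * tcoef g w| <= C.
  rewrite normrM (le_trans _ gC) // (le_trans _ (ler_tcoef_tnorm g w)) //.
  by rewrite ler_piMl // ger0_norm ?invr_ge0 // invf_le1 ?ltr0n // ler1n.
have [P rP lP] := HK C _ C1 fC.
have GP := reachable_free_group rP; have P1 := tconst_free_group GP.
have Pu := free_group_unit GP.
have -> : g = P * (P^-1 * g) by rewrite mulrA mulrV // mul1r.
apply: reachableM; first by apply: reachable_le rP => //; rewrite lerDl (le_trans _ C'1).
apply: (@reachable_le K' K' C' (C + C')); rewrite ?lerDr //.
apply: H'; first by apply: free_groupM => //; apply: free_groupV.
  have -> : P^-1 * g - 1 = P^-1 * (g - P) by rewrite mulrBr mulVr.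
  apply: lowMr; set s := \sum_(_ <- _) _ in lP.
  have -> : g - P = (g - 1 - s) - (P - 1 - s) by tlin.
  by apply: lowB => //; rewrite /s big_filter; apply: reachable_leading.
rewrite (le_trans (ler_tnormM _ _)) // ler_pM ?tnorm_ge0 //.
rewrite (le_trans (ler_tnormV P1)) // ler_geom ?addr_ge0 ?tnorm_ge0 //.
by rewrite lerD2l HB1.
Qed.

Lemma chow (B : R) : exists K C, 0 <= C /\
  forall g, free_group g -> tnorm g <= B -> reachable K C g.
Proof.
have [K [C [C1 H]]] := @chow_low m 1 B isT (add1n m).
exists K, C; split=> [|g Gg gB]; first exact: le_trans C1.
apply: H => //; apply/low_const.
by rewrite /tconst tcoefB -!/(tconst _) (tconst_free_group Gg) tconst1 subrr.
Qed.

End Chow.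

(** * Compactness, and closedness of the group *)

Section TensorTopology.
Variables (R : realType) (V : normedVectType R) (m : nat).
Local Notation T := (ttensor V m).
Local Notation L := (letter V).
Implicit Types (v : V) (a b c g h x y : T) (w u : seq L) (k n : nat) (s t : R).

Lemma ler0_scaled (x M : R) : (forall e : R, 0 < e -> e <= 1 -> x <= M * e) -> x <= 0.
Proof.
move=> H; rewrite leNgt; apply/negP => x0.
have M0 : 0 < M.
  rewrite ltNge; apply/negP => M0; have := H 1 ltr01 (lexx _).
  by rewrite mulr1 leNgt (le_lt_trans M0 x0).
have e0 : 0 < Num.min 1 (x / (M + M)) by rewrite lt_min ltr01 divr_gt0 ?addr_gt0.
have e1 : Num.min 1 (x / (M + M)) <= 1 by rewrite ge_min lexx.
have := H _ e0 e1; apply/negP; rewrite -ltNge.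
apply: (@le_lt_trans _ _ (M * (x / (M + M)))).
  by rewrite ler_pM2l // ge_min lexx orbT.
have -> : M * (x / (M + M)) = x / 2.
  field; by rewrite lt0r_neq0 // addr_gt0.
by rewrite ltr_pdivrMr // mulr_natr mulr2n ltrDl.
Qed.

(** Bolzano-Weierstrass, transported from the row vectors of coefficients in a box. *)
Lemma bounded_cluster (g : nat -> T) (B : R) : (forall n, tnorm (g n) <= B) ->
  exists a, forall e : R, 0 < e -> forall n0, exists2 n, (n0 <= n)%N & tnorm (g n - a) <= e.
Proof.
move=> gB; pose D := #|{: m.-bseq L}|.
pose x n : 'rV[R]_D := \row_j tcoef (g n) (enum_val j : m.-bseq L).
pose box := [set v : 'rV[R]_D | forall i, `[- B, B]%classic (v ord0 i)].
have cbox : compact box.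
  by apply: (@rV_compact _ _ (fun=> `[- B, B]%classic)) => i; apply: segment_compact.
have boxx n : box (x n).
  move=> i /=; rewrite mxE in_itv /= -ler_norml.
  exact: le_trans (ler_tcoef_tnorm _ _) (gB n).
have [|p [_ xp]] := cbox (x @ \oo) _; first by exists 0%N => // n _; apply: boxx.
pose a : T := tensor_of m (fun w => oapp (fun u : m.-bseq L => p ord0 (enum_rank u)) 0 (insub w)).
have aE (u : m.-bseq L) : tcoef a u = p ord0 (enum_rank u).
  by rewrite tcoefE size_bseq valK.
exists a => e e0 n0.
pose S : R := (size (words L m))%:R.
have S0 : 0 < S.
  by rewrite ltr0n; have : [::] \in words L m; [rewrite mem_words|case: words].
have eS : 0 < e / S by rewrite divr_gt0.
have [||_ [[n /= n0n <-] xpn]] := xp [set x n | n in [set n | (n0 <= n)%N]] (ball p (e / S)).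
- by exists n0 => // n n0n; exists n.
- exact: nbhsx_ballx.
exists n => //; have -> : e = \sum_(w <- words L m) e / S.
  by rewrite big_const_seq count_predT iter_addr_0 -[_ *+ _]mulr_natr divfK ?gt_eqF.
rewrite /tnorm big_seq [leRHS]big_seq; apply: ler_sum => w.
rewrite mem_words => wm; pose u := Bseq wm.
have := xpn; rewrite /ball /= => -[_ /(_ ord0 (enum_rank u))]; rewrite mxE enum_rankK.
rewrite tcoefB (_ : w = u) // aE distrC => /ltW.
exact.
Qed.

Lemma ler_tnorm_wsum (f : seq L -> T) a :
  tnorm (wsum f a) <= tnorm a * \sum_(w <- words L m) tnorm (f w).
Proof.
rewrite (le_trans (ler_tnorm_sum _ _)) // mulr_sumr; apply: ler_sum => w _.
by rewrite tnormZ ler_wpM2r ?tnorm_ge0 // ler_tcoef_tnorm.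
Qed.

Lemma ler_tnorm_tdeg a : tnorm (tdeg a) <= m%:R * tnorm a.
Proof.
rewrite /tnorm mulr_sumr big_seq [leRHS]big_seq; apply: ler_sum => w.
rewrite mem_words => wm; rewrite tcoef_deg normrM ler_wpM2r // ger0_norm //.
by rewrite ler_nat.
Qed.

(** The defect [dynkin - tdeg] is bounded for [tnorm] and kills [qlog g], so at [qlog a] it is
    controlled by [qlog a - qlog g], which is of the order of [a - g]. *)
Lemma free_group_closed a :
  (forall e : R, 0 < e -> e <= 1 -> exists2 g, free_group g & tnorm (g - a) <= e) ->
  free_group a.
Proof.
move=> Ha; apply/free_groupP.
have a1 : tconst a = 1.
  apply/eqP; rewrite -subr_eq0 -normr_le0 distrC; apply: (@ler0_scaled _ 1) => e e0 e1.
  have [g Gg ga] := Ha e e0 e1; rewrite mul1r -(tconst_free_group Gg) /tconst -tcoefB.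
  exact: le_trans (ler_tcoef_tnorm _ _) ga.
split=> //; apply/free_lieP; split; first exact/lowMr/low1_deg.
have au := tconst_unit a1.
pose theta x := dynkin x - tdeg x.
have thetaB x y : theta (x - y) = theta x - theta y.
  by rewrite /theta !linearB /=; tlin.
pose S := \sum_(w <- words L m) tnorm (wbr m w) + m%:R.
have theta_le x : tnorm (theta x) <= S * tnorm x.
  rewrite (le_trans (ler_tnormB _ _)) // mulrDl lerD ?ler_tnorm_tdeg //.
  by rewrite mulrC ler_tnorm_wsum.
have S0 : 0 <= S by rewrite addr_ge0 // sumr_ge0 // => w _; apply: tnorm_ge0.
apply/eqP; rewrite -subr_eq0; apply/eqP; rewrite -/(theta _); apply: tnorm_eq0.
apply/eqP; rewrite eq_le tnorm_ge0 andbT.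
(* [ga] bounds [g^-1] for every group element [g] within 1 of [a]; this is the use of [e <= 1]. *)
pose al := tnorm a^-1; pose ga := geom m (1 + (tnorm a + 1)).
pose M := al * m%:R + al * ga * (m%:R * (tnorm a + 1)).
apply: (@ler0_scaled _ (S * M)) => e e0 e1.
have [g Gg gae] := Ha e e0 e1; have [g1 Lg] := free_group_qlog Gg.
have gu := tconst_unit g1.
have gB : tnorm g <= tnorm a + 1.
  rewrite -[g](subrK a) (le_trans (ler_tnormD _ _)) // addrC lerD2l.
  exact: le_trans gae e1.
have -> : theta (qlog a) = theta (qlog a - qlog g).
  by rewrite thetaB [theta (qlog g)]/theta dynkin_free_lie // subrr subr0.
rewrite (le_trans (theta_le _)) // -mulrA ler_wpM2l //.
have -> : qlog a - qlog g = a^-1 * tdeg (a - g) + a^-1 * (g - a) * g^-1 * tdeg g.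
  rewrite /qlog linearB /= !mulrBr !mulrBl -(mulrA a^-1 g) mulrV // mulVr //.
  by rewrite mulr1 mul1r; tlin.
have al0 : 0 <= al by apply: tnorm_ge0.
rewrite (le_trans (ler_tnormD _ _)) // /M mulrDl; apply: lerD.
  rewrite (le_trans (ler_tnormM _ _)) // -/al -mulrA ler_wpM2l //.
  rewrite (le_trans (ler_tnorm_tdeg _)) // ler_wpM2l // tnormBC //.
rewrite (le_trans (ler_tnormM _ _)) // [leRHS]mulrAC; apply: ler_pM; rewrite ?tnorm_ge0 //.
  rewrite (le_trans (ler_tnormM _ _)) // [leRHS]mulrAC; apply: ler_pM; rewrite ?tnorm_ge0 //.
    by rewrite (le_trans (ler_tnormM _ _)) // ler_wpM2l.
  rewrite (le_trans (ler_tnormV g1)) // ler_geom ?addr_ge0 ?tnorm_ge0 //.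
  by rewrite lerD2l.
by rewrite (le_trans (ler_tnorm_tdeg _)) // ler_wpM2l.
Qed.

Lemma ler_tnorm_dilation t a : 1 <= t -> tnorm (dilation t a) <= t ^+ m * tnorm a.
Proof.
move=> t1; rewrite /tnorm mulr_sumr big_seq [leRHS]big_seq; apply: ler_sum => w.
rewrite mem_words => wm; rewrite tcoef_dilation normrM ler_wpM2r //.
by rewrite ger0_norm ?exprn_ge0 ?(le_trans ler01) // ler_weXn2l.
Qed.

Lemma ler_dilation_tnorm t a : 1 <= t -> low 1 a -> t * tnorm a <= tnorm (dilation t a).
Proof.
move=> t1 la; rewrite /tnorm mulr_sumr; apply: ler_sum => w _.
rewrite tcoef_dilation; case: w => [|i w]; first by rewrite la // mulr0 normr0 mulr0.
rewrite normrM ler_wpM2r // ger0_norm ?exprn_ge0 ?(le_trans ler01) //.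
by rewrite -{1}[t]expr1 ler_weXn2l.
Qed.

(** For [t >= 0] the norm of [dilation t a] is a polynomial in [t], with value 0 at 0 and at least 1
    at 1. *)
Lemma tnorm_dilation_ivt a : low 1 a -> 1 <= tnorm a ->
  exists2 t, 0 <= t <= 1 & tnorm (dilation t a) = 1.
Proof.
move=> la a1.
pose q : {poly R} := \sum_(w <- words L m) `|tcoef a w| *: 'X^(size w).
have qE t : 0 <= t -> q.[t] = tnorm (dilation t a).
  move=> t0; rewrite /q horner_sum; apply: eq_bigr => w _.
  by rewrite hornerZ hornerXn tcoef_dilation normrM mulrC (ger0_norm (exprn_ge0 _ t0)).
have q0 : q.[0] = 0.
  rewrite qE // /tnorm big1 // => -[|i w] _.
    by rewrite tcoef_dilation la // mulr0 normr0.
  by rewrite tcoef_dilation expr0n mul0r normr0.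
have q1 : q.[1] = tnorm a by rewrite qE // dilation_1.
have [|t t01 /rootP] := @poly_ivt _ (q - 1%:P) 0 1 ler01.
  by rewrite !hornerE q0 q1 sub0r lerN10 subr_ge0.
rewrite !hornerE => /eqP; rewrite subr_eq0 => /eqP qt.
by exists t => //; rewrite -qE //; case/andP: t01.
Qed.

End TensorTopology.

(** * Comparison of the homogeneous norm with the coefficients *)

Section HomogeneousNorm.
Variables (R : realType) (V : normedVectType R) (m : nat).
Local Notation T := (ttensor V m).
Local Notation L := (letter V).
Variables (N : T -> R) (N_norm : homogeneous_norm N).
Implicit Types (v : V) (a b c g h x y : T) (w u : seq L) (k n : nat) (s t : R).

Lemma hnorm1 : N 1 = 0.
Proof. exact/(hnorm_eq0 N_norm (free_group1 V m)). Qed.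

Lemma hnorm_texpZ t v : N (texp (tvec m (t *: v))) = `|t| * N (texp (tvec m v)).
Proof.
by rewrite -dilation_tvec -dilation_texp hnorm_dilation //; apply: free_group_tvec.
Qed.

Lemma hnorm_prod I (r : seq I) (F : I -> T) : (forall i, free_group (F i)) ->
  N (\prod_(i <- r) F i) <= \sum_(i <- r) N (F i).
Proof.
move=> GF; elim: r => [|i r IH]; first by rewrite !big_nil hnorm1.
rewrite !big_cons (le_trans (hnorm_mul N_norm _ _)) ?lerD2l //.
exact: free_group_prod.
Qed.

Definition letter_bound : R := \sum_(i : L) N (texp (evec m i)).

Lemma letter_bound_ge0 : 0 <= letter_bound.
Proof.
by apply: sumr_ge0 => i _; apply: (hnorm_ge0 N_norm); apply: free_group_tvec.
Qed.

Lemma hnorm_letter t (i : L) : N (texp (t *: evec m i)) <= `|t| * letter_bound.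
Proof.
rewrite -linearZ /= hnorm_texpZ ler_wpM2l // /letter_bound (bigD1 i) //= lerDl.
by apply: sumr_ge0 => j _; apply: (hnorm_ge0 N_norm); apply: free_group_tvec.
Qed.

Lemma hnorm_reachable K (C : R) g : 0 <= C -> reachable K C g ->
  N g <= K%:R * (C * letter_bound).
Proof.
move=> C0 [vs [sv vC ->]].
have GF (p : R * L) : free_group (texp (p.1 *: evec m p.2)).
  by rewrite -linearZ; apply: free_group_tvec.
rewrite (le_trans (hnorm_prod _ GF)) //.
apply: (@le_trans _ _ (\sum_(p <- vs) C * letter_bound)).
  rewrite big_seq [leRHS]big_seq; apply: ler_sum => p pv.
  rewrite (le_trans (hnorm_letter _ _)) // ler_wpM2r ?letter_bound_ge0 //.
  exact: (allP vC).
rewrite big_const_seq count_predT iter_addr_0 -[_ *+ _]mulr_natl.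
by rewrite ler_wpM2r ?mulr_ge0 ?letter_bound_ge0 // ler_nat.
Qed.

Lemma hnorm_bounded (B : R) : exists2 M, 0 < M & forall g, free_group g -> tnorm g <= B -> N g <= M.
Proof.
have [K [C [C0 H]]] := chow V m B.
exists (1 + K%:R * (C * letter_bound)).
  by rewrite ltr_pwDl // !mulr_ge0 ?letter_bound_ge0.
move=> g Gg gB; rewrite (le_trans (hnorm_reachable C0 (H g Gg gB))) // lerDr //.
Qed.

Lemma dilation_sub1 t g : dilation t g - 1 = dilation t (g - 1).
Proof. by rewrite linearB /= dilation1. Qed.

Lemma low_sub1 g : free_group g -> low 1 (g - 1).
Proof.
move=> Gg; apply/low_const.
by rewrite /tconst tcoefB -!/(tconst _) (tconst_free_group Gg) tconst1 subrr.
Qed.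

(** Homogeneity turns boundedness into continuity at 1: if [tnorm (g - 1) <= l^-m], then
    [dilation l g] is within 1 of the unit, so [l * N g <= M], and [l] is chosen with
    [M <= l * e]. *)
Lemma hnorm_small (e : R) : 0 < e ->
  exists2 d : R, 0 < d & forall g, free_group g -> tnorm (g - 1) <= d -> N g <= e.
Proof.
move=> e0; have [M M0 HM] := hnorm_bounded 2.
pose l := 1 + M / e; have l1 : 1 <= l by rewrite lerDl divr_ge0 // ltW.
have l0 : 0 < l by apply: lt_le_trans l1.
exists (l ^+ m)^-1; first by rewrite invr_gt0 exprn_gt0.
move=> g Gg gd.
have := HM (dilation l g) (free_group_dilation l Gg) _.
rewrite (hnorm_dilation N_norm) // gtr0_norm // => H.
rewrite -(ler_pM2l l0) (le_trans (H _)) //; last first.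
  by rewrite mulrDl mul1r divfK ?gt_eqF // lerDr ltW.
rewrite -[dilation l g](subrK 1) (le_trans (ler_tnormD _ _)) // tnorm1.
rewrite -[leRHS]/(1 + 1) lerD2r dilation_sub1 (le_trans (ler_tnorm_dilation _ l1)) //.
by rewrite -ler_pdivlMl ?exprn_gt0 // mulr1.
Qed.

(** Otherwise elements of the sphere with [N] tending to 0 cluster at some [a] in the group with
    [N a = 0], so [a = 1], which is at distance 1 from the sphere. *)
Lemma hnorm_sphere :
  exists2 c : R, 0 < c & forall g, free_group g -> tnorm (g - 1) = 1 -> c <= N g.
Proof.
apply: contrapT => H.
have {}H n : exists g, [/\ free_group g, tnorm (g - 1) = 1 & N g <= n.+1%:R^-1].
  apply: contrapT => Hn; apply: H; exists n.+1%:R^-1; first by rewrite invr_gt0.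
  move=> g Gg g1; rewrite leNgt; apply/negP => /ltW gn; apply: Hn.
  by exists g.
have [g Hg] := choice H.
have gB n : tnorm (g n) <= 2.
  have [_ g1 _] := Hg n.
  by rewrite -[g n](subrK 1) (le_trans (ler_tnormD _ _)) // tnorm1 g1.
have [a Ha] := bounded_cluster gB.
have Ga : free_group a.
  apply: free_group_closed => e e0 _; have [n _ ga] := Ha e e0 0%N.
  by exists (g n) => //; case: (Hg n).
have a1 : 1 <= tnorm (a - 1).
  rewrite -subr_le0; apply: (@ler0_scaled _ _ 1) => e e0 _; rewrite mul1r.
  have [n _ ga] := Ha e e0 0%N; have [_ g1 _] := Hg n.
  rewrite lerBlDr -g1 (_ : g n - 1 = (g n - a) + (a - 1)); last by tlin.
  by rewrite (le_trans (ler_tnormD _ _)) // lerD2r.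
suff Na : N a <= 0.
  have /(hnorm_eq0 N_norm Ga) : N a = 0 by apply/eqP; rewrite eq_le Na hnorm_ge0.
  by move=> aE; move: a1; rewrite aE subrr tnorm0 ler10.
apply: (@ler0_scaled _ _ 2) => e e0 _.
have [d d0 Hd] := hnorm_small e0.
pose ga : R := geom m (1 + 2); have ga0 : 0 <= ga by apply: geom_ge0.
pose n0 := Num.trunc e^-1.
have dg : 0 < d / (1 + ga) by rewrite divr_gt0 // ltr_pwDl.
have [n n0n gna] := Ha _ dg n0; have [Gg _ Ng] := Hg n.
have gu := free_group_unit Gg.
(* Subadditivity gives the passage to the limit: the first factor has small [N] by the choice of
   [n0], the second is near 1. *)
have -> : a = g n * ((g n)^-1 * a) by rewrite mulrA mulrV // mul1r.
have Gh : free_group ((g n)^-1 * a) by apply: free_groupM => //; apply: free_groupV.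
rewrite (le_trans (hnorm_mul N_norm Gg Gh)) // mulrDl mul1r lerD //.
  rewrite (le_trans Ng) // -[leRHS]invrK lef_pV2 ?posrE ?invr_gt0 //.
  rewrite (le_trans (ltW (truncnS_gt _))) // ler_nat ltnS //.
apply: Hd => //.
have -> : (g n)^-1 * a - 1 = (g n)^-1 * (a - g n) by rewrite mulrBr mulVr.
rewrite (le_trans (ler_tnormM _ _)) // tnormBC.
apply: (@le_trans _ _ (ga * (d / (1 + ga)))).
  apply: ler_pM; rewrite ?tnorm_ge0 //.
  rewrite (le_trans (ler_tnormV (tconst_free_group Gg))) // ler_geom ?addr_ge0 ?tnorm_ge0 //.
  by rewrite lerD2l.
rewrite mulrCA ler_piMr ?(ltW d0) // ler_pdivrMr ?ltr_pwDl // mul1r lerDr //.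
Qed.

(** An element outside the unit ball around 1 is shrunk onto the sphere by a dilation with [t <= 1],
    which can only decrease [N]. *)
Lemma hnorm_lower :
  exists2 c : R, 0 < c & forall g, free_group g -> N g < c -> tnorm (g - 1) <= 1.
Proof.
have [c c0 Hc] := hnorm_sphere; exists c => // g Gg Ngc.
rewrite leNgt; apply/negP => /ltW /(tnorm_dilation_ivt (low_sub1 Gg)).
move=> [t /andP[t0 t1]]; rewrite -dilation_sub1 => /(Hc _ (free_group_dilation t Gg)).
rewrite (hnorm_dilation N_norm) // ger0_norm // leNgt => /negP; apply.
by rewrite (le_lt_trans _ Ngc) // ler_piMl // hnorm_ge0.
Qed.

Lemma tnorm_small (e : R) : 0 < e ->
  exists2 d : R, 0 < d & forall g, free_group g -> N g <= d -> tnorm (g - 1) <= e.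
Proof.
move=> e0; have [c c0 Hc] := hnorm_lower.
pose l := 1 + e^-1; have l1 : 1 <= l by rewrite lerDl invr_ge0 ltW.
have l0 : 0 < l by apply: lt_le_trans l1.
(* Half of [c], since [hnorm_lower] asks for a strict inequality. *)
exists (c / 2 / l); first by rewrite !divr_gt0.
move=> g Gg gd.
have := Hc (dilation l g) (free_group_dilation l Gg).
rewrite (hnorm_dilation N_norm) // gtr0_norm // dilation_sub1 => H.
rewrite -(ler_pM2l l0) (le_trans (ler_dilation_tnorm l1 (low_sub1 Gg))) //.
rewrite (le_trans (H _)) //.
  rewrite (@le_lt_trans _ _ (c / 2)) //; first by rewrite mulrC -ler_pdivlMr.
  by rewrite ltr_pdivrMr // mulr_natr mulr2n ltrDl.
by rewrite mulrDl mul1r mulVf ?gt_eqF // lerDr ltW.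
Qed.

Lemma tnorm_bounded (M : R) :
  exists B : R, forall g, free_group g -> N g <= M -> tnorm g <= B.
Proof.
have [c c0 Hc] := hnorm_lower.
pose l := 1 + `|M| / c; have l1 : 1 <= l by rewrite lerDl divr_ge0 // ltW.
have l0 : 0 < l by apply: lt_le_trans l1.
exists (l ^+ m + 1) => g Gg gM.
rewrite -[g](subrK 1) (le_trans (ler_tnormD _ _)) // tnorm1 lerD2r.
have -> : g - 1 = dilation l (dilation l^-1 g - 1).
  by rewrite dilation_sub1 dilation_comp mulfV ?gt_eqF // dilation_1.
rewrite (le_trans (ler_tnorm_dilation _ l1)) // ler_piMr ?exprn_ge0 ?(ltW l0) //.
apply: Hc; first exact: free_group_dilation.
rewrite (hnorm_dilation N_norm) // gtr0_norm ?invr_gt0 // ltr_pdivrMl //.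
rewrite (le_lt_trans gM) // (le_lt_trans (ler_norm M)) //.
by rewrite mulrDl mul1r divfK ?gt_eqF // ltrDr.
Qed.

(** [g] is dilated to norm 1, where [tnorm] is bounded and [chow] applies, and the factors are
    dilated back. Padding with zero vectors makes their number exactly [K], so that all cells of a
    grid are subdivided alike. *)
Lemma hnorm_chow : exists K (C : R), [/\ (0 < K)%N, 0 <= C & forall g, free_group g ->
  exists vs : seq V, [/\ size vs = K, g = \prod_(v <- vs) texp (tvec m v) &
    forall v, v \in vs -> N (texp (tvec m v)) <= C * N g]].
Proof.
have [B HB] := tnorm_bounded 1.
have [K [C [C0 H]]] := chow V m B.
(* The successor makes the number of factors positive. *)
exists K.+1, (C * letter_bound); split=> //; first by rewrite mulr_ge0 ?letter_bound_ge0.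
move=> g Gg; have Ng0 := hnorm_ge0 N_norm Gg.
have z0 : N (texp (tvec m 0)) <= C * letter_bound * N g.
  by rewrite linear0 texp0 hnorm1 !mulr_ge0 ?letter_bound_ge0.
case: (eqVneq (N g) 0) => [/(hnorm_eq0 N_norm Gg) ->|Ng].
  exists (nseq K.+1 0); split; first by rewrite size_nseq.
    by rewrite big_nseq linear0 texp0 iter_fix // mulr1.
  by move=> v /nseqP[-> _]; rewrite linear0 texp0 hnorm1 mulr0.
have Ngp : 0 < N g by rewrite lt_def Ng.
have [||vs [sv vC gE]] := H (dilation (N g)^-1 g).
- exact: free_group_dilation.
- apply: HB; first exact: free_group_dilation.
  by rewrite (hnorm_dilation N_norm) // gtr0_norm ?invr_gt0 // mulVf.
pose us := [seq N g *: (p.1 *: basis p.2) | p <- vs].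
exists (us ++ nseq (K.+1 - size us) 0); split.
- by rewrite size_cat size_nseq subnKC // size_map leqW.
- rewrite big_cat /= big_nseq linear0 texp0 iter_fix ?mulr1 //.
  rewrite -[LHS]dilation_1 -(mulfV Ng) -dilation_comp gE /us big_map.
  rewrite /horizontal_product (big_morph _ (dilationM (N g)) (dilation1 _ _ _)).
  by apply: eq_bigr => p _; rewrite dilation_texp -linearZ /= dilation_tvec.
move=> v; rewrite mem_cat => /orP[|/nseqP[-> _]] //.
move=> /mapP[p pv ->]; rewrite hnorm_texpZ ger0_norm // mulrC ler_wpM2r //.
rewrite linearZ /= (le_trans (hnorm_letter _ _)) // ler_wpM2r ?letter_bound_ge0 //.
exact: (allP vC).
Qed.

(** Conjugation is linear in [h - 1], and [tnorm] bounds it as soon as [g] and [g^-1] are bounded;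
    [tnorm_small] and [hnorm_small] translate from and to [N]. *)
Lemma hnorm_conj (M e : R) : 0 < e -> exists2 d : R, 0 < d &
  forall g h, free_group g -> free_group h -> N g <= M -> N h <= d -> N (g^-1 * h * g) <= e.
Proof.
move=> e0; have [B HB] := tnorm_bounded M; have [d d0 Hd] := hnorm_small e0.
pose Z := geom m (1 + `|B|) * `|B|.
have Z0 : 0 <= Z by rewrite mulr_ge0 // geom_ge0 // addr_ge0.
have [d' d'0 Hd'] := @tnorm_small (d / (1 + Z)) (divr_gt0 d0 (ltr_wpDr Z0 ltr01)).
exists d' => // g h Gg Gh gM hd.
have gu := free_group_unit Gg; have gB := le_trans (HB g Gg gM) (ler_norm B).
apply: Hd; first by do !apply: free_groupM => //; apply: free_groupV.
have -> : g^-1 * h * g - 1 = g^-1 * (h - 1) * g.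
  by rewrite mulrBr mulrBl mulr1 mulVr.
rewrite (le_trans (ler_tnormM _ _)) //.
apply: (@le_trans _ _ (geom m (1 + `|B|) * (d / (1 + Z)) * `|B|)).
  apply: ler_pM; rewrite ?tnorm_ge0 // (le_trans (ler_tnormM _ _)) //.
  apply: ler_pM; rewrite ?tnorm_ge0 ?Hd' //.
  rewrite (le_trans (ler_tnormV (tconst_free_group Gg))) // ler_geom ?addr_ge0 ?tnorm_ge0 //.
  by rewrite lerD2l.
rewrite mulrAC -/Z mulrCA ler_piMr ?(ltW d0) // ler_pdivrMr ?ltr_pwDl // mul1r lerDr //.
Qed.

End HomogeneousNorm.

(** * A family of flat functions *)

Section Bump.
Variable R : realType.
Implicit Types (f g : R -> R) (x y t : R) (k n : nat).

(** The function [x^-k exp (-1/x)] extended by 0. The index [k] makes the span of the family stable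
    under differentiation. *)
Definition flat k x : R := if 0 < x then x^-1 ^+ k * expR (- x^-1) else 0.

Lemma flat_ge0 k x : 0 <= flat k x.
Proof.
rewrite /flat; case: ifP => // x0.
by rewrite mulr_ge0 ?expR_ge0 // exprn_ge0 // invr_ge0 ltW.
Qed.

Lemma flat_le0 k x : x <= 0 -> flat k x = 0.
Proof. by rewrite /flat leNgt => /negbTE->. Qed.

Lemma flat_gt0 k x : 0 < x -> 0 < flat k x.
Proof. by move=> x0; rewrite /flat x0 mulr_gt0 ?expR_gt0 // exprn_gt0 // invr_gt0. Qed.

Lemma flat_le k x : flat k x <= k.+1%:R ^+ k.+1 * `|x|.
Proof.
rewrite /flat; case: ifPn => [x0|_]; last by rewrite mulr_ge0 // exprn_ge0.
rewrite gtr0_norm // -ler_pdivrMr // mulrAC -exprSr expRN.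
rewrite ler_pdivrMr ?expR_gt0 //.
set y := x^-1; have y0 : 0 < y by rewrite invr_gt0.
have n0 : 0 < k.+1%:R :> R by rewrite ltr0n.
(* With [n = k.+1]: [y^n = n^n (y/n)^n <= n^n exp (y/n)^n = n^n exp y]. *)
have -> : y = k.+1%:R * (y / k.+1%:R) by rewrite mulrC divfK ?gt_eqF.
rewrite expRM_natl -exprMn; apply: lerXn2r; rewrite ?nnegrE.
- by rewrite !mulr_ge0 ?invr_ge0 // ltW.
- by rewrite mulr_ge0 ?expR_ge0 // ltW.
rewrite ler_pM2l // (le_trans _ (expR_ge1Dx _)) // lerDr //.
Qed.

Lemma der_flat k : der (flat k) (fun x => - (k%:R * flat k.+1 x) + flat k.+2 x).
Proof.
move=> x; case: (ltrgtP x 0) => x0.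
- rewrite !flat_le0 ?(ltW x0) // mulr0 oppr0 addr0; apply: (@near_eq_is_derive _ _ _ (fun=> 0 : R)).
  near=> y; rewrite flat_le0 // ltW //.
  by near: y; apply: lt_nbhsl.
- apply: (@near_eq_is_derive _ _ _ (fun y => y^-1 ^+ k * expR (- y^-1))).
    near=> y; rewrite /flat ifT //.
    by near: y; apply: lt_nbhsr.
  have xn0 : x != 0 by rewrite gt_eqF.
  have dV : is_derive x (1 : R) (fun y : R => y^-1) (- x ^- 2).
    have := @is_deriveV R id x 1 1 xn0 (is_derive_id _ _).
    by rewrite /GRing.scale /= mulr1.
  have dE : is_derive x (1 : R) (fun y : R => expR (- y^-1)) (expR (- x^-1) * x ^- 2).
    have := @is_derive1_comp _ expR (fun y => - y^-1) x _ _ _ (is_deriveN dV).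
    by rewrite opprK; apply.
  apply: (is_derive_eq (is_deriveM (is_derX k dV) dE)).
  rewrite /flat x0 /GRing.scale /= -!exprVn !exprS.
  by case: k => [|k] /=; rewrite ?exprS; ring.
- subst x; rewrite !flat_le0 // mulr0 oppr0 addr0.
  (* At 0 the difference quotient of [flat k] is [flat k.+1], continuous there by the linear bound
     [flat_le]. *)
  apply/is_derive1_caratheodory; exists (flat k.+1); split.
  + move=> z; rewrite !subr0 [flat k 0]flat_le0 // subr0 /flat.
    case: ifP => z0; last by rewrite mul0r.
    by rewrite exprSr -!mulrA [_^-1 * _]mulrC -mulrA divff ?mulr1 // gt_eqF.
  + have f0 := flat_le0 k.+1 (lexx 0).
    suff : flat k.+1 y @[y --> (0 : R)] --> (0 : R) by rewrite -{2}f0.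
    pose C : R := k.+2%:R ^+ k.+2.
    apply: (@squeeze_cvgr _ _ _ _ (fun=> 0) (fun y => C * `|y|)).
    * by near=> y; rewrite flat_ge0 flat_le.
    * exact: cvg_cst.
    * rewrite -[X in _ --> X](mulr0 C) -[X in C * X](@normr0 _ R).
      by apply: cvgMr; apply: cvg_norm; apply: cvg_id.
  + by rewrite flat_le0.
Unshelve. all: by end_near. Qed.

End Bump.

(** * A class of functions closed under differentiation *)

Section SmoothFunctions.
Variable R : realType.
Implicit Types (f g : R -> R) (x y t : R) (k n : nat).

(** A syntactic class: derivatives of all orders follow from one differentiation rule per
    constructor. *)
Inductive smooth_fun : (R -> R) -> Prop :=
| smooth_cst c : smooth_fun (fun=> c)
| smooth_flat k : smooth_fun (flat k)
| smooth_add f g : smooth_fun f -> smooth_fun g -> smooth_fun (fun x => f x + g x)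
| smooth_mul f g : smooth_fun f -> smooth_fun g -> smooth_fun (fun x => f x * g x)
| smooth_inv f : (forall x, f x != 0) -> smooth_fun f -> smooth_fun (fun x => (f x)^-1)
| smooth_affine f a b : smooth_fun f -> smooth_fun (fun x => f (a * x + b)).

Lemma der_affine (a b : R) : der (fun x => a * x + b) (fun=> a).
Proof.
apply: (der_eq (derD (derZ a (@der_id R)) (der_cst b))) => x.
by rewrite mulr1 addr0.
Qed.

Lemma der_inv f f' : (forall x, f x != 0) -> der f f' ->
  der (fun x => (f x)^-1) (fun x => - ((f x)^-1 * (f x)^-1 * f' x)).
Proof.
move=> f0 df x; apply: (is_derive_eq (is_deriveV (f0 x) (df x))).
by rewrite /GRing.scale /= expr2 invfM mulNr.
Qed.

Lemma smooth_fun_der f : smooth_fun f -> exists2 f', smooth_fun f' & der f f'.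
Proof.
elim=> {f} [c|k|f g _ [f' sf df] _ [g' sg dg]|f g sf [f' sf' df] sg [g' sg' dg]
           |f f0 sf [f' sf' df]|f a b _ [f' sf df]].
- by exists (fun=> 0); [exact: smooth_cst|exact: der_cst].
- exists (fun x => - k%:R * flat k.+1 x + flat k.+2 x).
    apply: smooth_add; last exact: smooth_flat.
    by apply: smooth_mul; [exact: smooth_cst|exact: smooth_flat].
  by apply: (der_eq (der_flat k)) => x; rewrite mulNr.
- by exists (fun x => f' x + g' x); [exact: smooth_add|exact: derD].
- exists (fun x => f' x * g x + f x * g' x); last exact: derM.
  by apply: smooth_add; apply: smooth_mul.
- exists (fun x => -1 * ((f x)^-1 * (f x)^-1 * f' x)).
    apply: smooth_mul; first exact: smooth_cst.
    by apply: smooth_mul => //; apply: smooth_mul; apply: smooth_inv.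
  by apply: (der_eq (der_inv f0 df)) => x; rewrite mulN1r.
- exists (fun x => f' (a * x + b) * a); last exact: der_comp (der_affine a b).
  by apply: smooth_mul; [exact: smooth_affine|exact: smooth_cst].
Qed.

Lemma smooth_fun_derP f : smooth_fun f -> exists f', smooth_fun f' /\ der f f'.
Proof. by move=> /smooth_fun_der[f' ? ?]; exists f'. Qed.

Lemma der_lipschitz f f' (D : R) : der f f' -> (forall x, `|f' x| <= D) ->
  forall x y, `|f x - f y| <= D * `|x - y|.
Proof.
move=> df fD x y; wlog xy : x y / y <= x.
  move=> H; case: (leP y x) => [|/ltW] xy; first exact: H.
  by rewrite distrC [`|x - y|]distrC; apply: H.
have [c _ ->] := MVT_segment xy (fun z _ => df z)
  (continuous_subspaceT (der_continuous df)).
by rewrite normrM ler_wpM2r.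
Qed.

(** The classical quotient [a / (a + b)], with [a] flat at 0 and [b] flat at 1. Its derivative
    vanishes outside the unit interval, and [D] is the maximum of its absolute value there. *)
Lemma smooth_step : exists f f' (D : R),
  [/\ smooth_fun f, smooth_fun f' /\ der f f', forall x, x <= 0 -> f x = 0 /\ f' x = 0,
      forall x, 1 <= x -> f x = 1 /\ f' x = 0 &
      0 <= D /\ forall x y, `|f x - f y| <= D * `|x - y| ].
Proof.
pose a x := flat 0 x; pose b x := flat 0 (-1 * x + 1).
pose a' x := flat 2 x; pose b' x := flat 2 (-1 * x + 1).
have da : der a a'.
  by apply: (der_eq (der_flat 0)) => x; rewrite mul0r oppr0 add0r.
have db : der b (fun x => - b' x).
  apply: (der_eq (der_comp (der_flat 0) (der_affine (-1) 1))) => x.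
  by rewrite mul0r oppr0 add0r mulrN1.
have s0 x : 0 < a x + b x.
  case: (ltP 0 x) => x0; first by rewrite ltr_pwDl ?flat_gt0 // flat_ge0.
  by rewrite ltr_wpDl ?flat_ge0 // flat_gt0 // mulN1r ltr_wpDl // oppr_ge0.
have sn0 x : a x + b x != 0 by rewrite gt_eqF.
have sa : smooth_fun a by apply: smooth_flat.
have sb : smooth_fun b by apply: smooth_affine; apply: smooth_flat.
pose f x := a x * (a x + b x)^-1.
pose f' x := (a' x * b x + a x * b' x) / (a x + b x) ^+ 2.
have sf : smooth_fun f.
  by apply: smooth_mul => //; apply: smooth_inv => //; apply: smooth_add.
have df : der f f'.
  apply: (der_eq (derM da (der_inv sn0 (derD da db)))) => x.
  by rewrite /f'; field.
have f0 x : x <= 0 -> f x = 0 /\ f' x = 0.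
  by move=> x0; rewrite /f /f' /a /a' !flat_le0 // !mul0r addr0 mul0r.
have f1 x : 1 <= x -> f x = 1 /\ f' x = 0.
  move=> x1; have bx : b x = 0 by rewrite /b flat_le0 // mulN1r addrC subr_le0.
  have bx' : b' x = 0 by rewrite /b' flat_le0 // mulN1r addrC subr_le0.
  rewrite /f /f' bx bx' !mulr0 !addr0 mul0r; split=> //.
  by have := sn0 x; rewrite bx addr0 => /mulfV->.
have sf' : smooth_fun f'.
  have [g sg dg] := smooth_fun_der sf.
  by have -> : f' = g by apply/funext; apply: der_unique df dg.
have [h _ gh] := smooth_fun_der sf'.
have cf' : {within `[0, 1], continuous (fun x => `|f' x|)}.
  apply: continuous_subspaceT => x; apply: cvg_norm; exact: (der_continuous gh).
have [c _ cmax] := EVT_max ler01 cf'.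
exists f, f', `|f' c|; split=> //; split=> //; apply: der_lipschitz df _ => x.
case: (leP x 0) => [/f0[_ ->]|x0]; first by rewrite normr0.
case: (leP 1 x) => [/f1[_ ->]|x1]; first by rewrite normr0.
by apply: cmax; rewrite in_itv /= !ltW.
Qed.

End SmoothFunctions.

(** * Punctured neighbourhoods in the unit interval *)

Section SmoothPaths.
Variables (R : realType) (V : normedVectType R).
Local Notation L := (letter V).
Implicit Types (v : V) (y z : R -> V) (t u : R) (k n : nat) (ps : seq ((R -> R) * V)).

Lemma nbhs01_proper t : t \in `[0, 1] -> ProperFilter (nbhs01 t).
Proof.
rewrite in_itv /= => /andP[t0 t1]; apply: Build_ProperFilter_ex.
move=> P /nbhs_ballP[e /= e0 He].
(* The end point farther from [t]; moving towards it by a small step stays inside the interval. *)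
pose z : R := if t <= 1 / 2 then 1 else 0.
pose s := Num.min (e / 2) 1.
have s0 : 0 < s by rewrite lt_min ltr01 andbT divr_gt0.
have s1 : s <= 1 by rewrite ge_min lexx orbT.
have se : s < e.
  by rewrite gt_min ltr_pdivrMr // mulr_natr mulr2n ltrDl e0.
have zt : z - t != 0 by rewrite /z; case: ifP => /= zt; apply/eqP => zt'; lra.
have zt1 : `|z - t| <= 1 by rewrite /z; case: ifP => _; rewrite ler_norml; lra.
exists (t + s * (z - t)); apply: He.
- rewrite /ball /= opprD addrA subrr sub0r normrN normrM gtr0_norm //.
  by rewrite (le_lt_trans _ se) // ler_piMr // ltW.
- by rewrite -subr_eq0 addrAC subrr add0r mulf_neq0 // gt_eqF.
- rewrite in_itv /=; rewrite /z; case: ifP => _; nra.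
Qed.

End SmoothPaths.

(** * Smooth finite sums, and continuity of the coordinates of [V] *)

Section SmoothSums.
Variables (R : realType) (V : normedVectType R).
Local Notation L := (letter V).
Implicit Types (y z : R -> V) (t u : R) (k n : nat).

Lemma nbhs01_filter t : Filter (nbhs01 t).
Proof. exact: within_filter. Qed.

(** Iterated derivatives are identified on the unit interval only, so limits must be seen to depend
    on nothing else. *)
Lemma eq_quotient01 y z t : {in `[0, 1], y =1 z} -> t \in `[0, 1] ->
  quotient01 y t @ nbhs01 t = quotient01 z t @ nbhs01 t.
Proof.
move=> yz t01; apply/funext => P; apply/propext.
have qE u : u \in `[0, 1] -> quotient01 y t u = quotient01 z t u.
  by move=> u01; rewrite /quotient01 !yz.
change (t^' [set u | `[0, 1]%classic u -> P (quotient01 y t u)] <->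
        t^' [set u | `[0, 1]%classic u -> P (quotient01 z t u)]).
by split; apply: filterS => u /= Pu u01; move: (Pu u01); rewrite qE.
Qed.

Lemma quotient01_cvg (f f' : R -> R) (v : V) t : der f f' ->
  (u - t)^-1 *: (f u *: v - f t *: v) @[u --> nbhs01 t] --> f' t *: v.
Proof.
move=> df; have [g [fg cg gt]] := (is_derive1_caratheodory f t (f' t)).1 (df t).
have F01 := nbhs01_filter t.
rewrite -gt; apply: (@cvg_trans _ (g u *: v @[u --> nbhs01 t])).
  apply: near_eq_cvg; rewrite /nbhs01 near_withinE; near=> u => _.
  rewrite -scalerBl fg scalerA mulrC mulfK // subr_eq0.
  by near: u; exact: nbhs_dnbhs_neq.
apply: cvgZr_tmp => P /cg nP.
by apply: filterS (nbhs_dnbhs nP) => u + _.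
Unshelve. all: by end_near. Qed.

Section Sums.
Variables (I : eqType) (r : seq I) (v : I -> V).
Implicit Types (F : I -> R -> R).

Definition vsum F t : V := \sum_(i <- r) F i t *: v i.

Lemma quotient01_vsum F F' t : (forall i, der (F i) (F' i)) ->
  quotient01 (vsum F) t @ nbhs01 t --> vsum F' t.
Proof.
move=> dF; have F01 := nbhs01_filter t.
rewrite /quotient01 /vsum; elim: r => [|i s IH].
  rewrite (_ : (fun u => _) = fun=> 0); first by rewrite big_nil; apply: cvg_cst.
  by apply/funext => u; rewrite !big_nil subrr scaler0.
rewrite (_ : (fun u => _) = fun u => (u - t)^-1 *: (F i u *: v i - F i t *: v i) +
    (u - t)^-1 *: (\sum_(j <- s) F j u *: v j - \sum_(j <- s) F j t *: v j)).
  by rewrite big_cons; apply: cvgD => //; apply: quotient01_cvg.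
by apply/funext => u; rewrite !big_cons opprD addrACA scalerDr.
Qed.

Lemma derive01_vsum F F' t : t \in `[0, 1] -> (forall i, der (F i) (F' i)) ->
  derive01 (vsum F) t = vsum F' t.
Proof.
move=> t01 dF; have P01 := nbhs01_proper t01.
apply: cvg_lim; first exact: norm_hausdorff.
exact: quotient01_vsum.
Qed.

(** On the unit interval every iterated derivative is again a [vsum] of functions of the class, with
    the same vectors. *)
Lemma smooth_path_vsum F : (forall i, smooth_fun (F i)) -> smooth_path (vsum F).
Proof.
move=> sF k.
have [G [sG yG]] : exists G, (forall i, smooth_fun (G i)) /\
    {in `[0, 1], iter k (@derive01 R V) (vsum F) =1 vsum G}.
  elim: k => [|k [G [sG yG]]]; first by exists F.
  have [G' HG'] := choice (fun i => smooth_fun_derP (sG i)).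
  exists G'; split=> [i|t t01]; first by case: (HG' i).
  rewrite iterS /derive01 (eq_quotient01 yG t01) -/(derive01 _ _).
  by apply: derive01_vsum => // i; case: (HG' i).
move=> t t01; rewrite (eq_quotient01 yG t01).
have [G' HG'] := choice (fun i => smooth_fun_derP (sG i)).
apply: (cvgP (vsum G' t)); apply: quotient01_vsum => i; by case: (HG' i).
Qed.

End Sums.

(** Equivalence of the norm of [V] with the l1 norm of coordinates, by compactness of the l1 sphere.
    Vectors are embedded in degree one of the step 1 tensors to use [bounded_cluster]. *)
Lemma ler_vcoord : exists2 C : R, 0 <= C & forall (i : L) (v : V), `|vcoord i v| <= C * `|v|.
Proof.
pose T := ttensor V 1.
have tnE (v : V) : tnorm (tvec 1 v) = \sum_(i : L) `|vcoord i v|.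
  rewrite /tnorm big_words_letter //; first by apply: eq_bigr => i _; rewrite /tvec tcoefE.
  by move=> [|i [|]] // *; rewrite /tvec tcoefE ?normr0 // if_same normr0.
suff [c c0 Hc] : exists2 c : R, 0 < c & forall v : V, tnorm (tvec 1 v) = 1 -> c <= `|v|.
  exists c^-1 => [|i v]; first by rewrite invr_ge0 ltW.
  have iv : `|vcoord i v| <= tnorm (tvec 1 v).
    by rewrite tnE (bigD1 i) //= lerDl sumr_ge0.
  rewrite (le_trans iv) // ler_pdivlMl // mulrC.
  case: (eqVneq (tnorm (tvec 1 v)) 0) => [->|v0]; first by rewrite mul0r.
  have vp : 0 < tnorm (tvec 1 v) by rewrite lt_def v0 tnorm_ge0.
  rewrite mulrC -ler_pdivlMr // -[_^-1]gtr0_norm ?invr_gt0 // mulrC -normrZ.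
  by apply: Hc; rewrite linearZ /= tnormZ gtr0_norm ?invr_gt0 // mulVf.
apply: contrapT => H.
have {}H n : exists v : V, tnorm (tvec 1 v) = 1 /\ `|v| <= n.+1%:R^-1.
  apply: contrapT => Hn; apply: H; exists n.+1%:R^-1; first by rewrite invr_gt0.
  move=> v v1; rewrite leNgt; apply/negP => /ltW vn; apply: Hn.
  by exists v.
have [g Hg] := choice H.
have gB n : tnorm (tvec 1 (g n)) <= 1 by case: (Hg n) => ->.
have [a Ha] := bounded_cluster gB.
pose v : V := \sum_(i : L) tcoef a [:: i] *: basis i.
have close (n : nat) : `|v| <= `|g n| + tnorm (tvec 1 (g n) - a) * \sum_(i : L) `|basis i|.
  rewrite -[v](subrK (g n)) addrC (le_trans (ler_normD _ _)) // lerD2l distrC.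
  rewrite {1}[g n]vcoord_sum /v -sumrB (le_trans (ler_norm_sum _ _ _)) // mulr_sumr.
  apply: ler_sum => i _; rewrite -scalerBl normrZ ler_wpM2r //.
  have := ler_tcoef_tnorm (tvec 1 (g n) - a) [:: i].
  by rewrite tcoefB {1}/tvec tcoefE.
have v0 : v = 0.
  apply/eqP; rewrite -normr_le0; apply: (@ler0_scaled _ _ (1 + \sum_(i : L) `|basis i|)).
  move=> e e0 _; have [n n0n gna] := Ha e e0 (Num.trunc e^-1).
  rewrite (le_trans (close n)) // mulrDl mul1r lerD //; last first.
    by rewrite mulrC ler_wpM2l // sumr_ge0.
  have [_ /le_trans->//] := Hg n.
  rewrite -[leRHS]invrK lef_pV2 ?posrE ?invr_gt0 //.
  by rewrite (le_trans (ltW (truncnS_gt _))) // ler_nat ltnS.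
have a0 (i : L) : tcoef a [:: i] = 0.
  have := vcoord_basis i i; rewrite eqxx => _.
  transitivity (vcoord i v); last by rewrite v0 /vcoord linear0.
  rewrite /v /vcoord linear_sum (bigD1 i) //= linearZ /= -/(vcoord i _) vcoord_basis eqxx.
  rewrite mulr1 big1 ?addr0 // => j ji.
  by rewrite linearZ /= -/(vcoord i _) vcoord_basis (negbTE ji) mulr0.
have [n _ gna] := Ha (1 / 2) (divr_gt0 ltr01 (ltr0Sn _ _)) 0%N.
have [g1 _] := Hg n; move: gna; apply/negP; rewrite -ltNge.
apply: (@lt_le_trans _ _ (tnorm (tvec 1 (g n)))).
  by rewrite g1 ltr_pdivrMr // mul1r ltrDl.
rewrite tnE /tnorm big_wordsS; apply: ler_wpDl => //.
apply: ler_sum => i _; rewrite big_words0 tcoefB a0 subr0 /tvec tcoefE //.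
Qed.

End SmoothSums.

(** * Extension of derivatives beyond the unit interval *)

Section Clamp.
Variable R : realType.
Implicit Types (t u : R).

(** The retraction onto the unit interval; composing with it extends a derivative to the line, where
    the flows are defined. *)
Definition clamp t : R := Num.max 0 (Num.min t 1).

Lemma clamp01 t : clamp t \in `[0, 1].
Proof. by rewrite in_itv /= /clamp le_max lexx ge_max ler01 ge_min lexx orbT. Qed.

Lemma clampK t : t \in `[0, 1] -> clamp t = t.
Proof.
by rewrite in_itv /= => /andP[t0 t1]; rewrite /clamp (min_idPl t1) (max_idPr t0).
Qed.

Lemma clamp_lip t u : `|clamp t - clamp u| <= `|t - u|.
Proof.
have h1 := ler_norm (t - u); have h2 := ler_norm (u - t).
rewrite distrC in h2; set d := `|t - u| in h1 h2 *.
rewrite /clamp ler_norml.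
have l1 : (0 : R) <= 1 := ler01.
case: (leP t 1) => t1; case: (leP u 1) => u1;
  rewrite ?(max_idPr l1); try case: (leP 0 t) => t0; try case: (leP 0 u) => u0;
  apply/andP; split; lra.
Qed.

(** The derivative has itself a convergent quotient at [clamp t], hence a Lipschitz estimate there,
    and [clamp] is 1-Lipschitz. *)
Lemma continuous_vcoord_derive01 (V : normedVectType R) (y : R -> V) (i : letter V) :
  smooth_path y -> continuous (fun t => vcoord i (derive01 y (clamp t))).
Proof.
move=> sy t; have t01 := clamp01 t; set t' := clamp t in t01 *.
have F01 := nbhs01_filter t'.
have /cvg_ex[l ql] := sy 1%N t' t01.
pose K : R := `|l| + 1; have K0 : 0 < K by rewrite ltr_wpDl.
have [e e0 He] : exists2 e : R, 0 < e & forall u, u \in `[0, 1] -> `|u - t'| < e ->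
    `|derive01 y u - derive01 y t'| <= K * `|u - t'|.
  have := (@cvgrPdist_le _ _ _ _ F01 _ _).1 ql 1 ltr01; rewrite /nbhs01 /dnbhs !near_withinE.
  move=> /nbhs_ballP[e /= e0 He]; exists e => // u u01 ue.
  case: (eqVneq u t') => [->|ut]; first by rewrite !subrr !normr0 mulr0.
  have := He u; rewrite /ball /= distrC => /(_ ue ut u01).
  rewrite /quotient01 /= distrC => qu.
  have -> : derive01 y u - derive01 y t' =
      (u - t') *: ((u - t')^-1 *: (derive01 y u - derive01 y t')).
    by rewrite scalerA divff ?scale1r // subr_eq0.
  rewrite normrZ mulrC ler_wpM2r //; set q := _ *: _ in qu *.
  by rewrite -[q](subrK l) (le_trans (ler_normD _ _)) // /K addrC lerD2l.
have [C C0 HC] := ler_vcoord V.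
apply/cvgrPdist_le => eps eps0.
near=> s.
have s01 := clamp01 s; have sl : `|clamp s - t'| <= `|s - t| by apply: clamp_lip.
rewrite distrC /vcoord -linearB -/(vcoord _ _) (le_trans (HC _ _)) //.
have se : `|s - t| < e.
  by near: s; apply/nbhs_ballP; exists e => //= s; rewrite /ball /= distrC.
have sd : `|s - t| <= eps / (C * K + 1).
  near: s; apply/nbhs_ballP; exists (eps / (C * K + 1)).
    by rewrite /= divr_gt0 // ltr_wpDl // mulr_ge0 // ltW.
  by move=> s; rewrite /ball /= distrC => /ltW.
have CK : 0 <= C * K by rewrite mulr_ge0 // ltW.
apply: (@le_trans _ _ (C * (K * `|s - t|))).
  rewrite ler_wpM2l // (le_trans (He _ s01 (le_lt_trans sl se))) //.
  by rewrite ler_wpM2l // ltW.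
rewrite mulrA (le_trans (ler_wpM2l CK sd)) // mulrCA ler_piMr ?(ltW eps0) //.
by rewrite ler_pdivrMr ?ltr_wpDl // mul1r lerDl.
Unshelve. all: by end_near. Qed.

End Clamp.

(** * Primitives of continuous functions *)

Section Primitives.
Variable R : realType.
Implicit Types (c F : R -> R) (t x : R).
Local Notation mu := (@lebesgue_measure R).

Lemma continuous_integrable_cc c (a b : R) : continuous c ->
  mu.-integrable `[a, b] (EFin \o c).
Proof.
move=> cc; apply: continuous_compact_integrable; first exact: segment_compact.
exact: continuous_subspaceT.
Qed.

Lemma continuous_primitive c : continuous c -> exists F, F 0 = 0 /\ der F c.
Proof.
move=> cc; pose G a x := (\int[mu]_(t in `[a, x]) c t)%R.
pose F x := if 0 <= x then (\int[mu]_(t in `]0, x]) c t)%R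
            else - (\int[mu]_(t in `]x, 0]) c t)%R.
have FG a x : a <= 0 -> a <= x -> F x = G a x - G a 0.
  move=> a0 ax; rewrite /F /G; case: (leP 0 x) => x0.
    by rewrite Rintegral_itvB ?bnd_simp //; apply: continuous_integrable_cc.
  rewrite -opprB Rintegral_itvB ?bnd_simp // ?(ltW x0) //.
  exact: continuous_integrable_cc.
exists F; split=> [|x]; first by rewrite (FG 0) // subrr.
(* A base point strictly to the left of both [x] and 0, so that near [x] the two-sided integral is
   an ordinary one up to a constant. *)
pose a := Num.min x 0 - 1.
have a0 : a < 0 by rewrite /a ltrBlDr add0r gt_min ltr01 orbT.
have ax : a < x by rewrite /a ltrBlDr gt_min ltrDl ltr01.
have [dG G'] : derivable (G a) x 1 /\ (G a)^`()%classic x = c x.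
  apply: (@continuous_FTC1_closed _ _ _ _ (x + 1)) => //; last exact: cc.
    by rewrite ltrDl.
  exact: continuous_integrable_cc.
have dGx : is_derive x (1 : R) (G a) (c x).
  by split; [exact: dG|rewrite -derive1E].
have dH : is_derive x (1 : R) (fun y => G a y - G a 0) (c x).
  by apply: (is_derive_eq (is_deriveD dGx (der_cst (- G a 0) x))); rewrite addr0.
apply: near_eq_is_derive dH.
near=> y; apply/esym/FG; first exact: ltW.
by apply: ltW; near: y; apply: lt_nbhsr.
Unshelve. all: by end_near. Qed.

Lemma Rintegral_primitive c F t : continuous c -> der F c -> F 0 = 0 -> 0 <= t ->
  (\int[mu]_(u in `]0%R, t[) c u)%R = F t.
Proof.
move=> cc dF F0; rewrite le_eqVlt => /predU1P[<-|t0].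
  by rewrite set_itvoo0 Rintegral_set0.
have ic := continuous_integrable_cc 0 t cc.
rewrite Rintegral_itv_bndo_bndc; last first.
  apply: integrableS ic => //; exact: subset_itv_oo_cc.
rewrite Rintegral_itv_obnd_cbnd; last first.
  apply: integrableS ic => //; exact: subset_itv_oc_cc.
rewrite /Rintegral (@continuous_FTC2 _ _ F) ?F0 ?sube0 //.
- exact: continuous_subspaceT.
- have cF := der_continuous dF; split=> [x _||].
  + by case: (dF x).
  + by apply: cvg_at_right_filter; apply: cF.
  + by apply: cvg_at_left_filter; apply: cF.
- by move=> x _; rewrite derive1E; apply: derive_val.
Qed.

End Primitives.

(** * Signatures as linear flows *)

Section Signatures.
Variables (R : realType) (V : normedVectType R) (m : nat).
Local Notation T := (ttensor V m).
Local Notation L := (letter V).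
Implicit Types (y : R -> V) (x : T) (w : seq L) (t : R).

(** Right multiplication by a vector appends a last letter, the one that carries the outermost
    integration variable. *)
Lemma tcoef_mul_tvec x (v : V) w i : (size w < m)%N ->
  tcoef (x * tvec m v) (rcons w i) = tcoef x w * vcoord i v.
Proof.
move=> wm; rewrite tcoef_mul ?size_rcons // big_ord_recr big_ord_recr /=.
rewrite -(size_rcons w i) drop_size take_size (@low_tvec _ _ _ v [::]) // mulr0 addr0.
rewrite -cats1 take_size_cat // drop_size_cat // {2}/tvec tcoefE /=.
rewrite (leq_ltn_trans (leq0n _) wm) big1 ?add0r // => k _.
rewrite drop_cat ltn_ord /tvec tcoefE; case: ifP => _; last by rewrite mulr0.
case E : (drop k w) => [|j u]; last by case: u {E} => [|? ?]; rewrite /= mulr0.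
by have := size_drop k w; rewrite E /= => /esym/eqP; rewrite subn_eq0 leqNgt ltn_ord.
Qed.

(** Read on coefficients, [X' = X a] is the recursion of iterated integrals, by induction on the
    reversed word. The equation holds on the line, the derivative of [y] only on the unit
    interval. *)
Lemma signature_flow (X : R -> T) (a : R -> V) y :
  tder X (fun t => X t * tvec m (a t)) -> X 0 = 1 ->
  (forall i : L, continuous (fun t => vcoord i (a t))) ->
  {in `[0, 1], derive01 y =1 a} ->
  {in `[0, 1], signature_path m y =1 X}.
Proof.
move=> dX X0 ca ya t t01; apply: ttensorP => w; have := size_bseq w.
move: (bseqval w) => {}w wm; rewrite tcoef_tensor_of //.
rewrite -{2}(revK w); move: wm; rewrite -size_rev; move: (rev w) => {w}r.
elim: r t t01 => [|i r IH] t t01 rm.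
  have [Xt _] := free_lie_flow dX (fun t => @free_lie_tvec R V m (a t)) X0 t.
  exact/esym/Xt.
have cX w : continuous (fun t => tcoef (X t) w) := der_continuous (dX w).
move: (t01); rewrite in_itv /= => /andP[t0 t1].
rewrite [LHS](_ : _ = (\int[lebesgue_measure]_(u in `]0%R, t[)
    (tcoef (X u) (rev r) * vcoord i (a u)))%R); last first.
  apply: eq_Rintegral => u; rewrite inE /= in_itv /= => /andP[u0 ut].
  have u01 : u \in `[0, 1] by rewrite in_itv /= ltW //= (le_trans (ltW ut)).
  by rewrite IH // ?ya //; apply: ltnW.
apply: (@Rintegral_primitive R (fun u => tcoef (X u) (rev r) * vcoord i (a u))
  (fun u => tcoef (X u) (rev (i :: r)))) => //.
- by move=> u; apply: cvgM; [apply: cX|apply: ca].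
- apply: (der_eq (dX _)) => u; rewrite rev_cons tcoef_mul_tvec // size_rev //.
- by rewrite X0 tcoef_one ?size_rev.
Qed.

(** The system is triangular in the length of the words, so iterated primitives solve it. *)
Lemma flow_exists (a : R -> V) : (forall i : L, continuous (fun t => vcoord i (a t))) ->
  exists X : R -> T, tder X (fun t => X t * tvec m (a t)) /\ X 0 = 1.
Proof.
move=> ca.
(* Continuity is put inside the existential, with [c] itself as default, so that choice yields a
   primitive operator on all functions. *)
have prim_ex (c : R -> R) : exists F : R -> R, continuous c -> F 0 = 0 /\ der F c.
  have [cc|ncc] := pselect (continuous c); last by exists c.
  by have [F HF] := continuous_primitive cc; exists F.
have [prim Hprim] := choice prim_ex.
pose P := fix P (r : seq L) : R -> R :=
  if r is i :: r' then prim (fun t => P r' t * vcoord i (a t)) else fun=> 1.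
have cP r : continuous (P r).
  elim: r => [|i r IH]; first by move=> t; apply: cvg_cst.
  have [|_ /der_continuous//] := Hprim (fun t => P r t * vcoord i (a t)).
  by move=> t; apply: cvgM; [apply: IH|apply: ca].
have dP i r : P (i :: r) 0 = 0 /\ der (P (i :: r)) (fun t => P r t * vcoord i (a t)).
  by apply: Hprim => t; apply: cvgM; [apply: cP|apply: ca].
pose X t : T := tensor_of m (fun w => P (rev w) t).
exists X; split; last first.
  apply: ttensorP => w; have wm := size_bseq w; rewrite tcoefE wm tcoef_one //.
  move: (bseqval w) => {wm}w; rewrite -(size_rev w).
  by case: (rev w) => [|i r] //=; case: (dP i r).
move=> w; case: (leqP (size w) m) => wm; last first.
  rewrite (_ : (fun t => _) = fun=> 0).
    by apply: (der_eq (der_cst _)) => t; rewrite tcoef_gt.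
  by apply/funext => t; rewrite tcoef_gt.
rewrite (_ : (fun t => tcoef (X t) w) = P (rev w)); last first.
  by apply/funext => t; rewrite tcoefE wm.
elim/last_ind: w wm => [|w i _] wm.
  apply: (der_eq (der_cst _)) => t; apply/esym.
  by rewrite -/(tconst _) tconst_mul [tconst (tvec _ _)]low_tvec ?mulr0.
rewrite size_rcons in wm; rewrite rev_rcons.
apply: (der_eq (dP i (rev w)).2) => t; rewrite tcoef_mul_tvec //.
by rewrite tcoefE (ltnW wm).
Qed.

Lemma signature_free_group y t : smooth_path y -> t \in `[0, 1] ->
  free_group (signature_path m y t).
Proof.
move=> sy t01; pose a t := derive01 y (clamp t).
have ca (i : L) : continuous (fun t => vcoord i (a t)).
  exact: continuous_vcoord_derive01.
have [X [dX X0]] := flow_exists ca.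
rewrite (signature_flow dX X0 ca) //; last by move=> u u01; rewrite /a clampK.
by apply/free_groupP; apply: (free_lie_flow dX) => // u; apply: free_lie_tvec.
Qed.

End Signatures.

(** * Paths that run through given vectors in turn *)

Section Staircase.
Variables (R : realType) (V : normedVectType R) (m : nat).
Local Notation T := (ttensor V m).
Local Notation L := (letter V).
Variables (f f' : R -> R) (M : nat) (v : nat -> V).
Hypotheses (M_gt0 : (0 < M)%N) (sf : smooth_fun f) (sf' : smooth_fun f').
Hypotheses (df : der f f') (f_le0 : forall x, x <= 0 -> f x = 0 /\ f' x = 0)
  (f_ge1 : forall x, 1 <= x -> f x = 1 /\ f' x = 0).
Implicit Types (s t : R) (k n j : nat).

(** The time change of the [j]-th vector, rising from 0 to 1 between [j / M] and [(j + 1) / M]. *)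
Definition step j t : R := f (M%:R * t + - j%:R).
Definition dstep j t : R := f' (M%:R * t + - j%:R) * M%:R.
Definition stair_path : R -> V := vsum (index_iota 0 M) v step.
Definition slope n : R -> V := vsum (index_iota 0 n) v dstep.
Definition stair n t : T := \prod_(0 <= j < n) texp (step j t *: tvec m (v j)).

Lemma der_step j : der (step j) (dstep j).
Proof. exact: der_comp df (der_affine _ _). Qed.

Lemma stair_free_group n t : free_group (stair n t).
Proof.
by apply: free_group_prod => j; rewrite -linearZ; apply: free_group_tvec.
Qed.

(** The last factor need not commute with the earlier slopes, but at each time either it is still 1
    or those slopes have vanished. *)
Lemma tder_stair n : tder (stair n) (fun t => stair n t * tvec m (slope n t)).
Proof.
elim: n => [|n IH].
  rewrite (_ : stair 0 = fun=> 1); last by apply/funext => t; rewrite /stair big_geq.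
  by apply: (tder_eq (tder_cst _)) => t; rewrite /slope /vsum big_nil linear0 mulr0.
rewrite (_ : stair n.+1 = fun t => stair n t * texp (step n t *: tvec m (v n))); last first.
  by apply/funext => t; rewrite /stair big_nat_recr.
apply: (tder_eq (tderM IH (tder_texp (@low_tvec _ _ _ (v n)) (der_step n)))) => t.
rewrite /slope /vsum big_nat_recr //= -/(vsum _ _ _ _) -/(slope n t).
rewrite linearD linearZ /= mulrDr -!scalerAr mulrA; congr (_ + _).
case: (leP (M%:R * t) n%:R) => Mt.
  rewrite /step; have [-> _] : f (M%:R * t - n%:R) = 0 /\ _ := f_le0 (etrans (subr_le0 _ _) Mt).
  by rewrite scale0r texp0 !mulr1.
suff -> : slope n t = 0 by rewrite linear0 !mulr0 mul0r.
rewrite /slope /vsum big_seq big1 // => j; rewrite mem_index_iota => /andP[_ jn].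
rewrite /dstep; have [|_ ->] := f_ge1 (x := M%:R * t - j%:R); last by rewrite mul0r scale0r.
by rewrite lerBrDr (le_trans _ (ltW Mt)) // nat1r ler_nat.
Qed.

Lemma stair_head n k t : (k <= n)%N -> k%:R <= M%:R * t ->
  stair n t = \prod_(0 <= j < k) texp (tvec m (v j)) *
    \prod_(k <= j < n) texp (step j t *: tvec m (v j)).
Proof.
move=> kn kt; rewrite /stair (big_cat_nat (n := k)) //=; congr (_ * _).
apply: eq_big_nat => j /andP[_ jk]; rewrite /step.
have [|-> _] := f_ge1 (x := M%:R * t - j%:R); last by rewrite scale1r.
by rewrite lerBrDr (le_trans _ kt) // nat1r ler_nat.
Qed.

Lemma stair_tail n k t : M%:R * t <= k%:R ->
  \prod_(k <= j < n) texp (step j t *: tvec m (v j)) = 1.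
Proof.
move=> tk; rewrite big_nat big1 // => j /andP[kj _]; rewrite /step.
have [|-> _] := f_le0 (x := M%:R * t - j%:R); last by rewrite scale0r texp0.
by rewrite subr_le0 (le_trans tk) // ler_nat.
Qed.

Lemma stair_grid k : (k <= M)%N ->
  stair M (k%:R / M%:R) = \prod_(0 <= j < k) texp (tvec m (v j)).
Proof.
move=> kM; have Mk : M%:R * (k%:R / M%:R) = k%:R :> R.
  by rewrite mulrC divfK // pnatr_eq0 -lt0n.
by rewrite (stair_head kM) ?Mk // stair_tail ?Mk // mulr1.
Qed.

(** Within a cell one factor moves, along a one-parameter subgroup; all earlier ones cancel and all
    later ones are 1. *)
Lemma stair_local k s t : (k < M)%N -> k%:R <= M%:R * s -> s <= t ->
  M%:R * t <= k.+1%:R ->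
  (stair M s)^-1 * stair M t = texp ((step k t - step k s) *: tvec m (v k)).
Proof.
move=> kM ks st tk.
have M0 : 0 < M%:R :> R by rewrite ltr0n.
have Mst : M%:R * s <= M%:R * t by rewrite ler_pM2l.
have E u : k%:R <= M%:R * u -> M%:R * u <= k.+1%:R ->
    stair M u = \prod_(0 <= j < k) texp (tvec m (v j)) * texp (step k u *: tvec m (v k)).
  move=> ku uk; rewrite (stair_head (ltnW kM)) // [X in _ * X]big_ltn //.
  by rewrite stair_tail // mulr1.
have kt := le_trans ks Mst; have sk := le_trans Mst tk; rewrite !E //.
set P := \prod_(_ <= _ < _) _.
have Pu : P \is a GRing.unit.
  by apply: free_group_unit; apply: free_group_prod => j; apply: free_group_tvec.
have lv := @low_tvec _ _ m (v k).
rewrite invrM //; last by rewrite tconst_unit // tconst_texp //; apply: lowZ.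
rewrite texpV; last exact: lowZ.
by rewrite -!mulrA (mulrA P^-1) mulVr // mul1r -scaleNr -texpD // addrC.
Qed.

Lemma smooth_stair_path : smooth_path stair_path.
Proof. by apply: smooth_path_vsum => j; apply: smooth_affine. Qed.

Lemma signature_stair : {in `[0, 1], signature_path m stair_path =1 stair M}.
Proof.
apply: (@signature_flow _ _ _ _ (slope M)).
- exact: tder_stair.
- rewrite /stair big_nat big1 // => j _; rewrite /step mulr0 add0r.
  by have [|-> _] := f_le0 (x := - j%:R); rewrite ?oppr_le0 // scale0r texp0.
- move=> i; have [f'' _ df'] := smooth_fun_der sf'.
  rewrite (_ : (fun t => _) = fun t => \sum_(0 <= j < M) dstep j t * vcoord i (v j)).
    apply: der_continuous; apply: der_sum => j; apply: derM (der_cst _).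
    by apply: derM (der_cst _); apply: der_comp df' (der_affine _ _).
  apply/funext => t; rewrite /slope /vsum /vcoord linear_sum.
  by apply: eq_bigr => j _; rewrite linearZ.
- by move=> t t01; apply: derive01_vsum => // j; apply: der_step.
Qed.

End Staircase.

(** * Lipschitz bounds from cells to intervals *)

Section GridLipschitz.
Variables (R : realType) (d : R -> R -> R) (M : nat) (D : R).
Hypotheses (M_gt0 : (0 < M)%N)
  (d_tri : forall s u t, d s t <= d s u + d u t)
  (d_local : forall k s t, (k < M)%N -> k%:R <= M%:R * s -> s <= t ->
     M%:R * t <= k.+1%:R -> d s t <= D * (t - s)).

(** The bound is additive in [t - s], so cutting at grid points keeps the constant [D]. *)
Lemma grid_lipschitz s t : 0 <= s -> s <= t -> t <= 1 -> d s t <= D * (t - s).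
Proof.
have M0 : 0 < M%:R :> R by rewrite ltr0n.
suff H k : (k <= M)%N -> forall s t, 0 <= s -> s <= t -> M%:R * t <= k%:R -> d s t <= D * (t - s).
  by move=> s0 st t1; apply: (H M) => //; rewrite ler_piMr // ltW.
elim: k => [|k IH] kM {}s {}t s0 st tk.
  apply: (d_local M_gt0) => //; first by rewrite mulr_ge0 // ltW.
  by rewrite (le_trans tk).
case: (leP (M%:R * t) k%:R) => tk'; first by apply: IH => //; apply: ltnW.
case: (leP k%:R (M%:R * s)) => ks; first exact: d_local ks st tk.
pose u : R := k%:R / M%:R; have Mu : M%:R * u = k%:R by rewrite mulrC divfK ?gt_eqF.
have su : s <= u by rewrite -(ler_pM2l M0) Mu ltW.
have ut : u <= t by rewrite -(ler_pM2l M0) Mu ltW.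
rewrite (le_trans (d_tri s u t)) //.
have -> : D * (t - s) = D * (u - s) + D * (t - u) by ring.
apply: lerD; first by apply: IH; rewrite ?Mu // ltnW.
by apply: (d_local kM) => //; rewrite Mu.
Qed.

End GridLipschitz.

(** In the application [p], [q] are the grid values common to both paths, [x], [y] their values at
    [s], and [z], [w] those at [t]. All factors are small except the conjugating [p^-1 * q]. *)
Lemma increment_conj (A : unitRingType) (p q x y z w : A) :
  p \is a GRing.unit -> q \is a GRing.unit -> x \is a GRing.unit ->
  y \is a GRing.unit -> z \is a GRing.unit ->
  (x^-1 * z)^-1 * (y^-1 * w) =
  (q^-1 * z)^-1 * ((p^-1 * q)^-1 * ((p^-1 * x) * (p^-1 * y)^-1) * (p^-1 * q)) * (q^-1 * w).
Proof.
move=> pu qu xu yu zu; rewrite !invrM ?unitrV // !invrK.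
by rewrite -!mulrA !(mulVKr pu, mulVKr qu).
Qed.

(** * Interpolation of a Hölder path on a grid *)

Section HolderApproximation.
Variables (R : realType) (V : normedVectType R) (m : nat).
Local Notation T := (ttensor V m).
Variables (N : T -> R) (N_norm : homogeneous_norm N).
Implicit Types (g h : T) (s t u : R) (k n : nat) (X Y : R -> T).

Lemma free_group_incr g h : free_group g -> free_group h -> free_group (g^-1 * h).
Proof. by move=> Gg Gh; apply: free_groupM => //; apply: free_groupV. Qed.

Lemma hnorm_triangle g h x : free_group g -> free_group h -> free_group x ->
  N (g^-1 * x) <= N (g^-1 * h) + N (h^-1 * x).
Proof.
move=> Gg Gh Gx; have hu := free_group_unit Gh.
have -> : g^-1 * x = (g^-1 * h) * (h^-1 * x) by rewrite !mulrA -(mulrA g^-1) mulrV // mulr1.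
by apply: (hnorm_mul N_norm); apply: free_group_incr.
Qed.

Section Grid.
Variables (al : R) (al_gt0 : 0 < al) (al_le1 : al <= 1) (n : nat).
Let n0 : 0 < n.+1%:R :> R. Proof. by rewrite ltr0n. Qed.

Definition mesh : R := n.+1%:R^-1.
Definition grid k : R := k%:R * mesh.

Lemma mesh_gt0 : 0 < mesh. Proof. by rewrite invr_gt0. Qed.

Lemma mesh_powR_gt0 : 0 < mesh `^ al. Proof. exact: powR_gt0 mesh_gt0. Qed.

Lemma powR_mono s t : 0 <= s -> s <= t -> s `^ al <= t `^ al.
Proof.
by move=> s0 st; apply: ge0_ler_powR; rewrite ?nnegrE ?(ltW al_gt0) // (le_trans s0).
Qed.

(** With [x = n.+1 * u] in []0, 1]] this is [x <= x^al], the place where [al <= 1] is used. *)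
Lemma ler_small_powR u : 0 <= u -> u <= mesh ->
  n.+1%:R * mesh `^ al * u <= u `^ al.
Proof.
rewrite le_eqVlt => /predU1P[<- _|u0 um]; first by rewrite mulr0 powR_ge0.
have x01 : 0 < n.+1%:R * u <= 1 by rewrite mulr_gt0 //= mulrC -ler_pdivlMr // mul1r.
have -> : u `^ al = mesh `^ al * (n.+1%:R * u) `^ al.
  rewrite -powRM ?(ltW mesh_gt0) //; last by case/andP: x01 => /ltW.
  by rewrite mulrA /mesh mulVf ?mul1r // gt_eqF.
rewrite mulrAC mulrC ler_wpM2l ?powR_ge0 //; exact: ger1_powR.
Qed.

Lemma grid_floor t : 0 <= t -> t <= 1 -> exists k,
  [/\ (k <= n.+1)%N, grid k <= t & t < grid k.+1].
Proof.
move=> t0 t1; have nt : 0 <= t * n.+1%:R by rewrite mulr_ge0 // ltW.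
have /andP[kt tk] := truncn_itv nt.
exists (Num.trunc (t * n.+1%:R)); rewrite /grid ler_pdivrMr // ltr_pdivlMr //; split=> //.
by rewrite -(ler_nat R) (le_trans kt) // ler_piMl // ltW.
Qed.

Lemma gridS k : grid k.+1 = grid k + mesh.
Proof. by rewrite /grid -addn1 natrD mulrDl mul1r. Qed.

Lemma grid_ge0 k : 0 <= grid k.
Proof. by rewrite mulr_ge0 // ltW // mesh_gt0. Qed.

Lemma grid_le1 k : (k <= n.+1)%N -> grid k <= 1.
Proof. by move=> kn; rewrite ler_pdivrMr // mul1r ler_nat. Qed.

Lemma grid_mono j k : (j <= k)%N -> grid j <= grid k.
Proof. by move=> jk; rewrite ler_wpM2r ?(ltW mesh_gt0) // ler_nat. Qed.

Lemma grid_lt j k : grid j < grid k -> (j < k)%N.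
Proof. by move=> jk; rewrite ltnNge; apply/negP => /grid_mono; rewrite leNgt jk. Qed.

End Grid.

(** A real inequality in place of an extended supremum, with [s = t] allowed for chaining. *)
Definition holder_bound (al B : R) X :=
  forall s t, 0 <= s -> s <= t -> t <= 1 -> N ((X s)^-1 * X t) <= B * (t - s) `^ al.

Variables (al : R) (al_gt0 : 0 < al) (al_le1 : al <= 1).

Lemma holder_interpolate Y (H : R) :
  (forall t, 0 <= t -> t <= 1 -> free_group (Y t)) -> Y 0 = 1 -> 0 <= H ->
  holder_bound al H Y ->
  exists2 B : R, 0 <= B & forall n, exists y X,
    [/\ smooth_path y, {in `[0, 1], signature_path m y =1 X},
        forall t, free_group (X t), holder_bound al B X &
        forall k, (k <= n.+1)%N -> X (grid n k) = Y (grid n k)].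
Proof.
move=> GY Y0 H0 HY.
have [K [C [K0 C0 HC]]] := hnorm_chow N_norm.
have [f [f' [D [sf [sf' df] f_le0 f_ge1 [D0 fD]]]]] := smooth_step R.
(* [D] comes from the time change, [K] from the subdivision of a cell, and [C * H] from the size of
   a factor relative to [mesh^al]. *)
pose L0 := D * K%:R * (C * H); have L00 : 0 <= L0 by rewrite !mulr_ge0.
(* [L0] for each of the two end pieces of an interval, [H] for the part between grid points. *)
exists (L0 + H + L0) => [|n]; first by rewrite !addr_ge0.
have m0 := mesh_gt0 n; have q0 := mesh_powR_gt0 al n; set q := mesh n `^ al in q0.
have n0 : 0 < n.+1%:R :> R by rewrite ltr0n.
have Ggrid k : (k <= n.+1)%N -> free_group (Y (grid n k)).
  by move=> kn; apply: GY; [exact: grid_ge0|exact: grid_le1].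
(* The default 1 beyond the last cell keeps [g k] in the group for all [k], as [choice] requires. *)
pose g k := if (k <= n)%N then (Y (grid n k))^-1 * Y (grid n k.+1) else 1.
have Gg k : free_group (g k).
  rewrite /g; case: ifP => kn; last exact: free_group1.
  by apply: free_group_incr; apply: Ggrid => //; apply: leqW.
have Ng k : N (g k) <= H * q.
  rewrite /g; case: ifP => kn; last by rewrite (hnorm1 N_norm) mulr_ge0 // ltW.
  rewrite (le_trans (HY _ _ (grid_ge0 _ _) (grid_mono _ (leqnSn k)) (grid_le1 _))) //.
  by rewrite gridS addrAC subrr add0r.
have [vs Hvs] := choice (fun k => HC (g k) (Gg k)).
(* Vector [j] is number [j %% K] of cell [j %/ K], all cells having [K] vectors. *)
pose v j := nth 0 (vs (j %/ K)%N) (j %% K)%N.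
have Nv j : N (texp (tvec m (v j))) <= C * (H * q).
  have [svs _ Nvs] := Hvs (j %/ K)%N.
  rewrite (le_trans (Nvs _ _)) ?ler_wpM2l //.
  by rewrite mem_nth // svs ltn_pmod.
pose M := (n.+1 * K)%N; have M0 : (0 < M)%N by rewrite muln_gt0.
have M0R : 0 < M%:R :> R by rewrite ltr0n.
pose X := stair m f M v M.
have GX t : free_group (X t) by apply: stair_free_group.
have Xu t := free_group_unit (GX t).
have XY k : (k <= n.+1)%N -> X (grid n k) = Y (grid n k).
  move=> kn; have gE : grid n k = (k * K)%:R / M%:R.
    rewrite /grid /mesh /M !natrM; field.
    by rewrite nat1r !pnatr_eq0 -lt0n K0.
  rewrite /X {1}gE (stair_grid m v M0 f_le0 f_ge1) ?leq_mul2r ?kn ?orbT // => {gE}.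
  elim: k kn => [|k IH] kn; first by rewrite mul0n big_geq // /grid mul0r Y0.
  rewrite (big_cat_nat (n := k * K)) ?leq_mul2r ?leqnSn ?orbT //= IH; last exact: ltnW.
  have -> : \prod_(k * K <= j < k.+1 * K) texp (tvec m (v j)) = g k.
    have [svs -> _] := Hvs k.
    rewrite -{1}[(k * K)%N]add0n big_addn mulSn addnK [RHS](big_nth 0) svs.
    apply: eq_big_nat => j /andP[_ jK].
    by rewrite /v addnC divnMDl // divn_small // addn0 modnMDl modn_small.
  rewrite /g -ltnS kn mulrA mulrV ?mul1r //.
  by apply: free_group_unit; apply: Ggrid; apply: ltnW.
pose Dl := L0 * (n.+1%:R * q).
have Xlip s t : 0 <= s -> s <= t -> t <= 1 -> N ((X s)^-1 * X t) <= Dl * (t - s).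
  apply: (@grid_lipschitz _ (fun s t => N ((X s)^-1 * X t)) M) => //.
    by move=> {}s u {}t; apply: hnorm_triangle.
  move=> k {}s {}t kM ks st tk; rewrite /X (stair_local m v M0 f_le0 f_ge1 kM ks st tk).
  rewrite -linearZ /= (hnorm_texpZ N_norm).
  apply: (@le_trans _ _ (D * (M%:R * (t - s)) * (C * (H * q)))).
    apply: ler_pM => //; first by apply: (hnorm_ge0 N_norm); apply: free_group_tvec.
    rewrite (le_trans (fD _ _)) // ler_wpM2l // opprD addrACA subrr addr0 -mulrBr.
    by rewrite ger0_norm // mulr_ge0 ?subr_ge0 // ltW.
  by rewrite le_eqVlt; apply/orP; left; apply/eqP; rewrite /Dl /L0 /M natrM; ring.
exists (stair_path f M v), X; split=> //.
- exact: smooth_stair_path.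
- exact: (signature_stair m M v sf' df f_le0 f_ge1).
(* Up to the mesh the Lipschitz bound suffices. Longer intervals are cut at the first grid point
   after [s] and the last before [t], between which [X] has the increment of [Y]. *)
move=> s t s0 st t1; have [stm|stm] := leP (t - s) (mesh n).
  rewrite (le_trans (Xlip s t s0 st t1)) //.
  apply: (@le_trans _ _ (L0 * (t - s) `^ al)).
    by rewrite /Dl -mulrA ler_wpM2l // ler_small_powR // subr_ge0.
  by rewrite ler_wpM2r ?powR_ge0 // -addrA lerDl addr_ge0.
have [k [kn ks sk]] := grid_floor n s0 (le_trans st t1).
have [l [ln lt tl]] := grid_floor n (le_trans s0 st) t1.
have kl : (k < l)%N.
  rewrite -ltnS; apply: (@grid_lt n); rewrite (le_lt_trans _ tl) // gridS; lra.
set a := grid n k.+1 in sk; set b := grid n l in lt.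
have ab : a <= b by apply: grid_mono.
have a0 : 0 <= a by apply: grid_ge0.
have b1 : b <= 1 by apply: grid_le1.
have qst : q <= (t - s) `^ al by apply: powR_mono => //; apply: ltW.
have Dm u : u <= mesh n -> Dl * u <= L0 * (t - s) `^ al.
  move=> um; apply: (@le_trans _ _ (L0 * q)); last by rewrite ler_wpM2l.
  have -> : Dl * u = L0 * (q * (n.+1%:R * u)) by rewrite /Dl; ring.
  rewrite ler_wpM2l // ler_piMr ?(ltW q0) //.
  by rewrite -ler_pdivlMl // mulr1.
rewrite (le_trans (hnorm_triangle (GX s) (GX b) (GX t))) // mulrDl; apply: lerD.
  rewrite (le_trans (hnorm_triangle (GX s) (GX a) (GX b))) // mulrDl; apply: lerD.
    rewrite (le_trans (Xlip _ _ s0 (ltW sk) (le_trans ab b1))) // Dm //.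
    by rewrite /a gridS lerBlDl lerD2r.
  rewrite !XY ?(leq_trans kl) // (le_trans (HY _ _ a0 ab b1)) // ler_wpM2l //.
  by apply: powR_mono => //; rewrite ?subr_ge0 // lerB // ltW.
rewrite (le_trans (Xlip _ _ (le_trans a0 ab) lt t1)) // Dm //.
by rewrite lerBlDl -gridS ltW.
Qed.

(** [s] and [t] are compared with the grid points to their left, where the paths agree; each path
    moves by at most its Hölder constant times [mesh^al] from there. The increment of [Y] between
    the grid points has norm at most [H], so [hnorm_conj] handles the conjugation. *)
Lemma holder_uniform Y (H B e : R) :
  (forall t, 0 <= t -> t <= 1 -> free_group (Y t)) -> 0 <= H -> 0 <= B ->
  holder_bound al H Y -> 0 < e ->
  exists n0, forall n X, (n0 <= n)%N -> (forall t, free_group (X t)) -> holder_bound al B X ->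
    (forall k, (k <= n.+1)%N -> X (grid n k) = Y (grid n k)) ->
  forall s t, 0 <= s -> s <= t -> t <= 1 ->
    N (((X s)^-1 * X t)^-1 * ((Y s)^-1 * Y t)) <= e.
Proof.
move=> GY H0 B0 HY e0.
have e2 : 0 < e / 2 by rewrite divr_gt0.
have [d d0 Hd] := hnorm_conj N_norm H e2.
(* Chosen so that [(B + H) * r] is at most [d], for the conjugated factor, and at most [e / 2], for
   the two end factors together. *)
pose r := Num.min d (e / 2) / (1 + B + H).
have BH : 0 < 1 + B + H by rewrite -addrA ltr_pwDl // addr_ge0.
have r0 : 0 < r by rewrite divr_gt0 // lt_min d0.
have rE : (B + H) * r <= d /\ (B + H) * r <= e / 2.
  have : (B + H) * r <= Num.min d (e / 2).
    rewrite /r mulrCA ler_piMr //; first by rewrite le_min !ltW.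
    by rewrite ler_pdivrMr // mul1r -addrA lerDr.
  by rewrite le_min => /andP[].
(* a mesh below [r `^ (al^-1)] *)
exists (Num.trunc (r `^ al^-1)^-1) => n X n0n GX HX XY s t s0 st t1.
have m0 := mesh_gt0 n; pose q := mesh n `^ al.
have q0 : 0 <= q by apply: powR_ge0.
have qr : q <= r.
  have -> : r = (r `^ al^-1) `^ al.
    by rewrite -powRrM mulVf ?gt_eqF // powRr1 // ltW.
  apply: powR_mono; rewrite ?(ltW m0) ?(ltW al_gt0) //.
  rewrite /mesh -[leRHS]invrK lef_pV2 ?posrE ?invr_gt0 ?powR_gt0 //.
  by rewrite (le_trans (ltW (truncnS_gt _))) // ler_nat ltnS.
have near u : 0 <= u -> u <= 1 -> exists k, [/\ (k <= n.+1)%N, grid n k <= u < grid n k.+1,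
    N ((X (grid n k))^-1 * X u) <= B * q & N ((Y (grid n k))^-1 * Y u) <= H * q].
  move=> u0 u1; have [k [kn ku uk]] := grid_floor n u0 u1.
  exists k; split=> //; first by rewrite ku.
    rewrite (le_trans (HX _ _ (grid_ge0 _ _) ku u1)) // ler_wpM2l //.
    by apply: powR_mono; rewrite ?subr_ge0 // lerBlDl -gridS ltW.
  rewrite (le_trans (HY _ _ (grid_ge0 _ _) ku u1)) // ler_wpM2l //.
  by apply: powR_mono; rewrite ?subr_ge0 // lerBlDl -gridS ltW.
have s1 := le_trans st t1; have t0 := le_trans s0 st.
have [k [kn /andP[ks sk] Ba Ha']] := near s s0 s1.
have [l [ln /andP[lt tl] Bb Hb']] := near t t0 t1.
have kl : (k <= l)%N by rewrite -ltnS; apply: (@grid_lt n); lra.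
have GYs := GY s s0 s1; have GYt := GY t t0 t1.
have Gk : free_group (Y (grid n k)) by rewrite -XY.
have Gl : free_group (Y (grid n l)) by rewrite -XY.
rewrite XY // in Ba; rewrite XY // in Bb.
set P := Y (grid n k) in Ba Ha' Gk; set Q := Y (grid n l) in Bb Hb' Gl.
have Gg : free_group (P^-1 * Q) by apply: free_group_incr.
have Ng : N (P^-1 * Q) <= H.
  rewrite (le_trans (HY _ _ (grid_ge0 _ _) (grid_mono _ kl) (le_trans lt t1))) //.
  have p1 : 1 `^ al = 1 :> R by rewrite powR1.
  rewrite ler_piMr // -[leRHS]p1 powR_mono // ?subr_ge0 ?grid_mono //.
  by rewrite lerBlDr (le_trans lt) // (le_trans t1) // lerDl grid_ge0.
have Ga : free_group (P^-1 * X s) by apply: free_group_incr.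
have Ga' : free_group (P^-1 * Y s) by apply: free_group_incr.
have Gb : free_group (Q^-1 * X t) by apply: free_group_incr.
have Gb' : free_group (Q^-1 * Y t) by apply: free_group_incr.
have Gh : free_group ((P^-1 * X s) * (P^-1 * Y s)^-1).
  by apply: free_groupM => //; apply: free_groupV.
have -> : ((X s)^-1 * X t)^-1 * ((Y s)^-1 * Y t) =
    (Q^-1 * X t)^-1 * ((P^-1 * Q)^-1 * ((P^-1 * X s) * (P^-1 * Y s)^-1) * (P^-1 * Q)) *
    (Q^-1 * Y t).
  by apply: increment_conj; apply: free_group_unit.
have Gc : free_group ((P^-1 * Q)^-1 * ((P^-1 * X s) * (P^-1 * Y s)^-1) * (P^-1 * Q)).
  by apply: free_groupM => //; apply: free_group_incr.
have BHq : (B + H) * q <= (B + H) * r by rewrite ler_wpM2l // addr_ge0.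
have [rd re] := rE.
rewrite (le_trans (hnorm_mul N_norm (free_groupM (free_groupV Gb) Gc) Gb')) //.
have Nc : N ((P^-1 * Q)^-1 * ((P^-1 * X s) * (P^-1 * Y s)^-1) * (P^-1 * Q)) <= e / 2.
  apply: Hd => //.
  rewrite (le_trans (hnorm_mul N_norm Ga (free_groupV Ga'))) // (hnorm_inv N_norm) //.
  by rewrite (le_trans (lerD Ba Ha')) // -mulrDl (le_trans BHq).
have := hnorm_mul N_norm (free_groupV Gb) Gc; rewrite (hnorm_inv N_norm Gb) => Nbc.
have Nbb : N (Q^-1 * X t) + N (Q^-1 * Y t) <= e / 2.
  by rewrite (le_trans (lerD Bb Hb')) // -mulrDl (le_trans BHq).
lra.
Qed.

End HolderApproximation.

(** * Hölder norms as suprema, and the two implications *)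

Section HolderNorm.
Variables (R : realType) (V : normedVectType R) (m : nat).
Local Notation T := (ttensor V m).
Variables (N : T -> R) (N_norm : homogeneous_norm N).
Implicit Types (g h : T) (s t u al : R) (k n : nat) (X Y : R -> T).

Lemma hnorm_incrC g h : free_group g -> free_group h -> N (g^-1 * h) = N (h^-1 * g).
Proof.
move=> Gg Gh; rewrite -(hnorm_inv N_norm (free_group_incr Gg Gh)).
have gu := free_group_unit Gg; have hu := free_group_unit Gh.
by rewrite invrM ?unitrV // invrK.
Qed.

Lemma tnorm_cvg (a : nat -> T) (b : T) :
  (forall s : seq (letter V), tcoef (a n) s @[n --> \oo] --> tcoef b s) ->
  forall e : R, 0 < e -> exists n0, forall n, (n0 <= n)%N -> tnorm (a n - b) <= e.
Proof.
move=> ab; rewrite /tnorm; elim: (words _ m) => [|w ws IH] e e0.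
  by exists 0%N => n _; rewrite big_nil ltW.
have e2 : 0 < e / 2 by rewrite divr_gt0.
have [n1 H1] := IH _ e2.
have [n2 _ H2] := (cvgrPdist_le _ _).1 (ab w) _ e2.
exists (maxn n1 n2) => n; rewrite geq_max => /andP[/H1 h1 /H2 h2].
rewrite big_cons [e]splitr lerD // tcoefB distrC //.
Qed.

Lemma hnorm_cvg0 (a : nat -> T) (b : T) :
  (forall n, free_group (a n)) -> free_group b ->
  (forall s : seq (letter V), tcoef (a n) s @[n --> \oo] --> tcoef b s) ->
  forall e : R, 0 < e -> exists n0, forall n, (n0 <= n)%N -> N (b^-1 * a n) <= e.
Proof.
move=> Ga Gb ab e e0; have [d d0 Hd] := hnorm_small N_norm e0.
have z0 := tnorm_ge0 b^-1.
have [n0 H] := tnorm_cvg ab (divr_gt0 d0 (ltr_wpDr z0 ltr01)).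
exists n0 => n /H nab; apply: Hd; first exact: free_group_incr.
have -> : b^-1 * a n - 1 = b^-1 * (a n - b).
  by rewrite mulrBr mulVr // free_group_unit.
rewrite (le_trans (ler_tnormM _ _)) // (le_trans (ler_wpM2l z0 nab)) //.
by rewrite mulrCA ler_piMr ?(ltW d0) // ler_pdivrMr ?ltr_wpDr // mul1r lerDr.
Qed.

Lemma hdist1 X s t : free_group (increment X s t) ->
  hdist N (increment X s t) (increment (fun=> 1) s t) = N (increment X s t).
Proof.
by move=> Gx; rewrite /hdist {2}/increment invr1 !mulr1 (hnorm_inv N_norm).
Qed.

Lemma holder_norm_le al (C : R) X : (forall t, t \in `[0, 1] -> free_group (X t)) ->
  (forall s t, 0 <= s -> s < t -> t <= 1 -> N ((X s)^-1 * X t) <= C * (t - s) `^ al) ->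
  (holder_norm N al X <= C%:E)%E.
Proof.
move=> GX HX; apply: ub_ereal_sup => _ [s [t [s0 st t1 ->]]].
have ts : 0 < t - s by rewrite subr_gt0.
have Xs : free_group (X s) by apply: GX; rewrite in_itv /= s0 (le_trans (ltW st)).
have Xt : free_group (X t) by apply: GX; rewrite in_itv /= t1 (le_trans s0 (ltW st)).
rewrite lee_fin hdist1; last exact: free_group_incr.
by rewrite ler_pdivrMr ?powR_gt0 //; apply: HX.
Qed.

Lemma ler_holder_norm al (C : R) X s t :
  (forall t, t \in `[0, 1] -> free_group (X t)) ->
  (holder_norm N al X <= C%:E)%E -> 0 <= s -> s < t -> t <= 1 ->
  N ((X s)^-1 * X t) <= C * (t - s) `^ al.
Proof.
move=> GX XC s0 st t1.
have ts : 0 < t - s by rewrite subr_gt0.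
have Xs : free_group (X s) by apply: GX; rewrite in_itv /= s0 (le_trans (ltW st)).
have Xt : free_group (X t) by apply: GX; rewrite in_itv /= t1 (le_trans s0 (ltW st)).
rewrite -ler_pdivrMr ?powR_gt0 // -lee_fin (le_trans _ XC) //.
apply: ereal_sup_ubound; exists s, t; split=> //.
by rewrite hdist1 //; apply: free_group_incr.
Qed.

Lemma is_holder_bound al X : 0 < al -> (forall t, t \in `[0, 1] -> free_group (X t)) ->
  is_holder N al X -> exists2 H : R, 0 <= H & holder_bound N al H X.
Proof.
move=> al0 GX XH.
have G01 : free_group (increment X 0 1).
  by apply: free_group_incr; apply: GX; rewrite in_itv /= ?lexx ?ler01.
have X0 : (0 <= holder_norm N al X)%E.
  apply: (@le_trans _ _ (N (increment X 0 1))%:E).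
    by rewrite lee_fin (hnorm_ge0 N_norm).
  apply: ereal_sup_ubound; exists 0, 1; split=> //.
  by rewrite hdist1 // subr0 powR1 divr1.
(* The supremum is nonnegative by its value at [(0, 1)], so [is_holder] makes it finite. *)
have Xfin : holder_norm N al X \is a fin_num.
  by rewrite ge0_fin_numE.
exists (fine (holder_norm N al X)); first exact: fine_ge0.
move=> s t s0; rewrite le_eqVlt => /predU1P[<- s1|st t1].
  rewrite mulVr ?(hnorm1 N_norm); first by rewrite mulr_ge0 ?powR_ge0 ?fine_ge0.
  by apply: free_group_unit; apply: GX; rewrite in_itv /= s0.
by apply: ler_holder_norm => //; rewrite fineK.
Qed.

Lemma holder_dist_ge0 al X Y : (forall t, t \in `[0, 1] -> free_group (X t)) ->
  (forall t, t \in `[0, 1] -> free_group (Y t)) -> (0 <= holder_dist N al X Y)%E.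
Proof.
move=> GX GY; set d := hdist N (increment X 0 1) (increment Y 0 1).
apply: (@le_trans _ _ d%:E).
  rewrite lee_fin; apply: (hnorm_ge0 N_norm); apply: free_group_incr; apply: free_group_incr;
    by [apply: GX; rewrite in_itv /= ?lexx ?ler01|apply: GY; rewrite in_itv /= ?lexx ?ler01].
apply: ereal_sup_ubound; exists 0, 1; split=> //.
by rewrite subr0 powR1 divr1.
Qed.

Lemma holder_of_signatures al Y (y : nat -> R -> V) (C : R) :
  (forall t, t \in `[0, 1] -> free_group (Y t)) ->
  (forall n, smooth_path (y n)) ->
  (forall n, (holder_norm N al (signature_path m (y n)) <= C%:E)%E) ->
  (forall t, t \in `[0, 1] -> forall s : seq (letter V),
     tcoef (signature_path m (y n) t) s @[n --> \oo] --> tcoef (Y t) s) ->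
  is_holder N al Y.
Proof.
move=> GY sy yC yY; apply: (@le_lt_trans _ _ C%:E); last exact: ltry.
pose X n := signature_path m (y n).
have GX n t : t \in `[0, 1] -> free_group (X n t) by apply: signature_free_group.
apply: holder_norm_le => // s t s0 st t1.
have s01 : s \in `[0, 1] by rewrite in_itv /= s0 (le_trans (ltW st)).
have t01 : t \in `[0, 1] by rewrite in_itv /= t1 (le_trans s0 (ltW st)).
(* The error [2 * e] comes from replacing [Y] by a signature at [s] and at [t]. *)
rewrite -subr_le0; apply: (@ler0_scaled _ _ 2) => e e0 _.
have [n1 H1] := hnorm_cvg0 (fun n => GX n s s01) (GY s s01) (yY s s01) e0.
have [n2 H2] := hnorm_cvg0 (fun n => GX n t t01) (GY t t01) (yY t t01) e0.
pose n := maxn n1 n2.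
have h1 := H1 n (leq_maxl _ _); have h2 := H2 n (leq_maxr _ _).
have h3 := ler_holder_norm (GX n) (yC n) s0 st t1.
have Gs := GX n s s01; have Gt := GX n t t01; have Ys := GY s s01; have Yt := GY t t01.
have e1 := hnorm_triangle N_norm Ys Gs Yt.
have e2 := hnorm_triangle N_norm Gs Gt Yt.
rewrite lerBlDr (_ : 2 * e + _ = e + (C * (t - s) `^ al + e)); last by ring.
rewrite (le_trans e1) // lerD // (le_trans e2) // lerD //.
by rewrite hnorm_incrC.
Qed.

(** The sequence is fixed before the exponent [be]: uniform closeness of increments and the common
    Hölder bound serve every [be < al]. *)
Lemma signatures_of_holder al Y : 0 < al -> al <= 1 ->
  (forall t, t \in `[0, 1] -> free_group (Y t)) -> Y 0 = 1 -> is_holder N al Y ->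
  exists y : nat -> R -> V, exists B : R,
    [/\ forall n, smooth_path (y n),
        forall n, (holder_norm N al (signature_path m (y n)) <= B%:E)%E &
        (forall t, t \in `[0, 1] -> forall s : seq (letter V),
           tcoef (signature_path m (y n) t) s @[n --> \oo] --> tcoef (Y t) s) /\
        forall be, 0 < be -> be < al ->
          holder_dist N be (signature_path m (y n)) Y @[n --> \oo] --> 0%E].
Proof.
move=> al0 al1 GY Y0 YH.
have [H H0 HY] := is_holder_bound al0 GY YH.
have GY' t : 0 <= t -> t <= 1 -> free_group (Y t).
  by move=> t0 t1; apply: GY; rewrite in_itv /= t0.
have [B B0 HB] := holder_interpolate N_norm al0 al1 GY' Y0 H0 HY.
have [y /choice[X HX]] := choice HB.
have GX n t : free_group (X n t) by case: (HX n).
have GS n t : t \in `[0, 1] -> free_group (signature_path m (y n) t).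
  by move=> t01; apply: signature_free_group => //; case: (HX n).
have SX n s t : 0 <= s -> s < t -> t <= 1 ->
    increment (signature_path m (y n)) s t = (X n s)^-1 * X n t.
  move=> s0 st t1; have [_ SX _ _ _] := HX n.
  by rewrite /increment !SX // in_itv /= ?s0 ?t1 ?(le_trans s0 (ltW st)) ?(le_trans (ltW st)).
have unif e : 0 < e -> exists n0, forall n, (n0 <= n)%N ->
    forall s t, 0 <= s -> s < t -> t <= 1 ->
    hdist N (increment (signature_path m (y n)) s t) (increment Y s t) <= e.
  move=> e0; have [n0 Hn] := holder_uniform N_norm al0 GY' H0 B0 HY e0.
  exists n0 => n n0n s t s0 st t1; have [_ _ _ XB XY] := HX n.
  by rewrite /hdist SX //; apply: (Hn n (X n)) => //; apply: ltW.
exists y, B; split.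
- by move=> n; case: (HX n).
- move=> n; have [_ _ _ XB _] := HX n.
  apply: (holder_norm_le (GS n)) => s t s0 st t1.
  by rewrite -/(increment _ s t) SX //; apply: XB => //; apply: ltW.
split.
  (* Pointwise convergence is the uniform estimate at [s = 0], where both paths are 1. *)
  move=> t t01 w; apply/cvgrPdist_le => e e0.
  have z0 := tnorm_ge0 (Y t); have Gt := GY t t01.
  have [d d0 Hd] := tnorm_small N_norm (divr_gt0 e0 (ltr_wpDr z0 ltr01)).
  have [n0 Hn] := holder_uniform N_norm al0 GY' H0 B0 HY d0.
  exists n0 => // n /= n0n; have [_ sigX _ XB XY] := HX n.
  have [t0 t1] : 0 <= t /\ t <= 1 by move: t01; rewrite in_itv => /andP[].
  have X0 : X n 0 = 1 by have := XY 0%N isT; rewrite /grid mul0r Y0.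
  have := Hn n (X n) n0n (GX n) XB XY 0 t (lexx _) t0 t1.
  rewrite X0 Y0 invr1 !mul1r hnorm_incrC // => /(Hd _ (free_group_incr Gt (GX n t))) XYe.
  rewrite sigX // distrC -tcoefB (le_trans (ler_tcoef_tnorm _ _)) //.
  have -> : X n t - Y t = Y t * ((Y t)^-1 * X n t - 1).
    by rewrite mulrBr mulr1 mulrA mulrV ?mul1r // free_group_unit.
  rewrite (le_trans (ler_tnormM _ _)) // (le_trans (ler_wpM2l z0 XYe)) //.
  by rewrite mulrCA ler_piMr ?(ltW e0) // ler_pdivrMr ?ltr_wpDr // mul1r lerDr.
move=> be be0 beal.
have dist_le e : 0 < e -> exists n0, forall n, (n0 <= n)%N ->
    (holder_dist N be (signature_path m (y n)) Y <= e%:E)%E.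
  move=> e0; pose Z := B + H.
  have Z0 : 0 < 1 + Z by rewrite ltr_pwDl // addr_ge0.
  have ab : 0 < al - be by rewrite subr_gt0.
  (* The threshold of the interpolation. For [t - s <= r] the two Hölder bounds give
     [Z * r^(al - be) <= e] times [(t - s)^be]; for [t - s > r] the uniform distance [e * r^be] is
     at most [e * (t - s)^be]. *)
  pose r := (e / (1 + Z)) `^ (al - be)^-1.
  have eZ : 0 < e / (1 + Z) by rewrite divr_gt0.
  have r0 : 0 < r by apply: powR_gt0.
  have rE : r `^ (al - be) = e / (1 + Z).
    by rewrite /r -powRrM mulVf ?gt_eqF // powRr1 // ltW.
  have [n0 Hn] := unif (e * r `^ be) (mulr_gt0 e0 (powR_gt0 be r0)).
  exists n0 => n n0n; apply: ub_ereal_sup => _ [s [t [s0 st t1 ->]]].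
  have ts : 0 < t - s by rewrite subr_gt0.
  rewrite lee_fin ler_pdivrMr ?powR_gt0 //.
  have [tr|rt] := leP (t - s) r; last first.
    rewrite (le_trans (Hn n n0n s t s0 st t1)) // ler_wpM2l ?(ltW e0) //.
    by apply: powR_mono => //; apply: ltW.
  have [_ _ _ XB _] := HX n.
  have GI : free_group ((X n s)^-1 * X n t) by apply: free_group_incr.
  have GI' : free_group ((Y s)^-1 * Y t).
    by apply: free_group_incr; apply: GY'; lra.
  rewrite /hdist SX // (le_trans (hnorm_mul N_norm (free_groupV GI) GI')) //.
  rewrite (hnorm_inv N_norm) //.
  rewrite (le_trans (lerD (XB s t s0 (ltW st) t1) (HY s t s0 (ltW st) t1))) //.
  rewrite -mulrDl -/Z.
  have -> : (t - s) `^ al = (t - s) `^ be * (t - s) `^ (al - be).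
    by rewrite -powRD ?(gt_eqF ts) ?implybT //; congr (_ `^ _); ring.
  rewrite mulrCA mulrC ler_wpM2r ?powR_ge0 //.
  apply: (@le_trans _ _ (Z * (e / (1 + Z)))).
    rewrite ler_wpM2l ?addr_ge0 // -rE; apply: powR_mono => //; exact: ltW.
  by rewrite mulrCA ler_piMr ?(ltW e0) // ler_pdivrMr // mul1r lerDr.
have dist_ge0 n := holder_dist_ge0 be (GS n) GY.
apply/fine_cvgP; split.
  have [n0 Hn] := dist_le 1 ltr01; exists n0 => // n /= /Hn le1.
  by rewrite ge0_fin_numE // (le_lt_trans le1) // ltry.
apply/cvgrPdist_le => e e0; have [n0 Hn] := dist_le e e0.
exists n0 => // n /= /Hn le_e.
have fn : holder_dist N be (signature_path m (y n)) Y \is a fin_num.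
  by rewrite ge0_fin_numE // (le_lt_trans le_e) // ltry.
by rewrite sub0r normrN ger0_norm ?fine_ge0 // -lee_fin fineK.
Qed.

End HolderNorm.

Theorem corollary16 (R : realType) (V : normedVectType R) (m : nat) (p : R)
    (N : ttensor V m -> R) (Y : R -> ttensor V m)
    (m_ge1 : (1 <= m)%N) (p_ge1 : 1 <= p)
    (N_norm : homogeneous_norm N) (Y_path : group_path Y) :
  (is_holder N p^-1 Y <->
     exists y : nat -> R -> V,
       [/\ forall n, smooth_path (y n),
           exists C : R, forall n,
             (holder_norm N p^-1 (signature_path m (y n)) <= C%:E)%E &
           forall t : R, t \in `[0, 1] -> forall s : seq (letter V),
             tcoef (signature_path m (y n) t) s @[n --> \oo] --> tcoef (Y t) s])
  /\
  (is_holder N p^-1 Y ->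
     exists y : nat -> R -> V,
       (forall n, smooth_path (y n)) /\
       (forall alpha' : R, 0 < alpha' -> alpha' < p^-1 ->
          holder_dist N alpha' (signature_path m (y n)) Y @[n --> \oo] --> 0%E)).
Proof.
have p0 : 0 < p by apply: lt_le_trans p_ge1.
have al0 : 0 < p^-1 by rewrite invr_gt0.
have al1 : p^-1 <= 1 by rewrite invf_le1.
have [GY Y0 _] := Y_path.
split; first split.
- move=> YH; have [y [B [sy yB [yY _]]]] := signatures_of_holder N_norm al0 al1 GY Y0 YH.
  by exists y; split=> //; exists B.
- by move=> [y [sy [C yC] yY]]; apply: (holder_of_signatures N_norm GY sy yC yY).
- move=> YH; have [y [B [sy _ [_ yY]]]] := signatures_of_holder N_norm al0 al1 GY Y0 YH.
  by exists y.
Qed.
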